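(* Let $R$ be an Archimedean real closed field, and let $A, B$ be set-germs at $0$ in $R^n$, definable in an o-minimal structure on $R$, such that $0 \in \overline{A} \cap \overline{B}$. Let $h : (R^n,0) \to (R^n,0)$ be a bi-Lipschitz homeomorphism. Suppose that $h(A)$ and $h(B)$ are also definable. Then $$\dim (D(h(A)) \cap D(h(B))) = \dim (D(A)\cap D(B)).$$
   Context: An Archimedean field is a subfield of $\mathbb{R}$; $R^n\subset\mathbb{R}^n$ carries the induced Euclidean norm and metric. An o-minimal structure on a real closed field $R$ is a sequence $\mathcal{D}=(\mathcal{D}_n)_{n\in\mathbb{N}}$ of families $\mathcal{D}_n$ of subsets of $R^n$ such that: (D1) $\mathcal{D}_n$ is a boolean algebra; (D2) if $A\in\mathcal{D}_n$ then $A\times R, R\times A\in\mathcal{D}_{n+1}$; (D3) if $A\in\mathcal{D}_{n+1}$ then $\pi(A)\in\mathcal{D}_n$, where $\pi:R^{n+1}\to R^n$ is the projection on the first $n$ coordinates; (D4) $\mathcal{D}_n$ contains the zero set of every polynomial in $R[X_1,\dots,X_n]$; (D5) each set in $\mathcal{D}_1$ is a finite union of intervals and points. A set is definable if it belongs to some $\mathcal{D}_n$. For a set-germ $A$ at $0\in R^n$ with $0\in\overline{A}$, the direction set is $$D(A)=\{a\in S^{n-1} : \exists \{x_i\}\subset A\setminus\{0\},\ x_i\to 0\in R^n \text{ such that } x_i/\|x_i\|\to a,\ i\to\infty\},$$ where $S^{n-1}\subset R^n$ is the unit sphere of $R^n$ centred at $0$ (so $a$ has coordinates in $R$). If $A$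 is definable, so is $D(A)$. A bi-Lipschitz homeomorphism $h:(R^n,0)\to(R^n,0)$ is a germ at $0$ of a homeomorphism with $h(0)=0$ for which there are $0<K_1\le K_2$ in $R$ with $K_1\|x_1-x_2\|\le\|h(x_1)-h(x_2)\|\le K_2\|x_1-x_2\|$ near $0$; $h$ itself is not assumed definable. $\dim$ is the usual dimension of definable sets in an o-minimal structure. *)

(* Defs.v *)
From mathcomp Require Import all_boot all_order all_algebra.
From mathcomp Require Import all_classical all_reals.
From mathcomp Require Import topology normedtype.
From mathcomp Require mpoly.
Export numFieldNormedType.Exports.

Set Implicit Arguments.
Unset Strict Implicit.
Unset Printing Implicit Defensive.
Import Order.TTheory GRing.Theory Num.Theory.
Local Open Scope classical_set_scope.
Local Open Scope ring_scope.

(* R^n is 'rV[R]_n. Its MathComp-Analysis topology (induced by the sup norm) is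
   the topology of the Euclidean metric; the Euclidean norm itself is enorm. *)
Definition enorm (R : rcfType) (n : nat) (x : 'rV[R]_n) : R :=
  Num.sqrt (\sum_(i < n) x 0 i ^+ 2).

Definition sphere (R : rcfType) (n : nat) : set 'rV[R]_n :=
  [set a | enorm a = 1].

Definition proj_init (R : rcfType) (n : nat) (x : 'rV[R]_n.+1) : 'rV[R]_n :=
  col' ord_max x.

Definition proj_tail (R : rcfType) (n : nat) (x : 'rV[R]_n.+1) : 'rV[R]_n :=
  col' ord0 x.

Definition zero_set (R : rcfType) (n : nat) (p : mpoly.mpoly n R) :
    set 'rV[R]_n :=
  [set x | mpoly.meval (fun i => x 0 i) p = 0].

Definition set_family (R : rcfType) := forall n : nat, set (set 'rV[R]_n).

(* The type interval R has endpoints in R together with -oo and +oo and contains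
   the degenerate intervals `[a, a], that is, the points. *)
Record o_minimal (R : rcfType) (D : set_family R) : Prop := OMinimal {
  omin_set0 : forall n, D n set0;
  omin_setU : forall n (A B : set 'rV[R]_n), D n A -> D n B -> D n (A `|` B);
  omin_setC : forall n (A : set 'rV[R]_n), D n A -> D n (~` A);
  omin_cylr : forall n (A : set 'rV[R]_n), D n A ->
    D n.+1 [set x | A (proj_init x)];
  omin_cyll : forall n (A : set 'rV[R]_n), D n A ->
    D n.+1 [set x | A (proj_tail x)];
  omin_proj : forall n (A : set 'rV[R]_n.+1), D n.+1 A ->
    D n (@proj_init R n @` A);
  omin_poly : forall n (p : mpoly.mpoly n R), D n (zero_set p);
  omin_line : forall A : set 'rV[R]_1, D 1%N A ->
    exists s : seq (interval R),
      A = [set x | exists2 i : interval R, i \in s & x 0 0 \in i]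
}.

Definition graph_on (R : rcfType) (n : nat) (X : set 'rV[R]_n)
    (f : 'rV[R]_n -> R) : set 'rV[R]_n.+1 :=
  [set x | X (proj_init x) /\ x 0 ord_max = f (proj_init x)].

Definition definable_continuous (R : rcfType) (D : set_family R) (n : nat)
    (X : set 'rV[R]_n) (f : 'rV[R]_n -> R) : Prop :=
  D n.+1 (graph_on X f) /\ {within X, continuous f}.

(* A bound of a band is a continuous definable function on the base, or None
   for the constant -oo (lower bound) or +oo (upper bound). *)
Definition definable_bound (R : rcfType) (D : set_family R) (n : nat)
    (X : set 'rV[R]_n) (f : option ('rV[R]_n -> R)) : Prop :=
  if f is Some g then definable_continuous D X g else True.

Definition band (R : rcfType) (n : nat) (X : set 'rV[R]_n)
    (f g : option ('rV[R]_n -> R)) : set 'rV[R]_n.+1 :=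
  [set x | [/\ X (proj_init x),
              (if f is Some f' then f' (proj_init x) < x 0 ord_max else True) &
              (if g is Some g' then x 0 ord_max < g' (proj_init x) else True)]].

(* cell D d C: C is an (i_1, ..., i_n)-cell of R^n with d = i_1 + ... + i_n.
   The recursion starts at the one-point space R^0, the cell of empty type: over
   it, graphs are the points of R and bands are the open intervals. *)
Inductive cell (R : rcfType) (D : set_family R) :
    forall n : nat, nat -> set 'rV[R]_n -> Prop :=
| cell_nil : cell D 0 (@setT 'rV[R]_0)
| cell_graph (n d : nat) (X : set 'rV[R]_n) (f : 'rV[R]_n -> R) of
    cell D d X & definable_continuous D X f :
    cell D d (graph_on X f)
| cell_band (n d : nat) (X : set 'rV[R]_n) (f g : option ('rV[R]_n -> R)) of
    cell D d X & definable_bound D X f & definable_bound D X g &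
    (forall f' g', f = Some f' -> g = Some g' ->
       forall x, X x -> f' x < g' x) :
    cell D d.+1 (band X f g).

(* The largest d such that X contains a cell of dimension d (van den Dries), with
   value -oo when X contains no cell, that is, when X is empty. A cell of R^n
   has d <= n, so the range of d loses nothing. *)
Definition definable_dim (R : rcfType) (D : set_family R) (n : nat)
    (X : set 'rV[R]_n) : \bar int :=
  \big[maxe/-oo%E]_(d < n.+1 | `[< exists2 C, cell D d C & C `<=` X >])
    (Posz d)%:E.

(* A set-germ at 0 is given by a representative A : set 'rV[R]_n; it is definable
   when some representative of the same germ is. *)
Definition definable_germ (R : rcfType) (D : set_family R) (n : nat)
    (A : set 'rV[R]_n) : Prop :=
  exists2 A' : set 'rV[R]_n, D n A' & \forall x \near (0 : 'rV[R]_n), A x <-> A' x.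

Definition adherent0 (R : rcfType) (n : nat) (A : set 'rV[R]_n) : Prop :=
  closure A (0 : 'rV[R]_n).

Definition direction_set (R : rcfType) (n : nat) (A : set 'rV[R]_n) :
    set 'rV[R]_n :=
  [set a | sphere a /\
    exists x : nat -> 'rV[R]_n,
      [/\ forall k, (A `\ 0) (x k),
          x k @[k --> \oo] --> (0 : 'rV[R]_n) &
          (enorm (x k))^-1 *: x k @[k --> \oo] --> a]].

Definition homeomorphism_on (R : rcfType) (n : nat) (U V : set 'rV[R]_n)
    (h : 'rV[R]_n -> 'rV[R]_n) : Prop :=
  [/\ set_bij U V h, {within U, continuous h} &
      exists2 g : 'rV[R]_n -> 'rV[R]_n,
        {within V, continuous g} & forall x, U x -> g (h x) = x].

(* The germ at 0 of h : U -> V, where U and V are open neighbourhoods of 0; the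
   values of h outside U are irrelevant. *)
Definition bilipschitz_homeo_germ (R : rcfType) (n : nat) (U V : set 'rV[R]_n)
    (h : 'rV[R]_n -> 'rV[R]_n) : Prop :=
  [/\ open_nbhs (0 : 'rV[R]_n) U, open_nbhs (0 : 'rV[R]_n) V,
      homeomorphism_on U V h, h 0 = 0 &
      exists K1 K2 : R, [/\ 0 < K1, K1 <= K2 &
        exists2 W : set 'rV[R]_n, nbhs (0 : 'rV[R]_n) W &
          W `<=` U /\
          forall x1 x2, W x1 -> W x2 ->
            K1 * enorm (x1 - x2) <= enorm (h x1 - h x2) <=
            K2 * enorm (x1 - x2)]].

Definition germ_image (R : rcfType) (n : nat) (U : set 'rV[R]_n)
    (h : 'rV[R]_n -> 'rV[R]_n) (A : set 'rV[R]_n) : set 'rV[R]_n :=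
  h @` (A `&` U).

(* Main.v *)
Require Import Defs.
From mathcomp Require Import all_boot all_order all_algebra archimedean.
From mathcomp Require Import all_classical all_reals.
From mathcomp Require Import topology normedtype.
From mathcomp Require Import lra ring zify.
From mathcomp Require Import (canonicals) mpoly.
Import numFieldNormedType.Exports.

Set Implicit Arguments.
Unset Strict Implicit.
Unset Printing Implicit Defensive.
Import Order.TTheory GRing.Theory Num.Theory.
Local Open Scope classical_set_scope.
Local Open Scope ring_scope.

(** Let [M] be the set of common directions of [A] and [B], and [M'] that of
    their images under [h].  The proof shows, for every [k], that [M] has
    dimension at least [k] if and only if [M'] has.

    Geometry.  Let [w] lie on the cone over [M].  At every small scale [t],
    both [A] and [B] have points within [o(t)] of [t w]: the scales at which
    this holds form a definable subset of the line that accumulates at 0, and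
    such a set contains an interval [(0, t0)] (lemma [sequence_selection]).
    The images under [h] of these two points are within [o(t)] of each other,
    so by definable compactness they are within [o(t)] of the cone over [M']
    (lemma [common_direction]).  Dividing by [t] one obtains, for each finite
    subset of the cone over [M], a map into the cone over [M'] that is
    bi-Lipschitz up to an additive error as small as one likes (lemma
    [direction_transfer]).  As [R] is in general not complete, the blow-ups
    [h(t x)/t] need not have a limit; finite subsets and additive errors take
    the place of that limit.  The germ of the inverse of [h] gives the other
    direction.

    Topology.  Such approximate embeddings do not lower the dimension (theorem
    [sdim_ge_approx]); this is Lebesgue's covering dimension in finite form.
    A bounded definable set of dimension less than [k] stays away from all the
    codimension [k] planes of a well-chosen grid of mesh [r] (lemma
    [generic_grid]).  Such a set is a union of [k] families of small pieces,
    where distinct pieces of one family are a fixed distance apart: a point is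
    put in family [i] when it is close to [i] grid hyperplanes and fairly far
    from the others.  If the domain contains a [k]-dimensional box, the
    approximate embedding of a fine grid of this box thus colours that grid
    with [k] colours, in such a way that no piece of colour [i] reaches both
    faces orthogonal to the direction [i].  The discrete Poincare-Miranda
    theorem excludes such a colouring.

    Model theory.  A definable set has dimension at least [k] when, for some
    choice of quantifiers [exists] or [for infinitely many] on the
    coordinates, [k] of them of the second kind, the point thus quantified is
    in the set.  This notion is additive under unions and definable in
    families.  What o-minimality adds is a uniformity principle (lemma
    [inf_fiber_param]): if each of infinitely many [y] satisfies [P y c] for
    some [c > 0], and [P] is decreasing in [c], then a single [c] serves
    infinitely many [y].  Combined with finite grids, which exist as [R] is
    archimedean, it yields the exchange of two infinite quantifiers, hence the
    invariance under permutations of the coordinates and under definable maps;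
    it yields that the discontinuities of a definable function form a set of
    smaller dimension; and from these, that a definable set has dimension at
    least [k] if and only if it contains a [k]-cell ([sdim_ge_cell],
    [cell_sdim_ge]). *)

(** * Definability of first-order formulas *)

(** Formulas are interpreted in environments.  Variable 0 is the innermost
    one and stands for the last coordinate, so that the projection axiom of
    o-minimal structures is quantification over variable 0. *)
Definition env (R : Type) := nat -> R.

Definition scons (R : Type) (y : R) (e : env R) : env R :=
  fun i => if i is j.+1 then e j else y.

Definition tl (R : Type) (e : env R) : env R := fun i => e i.+1.

Definition drop_env (R : Type) (m : nat) (e : env R) : env R :=
  fun i => e (m + i)%N.

Definition cat_env (R : Type) (m : nat) (y e : env R) : env R :=
  fun i => if (i < m)%N then y i else e (i - m)%N.

Definition rvec (R : Type) (n : nat) (e : env R) : 'rV[R]_n :=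
  \row_i e (n - i.+1)%N.

Lemma tl_scons R (y : R) e : tl (scons y e) = e.
Proof. by []. Qed.

Lemma scons_tl R (e : env R) : scons (e 0%N) (tl e) = e.
Proof. by apply: funext => -[]. Qed.

Lemma cat_env0 R (y e : env R) : cat_env 0 y e = e.
Proof. by apply: funext => i; rewrite /cat_env ltn0 subn0. Qed.

Lemma cat_envS R m (y e : env R) :
  cat_env m.+1 y e = scons (y 0%N) (cat_env m (tl y) e).
Proof. by apply: funext => -[]. Qed.

Lemma cat_env_drop R m (e : env R) : cat_env m e (drop_env m e) = e.
Proof.
apply: funext => i; rewrite /cat_env /drop_env.
by case: ltnP => // h; rewrite subnKC.
Qed.

Lemma drop_env_cat R m (y e : env R) : drop_env m (cat_env m y e) = e.
Proof.
apply: funext => i; rewrite /cat_env /drop_env.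
by rewrite ltnNge leq_addr addKn.
Qed.

Lemma sub_rev i n : (i < n)%N -> (n - (n - i.+1).+1)%N = i.
Proof. by move=> h; lia. Qed.

Lemma rvec_ext (R : Type) n (e e' : env R) :
  (forall i, (i < n)%N -> e i = e' i) -> rvec n e = rvec n e'.
Proof. by move=> h; apply/rowP => i; rewrite !mxE; apply: h; move: (ltn_ord i) => hi; lia. Qed.

Lemma rvec_cat (R : Type) n (y e : env R) : rvec n (cat_env n y e) = rvec n y.
Proof. by apply: rvec_ext => i h; rewrite /cat_env h. Qed.

Lemma rvecP (R : Type) (c : R) n (x : 'rV[R]_n) : exists e, rvec n e = x.
Proof.
exists (fun i => if insub (n - i.+1)%N is Some j then x 0 j else c).
apply/rowP => i; rewrite mxE.
have hi := sub_rev (ltn_ord i).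
rewrite hi insubT // => h; congr (x _ _); exact: val_inj.
Qed.

Lemma proj_init_rvec (R : rcfType) n (e : env R) :
  proj_init (rvec n.+1 e) = rvec n (tl e).
Proof.
apply/rowP => i; rewrite !mxE /tl /=; congr e.
by rewrite /bump leqNgt ltn_ord /=; move: (ltn_ord i) => hi; lia.
Qed.

Lemma proj_tail_rvec (R : rcfType) n (e : env R) :
  proj_tail (rvec n.+1 e) = rvec n e.
Proof. by apply/rowP => i; rewrite !mxE /=; congr e; rewrite /bump /=; lia. Qed.

Lemma rvec_last (R : Type) n (e : env R) : rvec n.+1 e 0 ord_max = e 0%N.
Proof. by rewrite mxE /= subnn. Qed.

Section Definable.
Variables (R : archiRcfType) (D : set_family R).
Hypothesis oD : o_minimal D.

(** The number of variables is recorded because the axioms only project along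
    the last coordinate of [R^m.+1]; [dset_D] uses it to recover membership in
    the structure with the right number of coordinates. *)
Definition dsr m (P : env R -> Prop) : Prop :=
  exists2 X : set 'rV[R]_m, D X & forall e, P e <-> X (rvec m e).

Definition dset (P : env R -> Prop) : Prop := exists m, dsr m P.

Lemma dsr_ext m P Q : dsr m P -> (forall e, P e <-> Q e) -> dsr m Q.
Proof. by move=> [X DX h] PQ; exists X => // e; rewrite -PQ. Qed.

Lemma dset_ext P Q : dset P -> (forall e, P e <-> Q e) -> dset Q.
Proof. by move=> [m h] PQ; exists m; apply: dsr_ext PQ. Qed.

Lemma dsrN m P : dsr m P -> dsr m (fun e => ~ P e).
Proof.
move=> [X DX h]; exists (~` X); first exact: (omin_setC oD).
by move=> e; rewrite h.
Qed.

Lemma dsr_widen m n P : (m <= n)%N -> dsr m P -> dsr n P.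
Proof.
move=> /subnK <-; elim: (n - m)%N => [|k IH] // /IH [X DX h].
exists [set x | X (proj_tail x)]; first exact: (omin_cyll oD).
by move=> e; rewrite h -[in X in X <-> _]proj_tail_rvec.
Qed.

Lemma dsr_or m P Q : dsr m P -> dsr m Q -> dsr m (fun e => P e \/ Q e).
Proof.
move=> [X DX h] [Y DY h'].
exists (X `|` Y); first exact: (omin_setU oD).
by move=> e; rewrite h h'.
Qed.

Lemma dsr_and m P Q : dsr m P -> dsr m Q -> dsr m (fun e => P e /\ Q e).
Proof.
move=> /dsrN dP /dsrN dQ; apply: (dsr_ext (dsrN (dsr_or dP dQ))) => e.
by rewrite not_orE !notK.
Qed.

Lemma dsr_const m (p : Prop) : dsr m (fun=> p).
Proof.
have [hp|hp] := pselect p.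
  exists (~` set0); first exact/(omin_setC oD)/(omin_set0 oD).
  by move=> e; split => // _ [].
by exists set0; [exact: (omin_set0 oD)|move=> e; split].
Qed.

Lemma dsr_Ex m P : dsr m.+1 P -> dsr m (fun e => exists y, P (scons y e)).
Proof.
move=> [Y DY h].
exists (@proj_init R m @` Y); first exact: (omin_proj oD).
move=> e; split => [[y]|[x Yx ex]].
  rewrite h => Yy; exists (rvec m.+1 (scons y e)) => //.
  by rewrite proj_init_rvec.
have [e' ee'] := rvecP 0 x.
exists (e' 0%N); rewrite h.
suff -> : rvec m.+1 (scons (e' 0%N) e) = x by [].
rewrite -ee'; apply: rvec_ext => -[|i] // hi /=.
move: ex; rewrite -ee' proj_init_rvec => /rowP /(_ (rev_ord (Ordinal (hi : (i < m)%N)))).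
by rewrite !mxE /= /tl sub_rev.
Qed.

Lemma dsr_Exm m n P : dsr (m + n) P ->
  dsr n (fun e => exists y : env R, P (cat_env m y e)).
Proof.
elim: m P => [|m IH] P dP.
  apply: (dsr_ext dP) => e; split => [Pe|[y]]; last by rewrite cat_env0.
  by exists e; rewrite cat_env0.
apply: (dsr_ext (IH _ (dsr_Ex dP))) => e; split => [[y [a Pa]]|[y]].
  by exists (scons a y); rewrite cat_envS.
by rewrite cat_envS => Py; exists (tl y), (y 0%N).
Qed.

Lemma dsr_eqv n i j : (i < n)%N -> (j < n)%N -> dsr n (fun e => e i = e j).
Proof.
move=> i_n j_n.
have hi : (n - i.+1 < n)%N by lia.
have hj : (n - j.+1 < n)%N by lia.
pose X a := mpoly.mpolyX R (mpoly.mnm1 (a : 'I_n)).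
exists (zero_set (X (Ordinal hi) - X (Ordinal hj))); first exact: (omin_poly oD).
move=> e; rewrite /zero_set /= mpoly.mevalB !mpoly.mevalXU !mxE /=.
rewrite !sub_rev //; split => [->|/eqP]; first by rewrite subrr.
by rewrite subr_eq0 => /eqP.
Qed.

Lemma dsr_all_ord m n (P : 'I_n -> env R -> Prop) :
  (forall i, dsr m (P i)) -> dsr m (fun e => forall i, P i e).
Proof.
elim: n P => [|n IH] P dP.
  by apply: (dsr_ext (dsr_const m True)) => e; split => // _ [].
apply: (dsr_ext (dsr_and (dP ord_max) (IH (fun i => P (widen_ord (leqnSn n) i)) (fun i => dP _)))).
move=> e; split => [[h0 h] i|h]; last by split => // i; apply: h.
have [hi|hi] := ltnP i n.
  have := h (Ordinal hi); congr (P _ e); exact: val_inj.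
suff -> : i = ord_max by [].
by apply: val_inj => /=; move: (ltn_ord i) => h'; lia.
Qed.

(** Renaming is introduced by fresh variables [y_i] with [y_i = e (s i)], which
    are then projected away. *)
Lemma dsr_rename m n (s : nat -> nat) P : (forall i, (i < m)%N -> (s i < n)%N) ->
  dsr m P -> dsr n (fun e => P (fun i => e (s i))).
Proof.
move=> hs dP; have [X DX h] := dP.
have d1 : dsr (m + n) (fun e => forall i : 'I_m, e i = e (m + s i)%N).
  apply: dsr_all_ord => i; apply: dsr_eqv.
    by rewrite ltn_addr.
  by rewrite ltn_add2l hs.
apply: (dsr_ext (dsr_Exm (dsr_and (dsr_widen (leq_addr n m) dP) d1))) => e; split.
  move=> [y [Py hy]]; rewrite h.
  move: Py; rewrite h; congr X; apply: rvec_ext => i hi.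
  have /= -> := hy (Ordinal hi).
  by rewrite /cat_env ltnNge leq_addr addKn.
move=> Pe; exists (fun i => e (s i)); split.
  by rewrite h rvec_cat -h.
move=> i; rewrite /cat_env ltn_ord.
by rewrite ltnNge leq_addr addKn.
Qed.

(** A formula in which only the first [n] variables matter may have been built
    with more of them; identifying the superfluous ones with variable 0 brings
    it back to [R^n]. *)
Lemma dset_D n (X : set 'rV[R]_n) : dset (fun e => X (rvec n e)) -> D X.
Proof.
move=> [m dX].
have [Y DY h] : dsr n (fun e => X (rvec n e)).
  case: n X dX => [|n] X dX.
    apply: (dsr_ext (dsr_const 0 (X 0))) => e.
    by rewrite [rvec 0 e]thinmx0.
  have hs i : (i < m)%N -> ((if i < n.+1 then i else 0) < n.+1)%N by case: ifP.
  apply: (dsr_ext (dsr_rename hs dX)) => e.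
  suff -> : rvec n.+1 (fun i => e (if (i < n.+1)%N then i else 0%N)) = rvec n.+1 e by [].
  by apply: rvec_ext => i ->.
suff -> : X = Y by [].
by apply/seteqP; split => x; have [y <-] := rvecP 0 x; rewrite h.
Qed.

Lemma dsetN P : dset P -> dset (fun e => ~ P e).
Proof. by move=> [m dP]; exists m; exact: dsrN. Qed.

Lemma dset_or P Q : dset P -> dset Q -> dset (fun e => P e \/ Q e).
Proof.
move=> [m dP] [n dQ]; exists (m + n)%N; apply: dsr_or.
  exact: dsr_widen (leq_addr _ _) dP.
exact: dsr_widen (leq_addl _ _) dQ.
Qed.

Lemma dset_and P Q : dset P -> dset Q -> dset (fun e => P e /\ Q e).
Proof.
move=> [m dP] [n dQ]; exists (m + n)%N; apply: dsr_and.
  exact: dsr_widen (leq_addr _ _) dP.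
exact: dsr_widen (leq_addl _ _) dQ.
Qed.

Lemma dset_imp P Q : dset P -> dset Q -> dset (fun e => P e -> Q e).
Proof.
move=> /dsetN dP dQ; apply: (dset_ext (dset_or dP dQ)) => e.
by rewrite implyE.
Qed.

Lemma dset_const (p : Prop) : dset (fun=> p).
Proof. by exists 0%N; exact: dsr_const. Qed.

Lemma dset_Ex P : dset P -> dset (fun e => exists y, P (scons y e)).
Proof.
by move=> [m dP]; exists m; apply: dsr_Ex; exact: dsr_widen (leqnSn m) dP.
Qed.

Lemma dset_Exm m P : dset P -> dset (fun e => exists y : env R, P (cat_env m y e)).
Proof.
by move=> [n dP]; exists n; apply: dsr_Exm; exact: dsr_widen (leq_addl m n) dP.
Qed.

Lemma dset_eqv i j : dset (fun e => e i = e j).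
Proof. by exists (i + j).+1; apply: dsr_eqv; rewrite ltnS (leq_addl, leq_addr). Qed.

Lemma dset_all_ord n (P : 'I_n -> env R -> Prop) :
  (forall i, dset (P i)) -> dset (fun e => forall i, P i e).
Proof.
elim: n P => [|n IH] P dP.
  by apply: (dset_ext (dset_const True)) => e; split => // _ [].
apply: (dset_ext (dset_and (dP ord_max) (IH (fun i => P (widen_ord (leqnSn n) i)) (fun i => dP _)))).
move=> e; split => [[h0 h] i|h]; last by split => // i; apply: h.
have [hi|hi] := ltnP i n.
  have := h (Ordinal hi); congr (P _ e); exact: val_inj.
suff -> : i = ord_max by [].
by apply: val_inj => /=; move: (ltn_ord i) => h'; lia.
Qed.

Lemma dset_rename (s : nat -> nat) P : dset P -> dset (fun e => P (fun i => e (s i))).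
Proof.
move=> [m dP]; exists (\max_(i < m) (s i).+1); apply: dsr_rename dP => i hi.
exact: (leq_bigmax (Ordinal hi)).
Qed.

Lemma dset_poly n (p : mpoly.mpoly n R) :
  dset (fun e => mpoly.meval (fun i : 'I_n => e (n - i.+1)%N) p = 0).
Proof.
exists n, (zero_set p); first exact: (omin_poly oD).
move=> e; rewrite /zero_set /=.
suff -> : (fun i => rvec n e 0 i) = (fun i : 'I_n => e (n - i.+1)%N) by [].
by apply: funext => i; rewrite mxE.
Qed.

Definition dfun (t : env R -> R) : Prop := dset (fun e => e 0%N = t (tl e)).

Lemma dset_graph i m t : dfun t -> dset (fun e => e i = t (drop_env m e)).
Proof.
move=> dt; have := dset_rename (fun j => if j is j'.+1 then m + j' else i)%N dt.
by move=> /dset_ext; apply => e.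
Qed.

Lemma dset_subst (t : nat -> env R -> R) P : dset P -> (forall i, dfun (t i)) ->
  dset (fun e => P (fun i => t i e)).
Proof.
move=> dP dt; have [n [X DX h]] := dP.
have d1 : dset (fun e => forall i : 'I_n, e i = t i (drop_env n e)).
  by apply: dset_all_ord => i; apply: dset_graph.
apply: (dset_ext (dset_Exm n (dset_and dP d1))) => e; split.
  move=> [y [Py hy]]; rewrite h.
  move: Py; rewrite h; congr X; apply: rvec_ext => i hi.
  by have /= -> := hy (Ordinal hi); rewrite drop_env_cat.
move=> Pe; exists (fun i => t i e); split.
  by rewrite h rvec_cat -h.
by move=> i; rewrite drop_env_cat /cat_env ltn_ord.
Qed.

Lemma dset_vec n (X : set 'rV[R]_n) (v : env R -> 'rV[R]_n) : D X ->
  (forall i, dfun (fun e => v e 0 i)) -> dset (fun e => X (v e)).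
Proof.
move=> DX dv.
have d0 : dset (fun e => X (rvec n e)) by exists n, X.
pose t (i : nat) (e : env R) := if insub (n - i.+1)%N is Some j then v e 0 j else e 0%N.
have dt i : dfun (t i).
  rewrite /t; case: insub => [j|]; first exact: dv.
  exact: dset_eqv 0%N 1%N.
apply: (dset_ext (dset_subst d0 dt)) => e.
suff -> : rvec n (fun i => t i e) = v e by [].
apply/rowP => i; rewrite mxE /t.
have hi := sub_rev (ltn_ord i).
rewrite hi insubT // => h; congr (v e _ _); exact: val_inj.
Qed.

Lemma dfun_var i : dfun (fun e => e i).
Proof. exact: dset_eqv 0%N i.+1. Qed.

Lemma dset_subst2 t u P : dset P -> dfun t -> dfun u ->
  dset (fun e => P (scons (t e) (scons (u e) e))).
Proof.
move=> dP dt du.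
apply: (dset_ext (dset_subst (t := fun i e => scons (t e) (scons (u e) e) i) dP _)) => // i.
by case: i => [|[|i]]; [exact: dt|exact: du|exact: dfun_var].
Qed.

Lemma dset_eq t u : dfun t -> dfun u -> dset (fun e => t e = u e).
Proof.
by move=> dt du; apply: (dset_subst2 (P := fun e => e 0%N = e 1%N) (dset_eqv 0 1) dt du).
Qed.

Let X3 (a : nat) (h : (a < 3)%N) := mpoly.mpolyX R (mpoly.mnm1 (Ordinal h)).

Lemma dset_addv : dset (fun e => e 2%N = e 0%N + e 1%N).
Proof.
have := dset_poly (@X3 0 isT - (@X3 2 isT + @X3 1 isT)).
move=> /dset_ext; apply => e.
rewrite mpoly.mevalB mpoly.mevalD !mpoly.mevalXU /=.
split => [/eqP|->]; last by rewrite subrr.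
by rewrite subr_eq0 => /eqP.
Qed.

Lemma dset_mulv : dset (fun e => e 2%N = e 0%N * e 1%N).
Proof.
have := dset_poly (@X3 0 isT - (@X3 2 isT * @X3 1 isT)).
move=> /dset_ext; apply => e.
rewrite mpoly.mevalB mpoly.mevalM !mpoly.mevalXU /=.
split => [/eqP|->]; last by rewrite subrr.
by rewrite subr_eq0 => /eqP.
Qed.

Lemma dfun_const c : dfun (fun=> c).
Proof.
have := dset_poly (mpoly.mpolyX R (mpoly.mnm1 (@ord0 0)) - mpoly.mpolyC 1 c).
move=> /dset_ext; apply => e.
rewrite mpoly.mevalB mpoly.mevalC mpoly.mevalXU /=.
split => [/eqP|->]; last by rewrite subrr.
by rewrite subr_eq0 => /eqP.
Qed.

Lemma dfun_tl t : dfun t -> dfun (fun e => t (tl e)).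
Proof. exact: dset_graph 0%N 2%N t. Qed.

Lemma dfunD t u : dfun t -> dfun u -> dfun (fun e => t e + u e).
Proof.
move=> dt du; exact: (dset_subst2 dset_addv (dfun_tl dt) (dfun_tl du)).
Qed.

Lemma dfunM t u : dfun t -> dfun u -> dfun (fun e => t e * u e).
Proof.
move=> dt du; exact: (dset_subst2 dset_mulv (dfun_tl dt) (dfun_tl du)).
Qed.

Lemma dfunN t : dfun t -> dfun (fun e => - t e).
Proof.
move=> dt; apply: (dset_ext (dfunM (dfun_const (-1)) dt)) => e.
by rewrite mulN1r.
Qed.

Lemma dset_all P : dset P -> dset (fun e => forall y, P (scons y e)).
Proof.
move=> /dsetN /dset_Ex /dsetN /dset_ext; apply => e.
by split => [h y|h [y]]; [apply: contrapT => h'; apply: h; exists y|apply; exact: h].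
Qed.

Lemma dset_exists (P : R -> env R -> Prop) :
  dset (fun e => P (e 0%N) (tl e)) -> dset (fun e => exists y, P y e).
Proof. by move=> /dset_Ex. Qed.

Lemma dset_exists2 (P Q : R -> env R -> Prop) :
  dset (fun e => P (e 0%N) (tl e)) -> dset (fun e => Q (e 0%N) (tl e)) ->
  dset (fun e => exists2 y, P y e & Q y e).
Proof.
move=> dP dQ; apply: (dset_ext (dset_Ex (dset_and dP dQ))) => e.
by split => [[y []]|[y]]; exists y.
Qed.

Lemma dset_forall (P : R -> env R -> Prop) :
  dset (fun e => P (e 0%N) (tl e)) -> dset (fun e => forall y, P y e).
Proof. by move=> /dset_all. Qed.

Lemma dset_existsv n (P : 'rV[R]_n -> env R -> Prop) :
  dset (fun e => P (rvec n e) (drop_env n e)) -> dset (fun e => exists x, P x e).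
Proof.
move=> /(dset_Exm n) /dset_ext; apply => e; split => [[y]|[x]].
  by rewrite drop_env_cat rvec_cat => Py; exists (rvec n y).
have [y <-] := rvecP 0 x => Py; exists y.
by rewrite drop_env_cat rvec_cat.
Qed.

Lemma dset_forallv n (P : 'rV[R]_n -> env R -> Prop) :
  dset (fun e => P (rvec n e) (drop_env n e)) -> dset (fun e => forall x, P x e).
Proof.
move=> /dsetN /(dset_existsv (P := fun x e => ~ P x e)) /dsetN /dset_ext; apply => e.
by split => [h y|h [y]]; [apply: contrapT => h'; apply: h; exists y|apply; exact: h].
Qed.

(** In a real closed field the positive elements are the nonzero squares. *)
Lemma dset_lt t u : dfun t -> dfun u -> dset (fun e => t e < u e).
Proof.
move=> dt du.
have d : dset (fun e => exists z, z * z = u e - t e /\ z * z <> 0).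
  apply: dset_exists; apply: dset_and.
    apply: dset_eq; first by apply: dfunM; exact: (dfun_var 0).
    by apply: dfunD; [|apply: dfunN]; apply: dfun_tl.
  apply: dsetN; apply: dset_eq; last exact: dfun_const.
  by apply: dfunM; exact: (dfun_var 0).
apply: (dset_ext d) => e; rewrite -subr_gt0; split.
  move=> [z [<-]] /eqP; rewrite -expr2 exprn_even_gt0 //=.
  by rewrite sqrf_eq0.
move=> h; exists (Num.sqrt (u e - t e)); rewrite -expr2 sqr_sqrtr ?ltW //.
by split => //; apply/eqP; rewrite gt_eqF.
Qed.

Lemma dset_le t u : dfun t -> dfun u -> dset (fun e => t e <= u e).
Proof.
move=> dt du; apply: (dset_ext (dsetN (dset_lt du dt))) => e.
by rewrite leNgt; split => /negP.
Qed.

Lemma dfun_abs t : dfun t -> dfun (fun e => `|t e|).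
Proof.
move=> dt.
have dt' := dfun_tl dt.
have v := dfun_var 0.
have d : dset (fun e => 0 <= e 0%N /\ (e 0%N = t (tl e) \/ e 0%N = - t (tl e))).
  apply: dset_and; first by apply: dset_le => //; exact: dfun_const.
  by apply: dset_or; apply: dset_eq => //; apply: dfunN.
apply: (dset_ext d) => e; split; last first.
  move=> ->; split; first exact: normr_ge0.
  have [h|h] := lerP 0 (t (tl e)); first by left; rewrite ?ger0_norm.
  by right; rewrite ?ltr0_norm.
move=> [h0 [h|h]]; first by rewrite -h ger0_norm.
by rewrite -[t _]opprK -h normrN ger0_norm.
Qed.

Lemma dfun_sqrt t : dfun t -> dfun (fun e => Num.sqrt (t e)).
Proof.
move=> dt.
have dt' := dfun_tl dt.
have v := dfun_var 0.
have c0 := dfun_const 0.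
have d : dset (fun e => (0 <= t (tl e) /\ 0 <= e 0%N /\ e 0%N * e 0%N = t (tl e))
    \/ (t (tl e) < 0 /\ e 0%N = 0)).
  apply: dset_or; apply: dset_and; [|apply: dset_and| |];
  by first [exact: dset_le|exact: dset_lt|exact: dset_eq|apply: dset_eq => //; exact: dfunM].
apply: (dset_ext d) => e; split.
  move=> [[h1 [h2 <-]]|[h ->]]; last by rewrite ler0_sqrtr // ltW.
  by rewrite -expr2 sqrtr_sqr ger0_norm.
move=> ->; have [h|h] := lerP 0 (t (tl e)); [left|right]; split => //.
  by rewrite sqrtr_ge0 -expr2 sqr_sqrtr.
by rewrite ler0_sqrtr // ltW.
Qed.

Lemma dfun_sum n (t : 'I_n -> env R -> R) : (forall i, dfun (t i)) ->
  dfun (fun e => \sum_i t i e).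
Proof.
elim: n t => [|n IH] t dt.
  by apply: (dset_ext (dfun_const 0)) => e; rewrite big_ord0.
apply: (dset_ext (dfunD (IH (fun i => t (widen_ord (leqnSn n) i)) (fun i => dt _)) (dt ord_max))).
by move=> e; rewrite big_ord_recr.
Qed.

Lemma dfun_enorm n (v : env R -> 'rV[R]_n) :
  (forall i, dfun (fun e => v e 0 i)) -> dfun (fun e => enorm (v e)).
Proof.
move=> dv; apply: dfun_sqrt; apply: dfun_sum => i.
by rewrite /expr2; apply: dfunM.
Qed.

Lemma dfun_ext t u : dfun t -> t =1 u -> dfun u.
Proof. by move=> dt tu; apply: (dset_ext dt) => e; rewrite tu. Qed.

(** Shifts are the environment maps that arise when quantifiers are opened. *)
Definition is_shift (f : env R -> env R) := exists k, forall e i, f e i = e (k + i)%N.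

Lemma is_shift_id : is_shift (fun e => e).
Proof. by exists 0%N. Qed.

Lemma is_shift_tl f : is_shift f -> is_shift (fun e => tl (f e)).
Proof.
by move=> [k h]; exists k.+1 => e i; rewrite /tl h; congr e; lia.
Qed.

Lemma is_shift_drop m f : is_shift f -> is_shift (fun e => drop_env m (f e)).
Proof.
by move=> [k h]; exists (k + m)%N => e i; rewrite /drop_env h addnA.
Qed.

Lemma is_shift_tl1 : is_shift (@tl R).
Proof. exact: is_shift_tl is_shift_id. Qed.

Lemma is_shift_drop1 m : is_shift (@drop_env R m).
Proof. exact: is_shift_drop is_shift_id. Qed.

Lemma dfun_shift f i : is_shift f -> dfun (fun e => f e i).
Proof.
by move=> [k h]; apply: (dfun_ext (dfun_var (k + i))) => e; rewrite h.
Qed.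

Lemma dfun_rvec n f i : is_shift f -> dfun (fun e => rvec n (f e) 0 i).
Proof.
by move=> sf; apply: (dfun_ext (dfun_shift (n - i.+1) sf)) => e; rewrite mxE.
Qed.

Lemma dfun_addmx n (u v : env R -> 'rV[R]_n) i :
  dfun (fun e => u e 0 i) -> dfun (fun e => v e 0 i) -> dfun (fun e => (u e + v e) 0 i).
Proof. by move=> du dv; apply: (dfun_ext (dfunD du dv)) => e; rewrite mxE. Qed.

Lemma dfun_oppmx n (u : env R -> 'rV[R]_n) i :
  dfun (fun e => u e 0 i) -> dfun (fun e => (- u e) 0 i).
Proof. by move=> du; apply: (dfun_ext (dfunN du)) => e; rewrite mxE. Qed.

Lemma dfun_scalemx n (a : env R -> R) (u : env R -> 'rV[R]_n) i :
  dfun a -> dfun (fun e => u e 0 i) -> dfun (fun e => (a e *: u e) 0 i).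
Proof. by move=> da du; apply: (dfun_ext (dfunM da du)) => e; rewrite mxE. Qed.

End Definable.

Definition denv (R : archiRcfType) (D : set_family R) (f : env R -> env R) : Prop :=
  forall i, dfun D (fun e => f e i).

Section Env.
Variables (R : archiRcfType) (D : set_family R).
Hypothesis oD : o_minimal D.

Lemma dset_env f P : dset D P -> denv D f -> dset D (fun e => P (f e)).
Proof. move=> dP df; exact: (dset_subst oD (t := fun i e => f e i) dP df). Qed.

Lemma denv_scons t f : dfun D t -> denv D f -> denv D (fun e => scons (t e) (f e)).
Proof. by move=> dt df [|i] /=; [exact: dt|exact: df]. Qed.

Lemma denv_shift f : is_shift f -> denv D f.
Proof. by move=> sf i; apply: dfun_shift. Qed.

Lemma denv_const e : denv D (fun=> e).
Proof. by move=> i; apply: dfun_const. Qed.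
End Env.

Ltac shift_tac :=
  cbv beta; repeat first [exact: is_shift_id | exact: is_shift_tl1 | exact: is_shift_drop1 | apply: is_shift_tl | apply: is_shift_drop].

(** [ddef] proves definability by recursion on the syntax of a formula, from
    the definability hypotheses in the context. *)
Ltac ddef_step :=
  lazymatch goal with oD : o_minimal ?D |- _ =>
  lazymatch goal with
  | |- dset _ (fun _ => ?p) => exact: (dset_const oD)
  | |- dset _ (fun e => @?P e /\ @?Q e) => apply (@dset_and _ _ oD P Q)
  | |- dset _ (fun e => @?P e \/ @?Q e) => apply (@dset_or _ _ oD P Q)
  | |- dset _ (fun e => ~ @?P e) => apply (@dsetN _ _ oD P)
  | |- dset _ (fun e => exists x, @?P e x) =>
      first [apply (@dset_exists _ _ oD (fun x e => P e x))
            |apply (@dset_existsv _ _ oD _ (fun x e => P e x))]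
  | |- dset _ (fun e => exists2 x, @?P e x & @?Q e x) =>
      apply (@dset_exists2 _ _ oD (fun x e => P e x) (fun x e => Q e x))
  | |- dset _ (fun e => @?P e -> @?Q e) =>
      first [apply (@dset_imp _ _ oD P Q)
            |apply (@dset_forall _ _ oD (fun _ e => Q e))
            |apply (@dset_forallv _ _ oD _ (fun _ e => Q e))]
  | |- dset _ (fun e => forall x, @?P e x) =>
      first [apply (@dset_forall _ _ oD (fun x e => P e x))
            |apply (@dset_forallv _ _ oD _ (fun x e => P e x))
            |(apply (@dset_all_ord _ _ oD _ (fun x e => P e x)); intro)]
  | |- dset _ (fun e => is_true (@?t e < @?u e)) => apply (@dset_lt _ _ oD t u)
  | |- dset _ (fun e => is_true (@?t e <= @?u e)) => apply (@dset_le _ _ oD t u)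
  | |- dset _ (fun e => @?t e = @?u e) => apply (@dset_eq _ _ oD t u)
  | H : dset ?D ?P |- dset ?D ?P => exact: H
  | H : dset ?D ?P |- dset ?D (fun e => ?P (@?f e)) => apply (dset_env oD (f := f) H)
  | H : ?D ?n ?X |- dset ?D (fun e => ?X (@?v e)) => (apply (dset_vec oD (v := v) H); intro)
  | |- dfun _ (fun _ => ?c) => exact: (dfun_const oD)
  | |- dfun _ (fun e => @?t e + @?u e) => apply (@dfunD _ _ oD t u)
  | |- dfun _ (fun e => @?t e * @?u e) => apply (@dfunM _ _ oD t u)
  | |- dfun _ (fun e => - @?t e) => apply (@dfunN _ _ oD t)
  | |- dfun _ (fun e => `|@?t e|) => apply (@dfun_abs _ _ oD t)
  | |- dfun _ (fun e => enorm (@?v e)) => (apply (@dfun_enorm _ _ oD _ v); intro)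
  | |- dfun _ (fun e => fun_of_matrix (@?u e + @?v e) _ ?i) => apply (@dfun_addmx _ _ oD _ u v i)
  | |- dfun _ (fun e => fun_of_matrix (- @?u e) _ ?i) => apply (@dfun_oppmx _ _ oD _ u i)
  | |- dfun _ (fun e => fun_of_matrix (@?a e *: @?u e) _ ?i) => apply (@dfun_scalemx _ _ oD _ a u i)
  | |- dfun _ (fun e => fun_of_matrix (rvec _ (@?f e)) _ ?i) => apply (@dfun_rvec _ _ oD _ f i); shift_tac
  | |- denv _ (fun e => scons (@?t e) (@?f e)) => apply: denv_scons
  | |- denv _ (fun _ => ?c) => exact: (denv_const oD)
  | |- denv _ _ => apply (denv_shift oD); shift_tac
  | |- dfun _ _ => eapply (dfun_shift oD); shift_tac
  end end.

Ltac dsimp := cbv beta delta [mkset setI setU setC setD].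
(* Extended below, with the constructions whose definability is proved later. *)
Ltac ddef_hook := fail.
Ltac ddef := repeat (dsimp; first [assumption | ddef_hook | ddef_step]); dsimp.

(** * Definable subsets of the line *)

Section Line.
Variables (R : archiRcfType) (D : set_family R).
Hypothesis oD : o_minimal D.

(** The conclusion of the axiom on subsets of the line, for predicates. *)
Definition tame (S : R -> Prop) : Prop :=
  exists s : seq (interval R), forall y, S y <-> exists2 i, i \in s & y \in i.

Lemma dset_tame P : dset D P -> forall e, tame (fun y => P (scons y e)).
Proof.
move=> dP e.
have h : D [set x : 'rV[R]_1 | P (scons (x 0 0) e)].
  by apply: (dset_D oD); ddef.
have [s hs] := omin_line oD h; exists s => y.
have -> : P (scons y e) = [set x : 'rV[R]_1 | P (scons (x 0 0) e)] (const_mx y).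
  by rewrite /= mxE.
by rewrite hs /= mxE.
Qed.

Lemma itv_convex (i : interval R) x y z : x \in i -> z \in i -> x < y < z -> y \in i.
Proof.
case: i => l u; rewrite !itv_boundlr => /andP[lx _] /andP[_ zu] /andP[xy yz].
apply/andP; split.
  by apply: (le_trans lx); rewrite bnd_simp ltW.
by apply: le_trans zu; rewrite bnd_simp ltW.
Qed.

(** One of the finitely many convex pieces has two points. *)
Lemma tame_infinite S : tame S -> ~ finite_set (S : set R) ->
  exists a b, a < b /\ forall y, a < y < b -> S y.
Proof.
move=> [s hs] nf; apply: contrapT => ne; apply: nf.
have : (S : set R) `<=` \bigcup_(i in [set` s]) [set y | y \in i].
  by move=> y /hs [i si yi]; exists i.
move=> /sub_finite_set; apply; apply: bigcup_finite; first exact: finite_seq.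
move=> i si.
have [[x xi]|/forallNP h] := pselect (exists x, x \in i); last first.
  by rewrite (_ : [set _ | _] = set0) //; apply/seteqP; split => y //= yi; case: (h y).
have : [set y | y \in i] `<=` [set x].
  move=> y /= yi; apply: contrapT => /eqP yx.
  wlog lt_xy : x y xi yi yx / x < y.
    move=> hw; case: (ltrgtP x y) => [xy|xy|xy]; last by rewrite xy eqxx in yx.
      exact: (hw x y).
    by apply: (hw y x) => //; rewrite eq_sym.
  apply: ne; exists x, y; split => // z xzy.
  by apply/hs; exists i => //; apply: itv_convex xzy.
by move=> /sub_finite_set; apply; exact: finite_set1.
Qed.

(** One of the finitely many convex pieces accumulates at 0. *)
Lemma tame_near0 S : tame S -> (forall d, 0 < d -> exists y, 0 < y < d /\ S y) ->
  exists2 d, 0 < d & forall y, 0 < y < d -> S y.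
Proof.
move=> [s]; elim: s S => [|i s IH] S hs acc.
  by have [y [_ /hs[]]] := acc 1 ltr01.
have [h|] := pselect (forall d : R, 0 < d -> exists y, 0 < y < d /\ y \in i).
  have [z [/andP[z0 _] zi]] := h 1 ltr01.
  exists z => // y /andP[y0 yz].
  have [x [/andP[x0 xy] xi]] := h y y0.
  apply/hs; exists i; first by rewrite in_cons eqxx.
  by apply: (itv_convex xi zi); rewrite xy.
move=> /existsNP[d /not_implyP[d0 /forallNP hd]].
have hs' y : (exists2 j, j \in s & y \in j) <-> exists2 i, i \in s & y \in i by [].
have [|t t0 ht] := IH _ hs'.
  move=> d' d'0; have [|y [/andP[y0 yd] /hs[j]]] := acc (Order.min d d').
    by rewrite lt_min d0.
  move: yd; rewrite lt_min => /andP[yd yd'].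
  rewrite in_cons => /orP[/eqP -> yi|js yj].
    by case: (hd y); rewrite y0.
  by exists y; rewrite y0 yd'; split => //; exists j.
exists t => // y /ht[j js yj]; apply/hs; exists j => //.
by rewrite in_cons js orbT.
Qed.

(** [R] need not be complete, but the end points of intervals are in [R]. *)
Lemma tame_sup S M y0 : tame S -> S y0 -> (forall y, S y -> y <= M) ->
  exists2 m, (forall y, S y -> y <= m) & forall d, 0 < d -> exists y, S y /\ m - d < y.
Proof.
move=> [s]; elim: s S y0 => [|i s IH] S y0 hs Sy0 hM.
  by have /hs[] := Sy0.
have Si y : y \in i -> S y by move=> yi; apply/hs; exists i => //; rewrite in_cons eqxx.
have Ss y : (exists2 j, j \in s & y \in j) -> S y.
  by move=> [j js yj]; apply/hs; exists j => //; rewrite in_cons js orbT.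
have Sor y : S y -> y \in i \/ (exists2 j, j \in s & y \in j).
  move=> /hs[j]; rewrite in_cons => /orP[/eqP -> yi|js yj]; first by left.
  by right; exists j.
have supi x : x \in i -> exists2 m, (forall y, y \in i -> y <= m) &
    forall d, 0 < d -> exists y, y \in i /\ m - d < y.
  case: i {hs Sor IH} Si => l u Si xi.
  case: u Si xi => [b u|[]] Si xi.
  - have iu y : y \in Interval l (BSide b u) -> y <= u.
      rewrite itv_boundlr => /andP[_]; case: b {Si xi}; rewrite bnd_simp //; exact: ltW.
    exists u => // d d0.
    have := iu _ xi; rewrite le_eqVlt => /orP[/eqP ux|xu].
      by exists x; split => //; rewrite ux ltrBlDr ltrDl.
    exists (Order.max x (u - d / 2)); split; last first.
      by rewrite lt_max; apply/orP; right; rewrite ler_ltD // ltrN2 ltr_pdivrMr // mulr_natr mulr2n ltrDl.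
    move: xi; rewrite !itv_boundlr => /andP[lx _]; apply/andP; split.
      by apply: (le_trans lx); rewrite bnd_simp le_max lexx.
    have : Order.max x (u - d / 2) < u.
      by rewrite gt_max xu /= ltrBlDr ltrDl divr_gt0.
    by case: b {Si iu}; rewrite bnd_simp // => /ltW.
  - move: xi; rewrite itv_boundlr => /andP[_ //].
  - have : M + 1 \in Interval l +oo%O.
      move: (xi); rewrite !itv_boundlr => /andP[lx _]; rewrite andbT.
      apply: (le_trans lx); rewrite bnd_simp.
      by apply: (le_trans (hM _ (Si _ xi))); rewrite lerDl.
    by move=> /Si /hM; rewrite leNgt ltrDl ltr01.
have [[y sy]|/forallNP ns] := pselect (exists y, exists2 j, j \in s & y \in j).
  have [m1 b1 a1] := IH (fun y => exists2 j, j \in s & y \in j) y (fun _ => iff_refl _) sy (fun y h => hM y (Ss y h)).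
  have [[x xi]|/forallNP ni] := pselect (exists x, x \in i).
    have [m2 b2 a2] := supi x xi.
    have [m12|m21] := leP m1 m2.
      exists m2 => [z /Sor[/b2//|/b1 h]|d d0]; first exact: le_trans m12.
      by have [z [zi hz]] := a2 d d0; exists z; split => //; apply: Si.
    exists m1 => [z /Sor[/b2 h|/b1//]|d d0]; first by apply: le_trans (ltW m21).
    by have [z [zi hz]] := a1 d d0; exists z; split => //; apply: Ss.
  exists m1 => [z /Sor[/ni//|/b1//]|d d0].
  by have [z [zi hz]] := a1 d d0; exists z; split => //; apply: Ss.
have [//|xi] : y0 \in i \/ False by case: (Sor _ Sy0) => [|/ns]; [left|].
  move=> xi; have [m2 b2 a2] := supi _ xi.
  exists m2 => [z /Sor[/b2//|/ns//]|d d0].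
  by have [z [zi hz]] := a2 d d0; exists z; split => //; apply: Si.
by [].
Qed.

Lemma itv_infinite (S : set R) a b : a < b -> (forall y, a < y < b -> S y) -> ~ finite_set S.
Proof.
move=> ab h fS; apply: infinite_nat.
have ba : 0 < b - a by rewrite subr_gt0.
pose f (n : nat) := a + (b - a) / n.+2%:R.
have -> : [set: nat] = f @^-1` S.
  apply/seteqP; split => // n _; apply: h.
  rewrite /f ltrDl divr_gt0 //= -ltrBrDl ltr_pdivrMr // ltr_pMr //.
  by rewrite ltr1n.
apply: finite_preimage => // n m _ _ /addrI /(mulfI (lt0r_neq0 ba)) /invr_inj /eqP.
by rewrite eqr_nat => /eqP[].
Qed.

End Line.

(** * Dimension by infinite quantifiers *)

Definition infR (R : Type) (S : R -> Prop) : Prop := ~ finite_set (S : set R).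

Definition ex_fiber (R : Type) (P : env R -> Prop) : env R -> Prop :=
  fun e => exists y, P (scons y e).

Definition inf_fiber (R : Type) (P : env R -> Prop) : env R -> Prop :=
  fun e => infR (fun y => P (scons y e)).

(** Each of the first [n] variables is quantified by [exists] or by [for
    infinitely many], with [k] quantifiers of the second kind; the disjunction
    is over the choices of quantifiers.  The remaining variables are
    parameters. *)
Fixpoint dim_ge (R : Type) (n k : nat) (P : env R -> Prop) : env R -> Prop :=
  match n with
  | 0 => fun e => k = 0%N /\ P e
  | n'.+1 => fun e => dim_ge n' k (ex_fiber P) e \/
      (if k is k'.+1 then dim_ge n' k' (inf_fiber P) e else False)
  end.

Section InfiniteQuantifiers.
Variable R : Type.
Implicit Types P Q : env R -> Prop.

Lemma infRS (S T : R -> Prop) : (forall y, S y -> T y) -> infR S -> infR T.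
Proof. by move=> ST nf fT; apply: nf; apply: sub_finite_set fT. Qed.

Lemma infRU (S T : R -> Prop) : infR (fun y => S y \/ T y) -> infR S \/ infR T.
Proof.
move=> h; apply: contrapT => /not_orP[/contrapT fS /contrapT fT]; apply: h.
by rewrite (_ : (fun y => _) = S `|` T) // finite_setU.
Qed.

Lemma infR_ex (S : R -> Prop) : infR S -> exists y, S y.
Proof.
move=> h; apply: contrapT => /forallNP ne; apply: h.
by rewrite (_ : S = set0) //; apply/seteqP; split => y // /ne.
Qed.

Lemma dim_geS n k P Q e : (forall e, P e -> Q e) -> dim_ge n k P e -> dim_ge n k Q e.
Proof.
elim: n k P Q => [|n IH] k P Q PQ /=; first by move=> [-> /PQ].
case=> [h|]; first by left; apply: IH h => e' [y /PQ]; exists y.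
case: k => [//|k] h; right; apply: IH h => e'; apply: infRS => y; exact: PQ.
Qed.

Lemma dim_geU n k P Q e : dim_ge n k (fun e => P e \/ Q e) e ->
  dim_ge n k P e \/ dim_ge n k Q e.
Proof.
elim: n k P Q => [|n IH] k P Q /=; first by move=> [-> [h|h]]; [left|right].
case=> [h|].
  have [|h'|h'] := IH k (ex_fiber P) (ex_fiber Q); [|by left; left|by right; left].
  by apply: dim_geS h => e' [y [h|h]]; [left|right]; exists y.
case: k => [//|k] h.
have [|h'|h'] := IH k (inf_fiber P) (inf_fiber Q); [|by left; right|by right; right].
by apply: dim_geS h => e' /infRU.
Qed.

Lemma dim_geF n k e : ~ dim_ge n k (fun _ : env R => False) e.
Proof.
elim: n k => [|n IH] k /=; first by case.
case=> [h|]; first by apply: (IH k); apply: dim_geS h => e' [].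
by case: k => [//|k] h; apply: (IH k); apply: dim_geS h => e' /infR_ex[].
Qed.

Lemma dim_ge_seq (I : eqType) (s : seq I) n k (P : I -> env R -> Prop) e :
  dim_ge n k (fun e => exists2 i, i \in s & P i e) e ->
  exists2 i, i \in s & dim_ge n k (P i) e.
Proof.
elim: s => [|i s IH] h.
  by case: (@dim_geF n k e); apply: dim_geS h => e' [].
have /dim_geU[hi|/IH[j js hj]] : dim_ge n k (fun e => P i e \/ exists2 i, i \in s & P i e) e.
- apply: dim_geS h => e' [j]; rewrite in_cons => /orP[/eqP -> |js] Pj; first by left.
  by right; exists j.
- by exists i => //; rewrite in_cons eqxx.
- by exists j => //; rewrite in_cons js orbT.
Qed.

Lemma dim_ge_fin (I : finType) n k (P : I -> env R -> Prop) e :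
  dim_ge n k (fun e => exists i, P i e) e -> exists i, dim_ge n k (P i) e.
Proof.
move=> h; have [|i _ hi] := @dim_ge_seq I (enum I) n k P e; last by exists i.
by apply: dim_geS h => e' [i Pi]; exists i; rewrite ?mem_enum.
Qed.

Lemma dim_ge_le n k P e : dim_ge n k P e -> (k <= n)%N.
Proof.
elim: n k P => [|n IH] k P /=; first by case=> ->.
case=> [/IH h|]; first exact: leqW.
by case: k => [//|k] /IH.
Qed.

Lemma dim_ge_ex_block m n k P e :
  dim_ge n k (fun e => exists x : env R, P (cat_env m x e)) e -> dim_ge (m + n) k P e.
Proof.
elim: m P => [|m IH] P h.
  by apply: dim_geS h => e' [x]; rewrite cat_env0.
left; apply: IH; apply: dim_geS h => e' [x]; rewrite cat_envS => Px.
by exists (tl x), (x 0%N).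
Qed.

(** With at most one point in each fiber, no infinite quantifier can occur on
    the first [m] variables. *)
Lemma dim_ge_functional m n k P e :
  (forall y y' e, P (cat_env m y e) -> P (cat_env m y' e) ->
     forall i, (i < m)%N -> y i = y' i) ->
  dim_ge (m + n) k P e ->
  dim_ge n k (fun e => exists y : env R, P (cat_env m y e)) e.
Proof.
elim: m k P => [|m IH] k P fP.
  by move=> h; apply: dim_geS h => e' Pe; exists e'; rewrite cat_env0.
case=> [h|].
  have : dim_ge n k (fun e => exists y, ex_fiber P (cat_env m y e)) e.
    apply: IH h => y y' e' [a Pa] [b Pb] i im.
    by apply: (fP (scons a y) (scons b y') e' _ _ i.+1); rewrite // cat_envS.
  by apply: dim_geS => e' [y [a Pa]]; exists (scons a y); rewrite cat_envS.
case: k => [//|k] h; case: (@dim_geF (m + n) k e); apply: dim_geS h => e' h.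
apply: h; have [[y Py]|/forallNP nP] := pselect (exists y, P (scons y e')).
  apply: (@sub_finite_set _ _ [set y]); last exact: finite_set1.
  move=> z /= Pz; apply: (fP (scons z e') (scons y e') (drop_env m e') _ _ 0%N) => //;
  by rewrite cat_envS cat_env_drop.
by rewrite (_ : (fun y => _) = set0) //; apply/seteqP; split => y // /nP.
Qed.

End InfiniteQuantifiers.

Lemma exists_maximal (T : Type) (s : set T) (r : T -> T -> Prop) :
  finite_set s -> s !=set0 -> (forall x, ~ r x x) ->
  (forall x y z, r x y -> r y z -> r x z) ->
  exists2 x, s x & forall y, s y -> ~ r x y.
Proof.
move=> fs s0 rr rt.
have [l ls] : exists l : seq {classic T}, s = [set` l] by apply/finite_seqP.
rewrite ls in s0 *; elim: l {s fs ls} s0 => [[x //]|a l IH] _.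
have [l0|/nonemptyPn l0] := pselect ([set` l] !=set0); last first.
  exists a => [|y /=]; first by rewrite /= in_cons eqxx.
  rewrite in_cons => /orP[/eqP ->|yl]; first exact: rr.
  by suff : [set` l] y by rewrite l0.
have [x xl xm] := IH l0.
have [rxa|nrxa] := pselect (r x a).
  exists a => [|y /=]; first by rewrite /= in_cons eqxx.
  rewrite in_cons => /orP[/eqP ->|yl]; first exact: rr.
  by move=> ray; apply: (xm y yl); apply: rt ray.
exists x => [|y /=]; first by rewrite /= in_cons xl orbT.
by rewrite in_cons => /orP[/eqP -> //|yl]; exact: xm.
Qed.

Section InfiniteDefinable.
Variables (R : archiRcfType) (D : set_family R).
Hypothesis oD : o_minimal D.
Implicit Types P Q : env R -> Prop.

Lemma tame_infR S : tame S -> infR S <->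
  exists a b : R, a < b /\ forall y, a < y -> y < b -> S y.
Proof.
move=> tS; split => [/(tame_infinite tS)[a [b [ab h]]]|[a [b [ab h]]]].
  by exists a, b; split => // y ay yb; apply: h; rewrite ay.
by apply: (itv_infinite ab) => y /andP[ay yb]; apply: h.
Qed.

Lemma dset_infR (P : env R -> R -> Prop) : dset D (fun e => P (tl e) (e 0%N)) ->
  dset D (fun e => infR (P e)).
Proof.
set P' := fun e => P (tl e) (e 0%N) => dP.
have d : dset D (fun e => exists a b : R, a < b /\ forall y, a < y -> y < b -> P' (scons y e)).
  by ddef.
apply: (dset_ext d) => e; rewrite tame_infR //.
exact: (dset_tame oD dP e).
Qed.

End InfiniteDefinable.

Ltac dsimp ::= cbv beta delta [mkset setI setU setC setD ex_fiber inf_fiber].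
Ltac ddef_hook ::= lazymatch goal with oD : o_minimal ?D |- _ =>
  lazymatch goal with
  | |- dset _ (fun e => infR (fun y => @?P e y)) => apply (@dset_infR _ _ oD P)
  | |- dset _ (fun e => infR (@?P e)) => apply (@dset_infR _ _ oD P)
  end end.

Section UniformDimension.
Variables (R : archiRcfType) (D : set_family R).
Hypothesis oD : o_minimal D.
Implicit Types P Q : env R -> Prop.

Lemma dset_ex_fiber P : dset D P -> dset D (ex_fiber P).
Proof. by move=> dP; rewrite /ex_fiber; ddef. Qed.

Lemma dset_inf_fiber P : dset D P -> dset D (inf_fiber P).
Proof. by move=> dP; rewrite /inf_fiber; ddef. Qed.

(** The uniformity principle.  Suppose that every [y] in an interval has some
    [c] but that each [c] serves finitely many [y] only.  Call [x] a record if
    every later [y] misses some [c] that serves [x].  Looking at the finitely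
    many points that are as good as a given point, one finds a record beyond
    it; so there are infinitely many records, hence an interval of them.  But
    on this interval all points before [x] do better than [x], so the [c] of
    [x] serves infinitely many points. *)
Lemma inf_fiber_param P e : dset D P ->
  (forall (c c' : R) e, 0 < c' -> c' <= c -> P (scons c e) -> P (scons c' e)) ->
  inf_fiber (fun e => exists2 c : R, 0 < c & P (scons c e)) e ->
  exists2 c : R, 0 < c & inf_fiber (fun e => P (scons c e)) e.
Proof.
move=> dP decr; rewrite /inf_fiber.
have dQ : dset D (fun e => exists2 c : R, 0 < c & P (scons c e)) by ddef.
move=> /(tame_infR (dset_tame oD dQ e)) [a [b [ab hab]]].
apply: contrapT => nfin.
pose T (c y : R) := P (scons c (scons y e)).
have fin c : 0 < c -> finite_set [set y | T c y].
  by move=> c0; apply: contrapT => h; apply: nfin; exists c.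
pose B x := [/\ a < x, x < b & forall y, x < y -> y < b -> exists c : R, [/\ 0 < c, T c x & ~ T c y]].
have tB : tame B.
  pose B' (x : R) (e : env R) := [/\ a < x, x < b & forall y, x < y -> y < b ->
    exists c : R, [/\ 0 < c, P (scons c (scons x e)) & ~ P (scons c (scons y e))]].
  have dB : dset D (fun e => B' (e 0%N) (tl e)).
    have d : dset D (fun e => a < e 0%N /\ e 0%N < b /\ forall y, e 0%N < y -> y < b ->
       exists c : R, 0 < c /\ P (scons c (scons (e 0%N) (tl e))) /\ ~ P (scons c (scons y (tl e)))).
      by ddef.
    apply: (dset_ext d) => e'; split.
      move=> [h1 [h2 h3]]; split => // y h4 h5.
      by have [c [? []]] := h3 y h4 h5; exists c.
    move=> [h1 h2 h3]; split => //; split => // y h4 h5.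
    by have [c []] := h3 y h4 h5; exists c.
  exact: (dset_tame oD dB e).
(* A record beyond [x1]: among the points that [c1] serves, one that no
   later one matches. *)
have step x1 : a < x1 -> x1 < b -> exists2 x, x1 <= x & B x.
  move=> ax1 x1b; have [c1 c10 Tx1] := hab _ ax1 x1b.
  pose F : set R := [set y | T c1 y /\ x1 <= y < b].
  have fF : finite_set F.
    by apply: sub_finite_set (fin _ c10) => y [].
  have [||x y z|x [Tx /andP[x1x xb]] xm] := @exists_maximal R F
    (fun x y => x < y /\ forall c, 0 < c -> T c x -> T c y) fF.
  - by exists x1; split => //; rewrite lexx.
  - by move=> x [xx _]; rewrite ltxx in xx.
  - move=> [xy h] [yz h']; split; first exact: lt_trans yz.
    by move=> c c0 /(h _ c0) /(h' _ c0).
  exists x => //; split => //; first exact: lt_le_trans x1x.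
  move=> y xy yb; apply: contrapT => /forallNP ny.
  have xley c : 0 < c -> T c x -> T c y.
    by move=> c0 Tcx; apply: contrapT => nT; apply: (ny c).
  apply: (xm y) => //; split; first exact: xley.
  by rewrite (le_trans x1x (ltW xy)).
have mid (u v : R) : u < v -> u < (u + v) / 2 /\ (u + v) / 2 < v.
  by move=> uv; split; lra.
have infB : infR B.
  move=> fB; have [|x|x y z|x [ax xb _] xm] := @exists_maximal R B (fun x y => x < y) fB.
  - by have [h1 h2] := mid _ _ ab; have [x _ Bx] := step _ h1 h2; exists x.
  - by rewrite ltxx.
  - exact: lt_trans.
  have [h1 h2] := mid _ _ xb.
  have [y xy By] := step _ (lt_trans ax h1) h2.
  by apply: (xm y By); exact: lt_le_trans xy.
have /(tame_infR tB)[p [q [pq hB]]] := infB.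
have [px xq] := mid _ _ pq; move: ((p + q) / 2) px xq => x px xq.
have [ax xb _] := hB _ px xq.
have [c0 c00 Tx] := hab _ ax xb.
apply: (@itv_infinite R [set y | T c0 y] p x px _ (fin _ c00)) => y /andP[py yx].
have [_ _ /(_ x yx xb)[c [c_gt0 Ty nTx]]] := hB y py (lt_trans yx xq).
apply: (@decr c) => //; case: (leP c0 c) => // /ltW cc0.
by case: nTx; apply: decr Tx.
Qed.

Lemma dim_ge_param n k P e : dset D P ->
  (forall (c c' : R) e, 0 < c' -> c' <= c -> P (scons c e) -> P (scons c' e)) ->
  dim_ge n k (fun e => exists2 c : R, 0 < c & P (scons c e)) e ->
  exists2 c : R, 0 < c & dim_ge n k (fun e => P (scons c e)) e.
Proof.
elim: n k P => [|n IH] k P dP decr /=; first by move=> [-> [c c0 Pc]]; exists c.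
case=> [h|].
  have [| | |c c0 hc] := IH k (fun e => ex_fiber (fun e' => P (scons (e 0%N) e')) (tl e)).
  - by ddef.
  - by move=> c c' e' c0 cc' [y Py]; exists y; apply: decr Py.
  - by apply: dim_geS h => e' [y [c c0 Pc]]; exists c => //; exists y.
  - by exists c => //; left.
case: k => [//|k] h.
have [| | |c c0 hc] := IH k (fun e => inf_fiber (fun e' => P (scons (e 0%N) e')) (tl e)).
- by ddef.
- by move=> c c' e' c0 cc'; apply: infRS => y; apply: decr.
- by apply: dim_geS h => e'; apply: inf_fiber_param.
- by exists c => //; right.
Qed.

Lemma grid_cover (B d : R) : 0 < d -> exists N : nat, forall y, `|y| <= B ->
  exists i : 'I_N, `|y - (i%:R * d - B)| < d.
Proof.
move=> d0; pose f y := Num.floor ((y + B) / d).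
exists (`|f B|%N.+1) => y; rewrite ler_norml => /andP[By yB].
have f0 : 0 <= f y by rewrite floor_ge0 divr_ge0 ?(ltW d0) // -lerBlDr sub0r.
have fB : f y <= f B by apply: le_floor; rewrite ler_pM2r ?invr_gt0 // lerD2r.
have h : (`|f y| < `|f B|.+1)%N by lia.
exists (Ordinal h) => /=.
have /andP[h1 h2] := floor_itv ((y + B) / d).
have e1 : `|f y|%N%:R = (f y)%:~R :> R by rewrite natr_absz ger0_norm.
rewrite e1; move: h1 h2; rewrite -/(f y) ler_pdivlMr // ltr_pdivrMr // intrD mulr1z mulrDl mul1r.
by rewrite ltr_norml => h1 h2; apply/andP; split; lra.
Qed.

(** By uniformity the witness can be taken in a fixed bounded interval, which
    is covered by finitely many balls of radius [d]. *)
Lemma dim_ge_ex_ball n k P e d : dset D P -> 0 < d -> dim_ge n k (ex_fiber P) e ->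
  exists q, dim_ge n k (fun e => exists y, `|y - q| < d /\ P (scons y e)) e.
Proof.
move=> dP d0 h.
have [| | |c c0 hc] := @dim_ge_param n k
  (fun e => exists y, `|y| * e 0%N <= 1 /\ P (scons y (tl e))) e.
- by ddef.
- move=> c c' e' c'0 cc' [y [yc Py]]; exists y; split => //.
  by apply: le_trans yc; apply: ler_wpM2l.
- apply: dim_geS h => e' [y Py]; exists (1 + `|y|)^-1; first by rewrite invr_gt0 ltr_wpDr.
  by exists y; split => //=; rewrite ler_pdivrMr ?mul1r ?lerDr // ltr_wpDr.
have [N hN] := grid_cover c^-1 d0.
have [i hi] : exists i : 'I_N, dim_ge n k (fun e => exists y, `|y - (i%:R * d - c^-1)| < d /\ P (scons y e)) e.
  apply: dim_ge_fin; apply: dim_geS hc => e' [y [/= yc Py]].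
  have [|i hi] := hN y; first by rewrite -[c^-1]mul1r ler_pdivlMr.
  by exists i, y.
by exists (i%:R * d - c^-1).
Qed.

Lemma dim_ge_inf_ball n k P e : dset D P -> dim_ge n k (inf_fiber P) e ->
  exists q c, 0 < c /\ dim_ge n k (fun e => forall y, `|y - q| < c -> P (scons y e)) e.
Proof.
move=> dP h.
have [| | |c c0 hc] := @dim_ge_param n k
  (fun e => exists q, forall y, `|y - q| < e 0%N -> P (scons y (tl e))) e.
- by ddef.
- move=> c c' e' c'0 cc' [q hq]; exists q => y hy; apply: hq.
  exact: lt_le_trans cc'.
- apply: dim_geS h => e' /(tame_infR (dset_tame oD dP e'))[a [b [ab hab]]].
  exists ((b - a) / 2); first by rewrite divr_gt0 // subr_gt0.
  exists ((a + b) / 2) => y /=; rewrite ltr_norml => /andP[h1 h2].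
  by apply: hab; lra.
have c2 : 0 < c / 2 by rewrite divr_gt0.
have [|q hq] := @dim_ge_ex_ball n k (fun e => forall y, `|y - e 0%N| < c -> P (scons y (tl e))) e (c / 2) _ c2 hc.
  by ddef.
exists q, (c / 2); split => //; apply: dim_geS hq => e' [y [yq hy]] z zq; apply: hy => /=.
by move: yq zq; rewrite !ltr_norml => /andP[? ?] /andP[? ?]; apply/andP; split; lra.
Qed.

End UniformDimension.

(** * Invariance of the dimension under permutations and definable maps *)

Definition swap_env (R : Type) (i : nat) (e : env R) : env R :=
  fun j => e (if j == i then i.+1 else if j == i.+1 then i else j).

Definition cycle_env (R : Type) (m : nat) (e : env R) : env R :=
  fun j => e (if (j < m)%N then j.+1 else if j == m then 0%N else j).

Definition swap_blocks (R : Type) (a b : nat) (e : env R) : env R :=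
  cat_env b (drop_env a e) (cat_env a e (drop_env (a + b) e)).

Lemma cat_envE R m (y e : env R) j :
  cat_env m y e j = if (j < m)%N then y j else e (j - m)%N.
Proof. by []. Qed.

Lemma swap_blocksE R a b (e : env R) j : swap_blocks a b e j =
  if (j < b)%N then e (a + j)%N else if (j - b < a)%N then e (j - b)%N else e j.
Proof.
rewrite /swap_blocks !cat_envE; case: ltnP => // bj; case: ltnP => // h.
by rewrite /drop_env; congr e; lia.
Qed.

Lemma swap_env_scons R i (y : R) e : swap_env i.+1 (scons y e) = scons y (swap_env i e).
Proof.
apply: funext => -[|j] //; rewrite /swap_env /= !eqSS.
by case: eqP => // _; case: eqP.
Qed.

Lemma cycle_env0 R (e : env R) : cycle_env 0 e = e.
Proof. by apply: funext => -[]. Qed.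

Lemma cycle_envS R m (e : env R) : cycle_env m.+1 e = swap_env m (cycle_env m e).
Proof.
apply: funext => j; rewrite /swap_env /cycle_env.
have [->|jm] := eqVneq j m; first by rewrite ltnSn ltnNge leqnSn /= gtn_eqF.
have [->|jm1] := eqVneq j m.+1; first by rewrite ltnn eqxx ltnn.
rewrite [(j < m)%N]ltn_neqAle ltnS.
by have [jm'|jm'] := leqP j m; rewrite jm //= (negPf jm).
Qed.

Lemma swap_blocks0 R b (e : env R) : swap_blocks 0 b e = e.
Proof. by apply: funext => j; rewrite swap_blocksE add0n ltn0 if_same. Qed.

Lemma swap_blocksS R a b (e : env R) :
  swap_blocks a.+1 b e = cycle_env (a + b) (swap_blocks a b.+1 e).
Proof.
apply: funext => j; rewrite /cycle_env !swap_blocksE.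
have [jb|bj] := ltnP j b.
  have -> : (j < a + b)%N by lia.
  by rewrite ltnS jb; congr e; lia.
have [ja|aj] := ltnP (j - b) a.+1.
  have [jab|] := ltnP j (a + b).
    rewrite ltnS ltnNge bj /=.
    have -> : (j.+1 - b.+1 < a)%N by lia.
    by congr e; lia.
  move=> h; have -> : j == (a + b)%N by apply/eqP; lia.
  by rewrite ltn0Sn; congr e; lia.
have -> : (j < a + b)%N = false by apply/negbTE; rewrite -leqNgt; lia.
have -> : (j == a + b)%N = false by apply/negbTE/eqP; lia.
have -> : (j < b.+1)%N = false by apply/negbTE; rewrite -leqNgt; lia.
by have -> : (j - b.+1 < a)%N = false by apply/negbTE; rewrite -leqNgt; lia.
Qed.

Lemma swap_blocks_cat R a b (x y e : env R) :
  swap_blocks a b (cat_env a x (cat_env b y e)) = cat_env b y (cat_env a x e).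
Proof.
apply: funext => j; rewrite swap_blocksE !cat_envE.
have [jb|bj] := ltnP j b; first by rewrite ltnNge leq_addr addKn jb.
have [ja|aj] := ltnP (j - b) a; first by [].
have -> : (j < a)%N = false by apply/negbTE; rewrite -leqNgt; lia.
have -> : (j - a < b)%N = false by apply/negbTE; rewrite -leqNgt; lia.
by congr e; lia.
Qed.

Section Permute.
Variables (R : archiRcfType) (D : set_family R).
Hypothesis oD : o_minimal D.
Implicit Types P Q : env R -> Prop.

Lemma dset_swap i P : dset D P -> dset D (fun e => P (swap_env i e)).
Proof. exact: (dset_rename oD). Qed.

Lemma dset_cycle m P : dset D P -> dset D (fun e => P (cycle_env m e)).
Proof. exact: (dset_rename oD). Qed.

Lemma swap01 (x y : R) e : swap_env 0 (scons y (scons x e)) = scons x (scons y e).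
Proof. by apply: funext => -[|[|j]]. Qed.

(** Both sides say that a planar set is infinite: if its projection to one axis
    is infinite and the fibers over the other axis are finite, then infinitely
    many of these fibers are not empty. *)
Lemma ex_inf_swap P e : inf_fiber (ex_fiber P) e \/ ex_fiber (inf_fiber P) e ->
  inf_fiber (ex_fiber (fun e => P (swap_env 0 e))) e \/
  ex_fiber (inf_fiber (fun e => P (swap_env 0 e))) e.
Proof.
case=> [h|[x h]]; last first.
  by left; apply: infRS h => y Py; exists x; rewrite swap01.
have [[y hy]|/forallNP fin] := pselect (exists y, infR (fun x => P (scons y (scons x e)))).
  by right; exists y; apply: infRS hy => x Px; rewrite swap01.
left; apply: contrapT => /contrapT fY; apply: h.
pose Y : set R := [set y | exists x, P (scons y (scons x e))].
have fY' : finite_set Y.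
  by apply: sub_finite_set fY => y [x Px]; exists x; rewrite swap01.
have : [set x | ex_fiber P (scons x e)] `<=`
    \bigcup_(y in Y) [set x | P (scons y (scons x e))].
  by move=> x [y Px]; exists y => //; exists x.
move=> /sub_finite_set; apply; apply: bigcup_finite => // y _.
by have /contrapT := fin y.
Qed.

(** If infinitely many [x] have infinitely many [y] then, by uniformity, the
    same interval of [y] serves infinitely many [x]. *)
Lemma inf_inf_swap P e : dset D P -> inf_fiber (inf_fiber P) e ->
  inf_fiber (inf_fiber (fun e => P (swap_env 0 e))) e.
Proof.
move=> dP h.
have [|q [c [c0]]] := @dim_ge_inf_ball _ _ oD 1 1 P e dP; first by right.
case=> [[]//|/= [_ hi]].
apply: (@itv_infinite R _ (q - c) (q + c)) => [|y /andP[h1 h2]]; first lra.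
apply: infRS hi => x; rewrite swap01; apply.
by rewrite ltr_norml; apply/andP; split; lra.
Qed.

Lemma dim_ge_swap0 n k P e : dset D P -> dim_ge n.+2 k P e ->
  dim_ge n.+2 k (fun e => P (swap_env 0 e)) e.
Proof.
move=> dP; have mid k' : dim_ge n k' (inf_fiber (ex_fiber P)) e \/ dim_ge n k' (ex_fiber (inf_fiber P)) e ->
   dim_ge n.+2 k'.+1 (fun e => P (swap_env 0 e)) e.
  move=> h.
  have : dim_ge n k' (fun e => inf_fiber (ex_fiber P) e \/ ex_fiber (inf_fiber P) e) e.
    by case: h => h; apply: dim_geS h => e' h; [left|right].
  move=> /(dim_geS (@ex_inf_swap P)) /dim_geU[h'|h']; first by left; right.
  by right; left.
case=> [[h|]|].
- left; left; apply: dim_geS h => e' [x [y Py]].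
  by exists y, x; rewrite swap01.
- by case: k => [//|k] h; apply: mid; left.
- case: k => [//|k] [h|]; first by apply: mid; right.
  case: k => [//|k] h; right; right; apply: dim_geS h => e'.
  exact: inf_inf_swap.
Qed.

Lemma dim_ge_swap i n k P e : dset D P -> (i.+1 < n)%N -> dim_ge n k P e ->
  dim_ge n k (fun e => P (swap_env i e)) e.
Proof.
elim: i n k P => [|i IH] [|n] k P dP //.
  by case: n => [//|n] _; exact: dim_ge_swap0.
rewrite ltnS => i_n [h|].
  left; have := IH n k _ (dset_ex_fiber oD dP) i_n h.
  by apply: dim_geS => e' [y Py]; exists y; rewrite swap_env_scons.
case: k => [//|k] h; right.
have := IH n k _ (dset_inf_fiber oD dP) i_n h.
by apply: dim_geS => e'; apply: infRS => y; rewrite swap_env_scons.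
Qed.

Lemma dim_ge_cycle m n k P e : dset D P -> (m < n)%N -> dim_ge n k P e ->
  dim_ge n k (fun e => P (cycle_env m e)) e.
Proof.
elim: m P => [|m IH] P dP mn h.
  by apply: dim_geS h => e'; rewrite cycle_env0.
have := IH _ (dset_swap m dP) (ltnW mn) (dim_ge_swap dP mn h).
by apply: dim_geS => e'; rewrite cycle_envS.
Qed.

Lemma dim_ge_swap_blocks a b n k P e : dset D P -> (a + b <= n)%N -> dim_ge n k P e ->
  dim_ge n k (fun e => P (swap_blocks a b e)) e.
Proof.
elim: a b P => [|a IH] b P dP abn h.
  by apply: dim_geS h => e'; rewrite swap_blocks0.
have abn' : (a + b < n)%N by [].
have := IH b.+1 _ (dset_cycle (a + b) dP) _ (dim_ge_cycle dP abn' h).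
by rewrite addnS => /(_ abn); apply: dim_geS => e'; rewrite swap_blocksS.
Qed.

(** All the quantifiers are infinite; uniformity replaces them one after the
    other by fixed intervals. *)
Lemma dim_ge_box n P e : dset D P -> dim_ge n n P e ->
  exists (z : env R) (c : R), 0 < c /\ forall x : env R, (forall i, (i < n)%N -> `|x i - z i| < c) ->
    P (cat_env n x e).
Proof.
elim: n P => [|n IH] P dP.
  by move=> [_ Pe]; exists e, 1; split => // x _; rewrite cat_env0.
case=> [/dim_ge_le|h]; first by rewrite ltnn.
have [q [c [c0 h']]] := dim_ge_inf_ball oD dP h.
have [|z [d [d0 hz]]] := IH _ _ h'; first by ddef.
exists (scons q z), (Order.min c d); split; first by rewrite lt_min c0.
move=> x hx; rewrite cat_envS; apply: hz => [i i_n|].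
  by have := hx i.+1 i_n; rewrite lt_min => /andP[].
by have := hx 0%N isT; rewrite lt_min => /andP[].
Qed.

Lemma box_dim_ge n P e (z : env R) c : 0 < c ->
  (forall x : env R, (forall i, (i < n)%N -> `|x i - z i| < c) -> P (cat_env n x e)) ->
  dim_ge n n P e.
Proof.
move=> c0; elim: n z P => [|n IH] z P hP.
  by split => //; have := hP e; rewrite cat_env0; apply.
right; apply: (IH (tl z)) => x hx.
apply: (@itv_infinite R _ (z 0%N - c) (z 0%N + c)) => [|y /andP[h1 h2]]; first lra.
have := hP (scons y x); rewrite cat_envS; apply => -[|i] /= h; last exact: hx.
by rewrite ltr_norml; apply/andP; split; lra.
Qed.

Definition sdim_ge n k (X : set 'rV[R]_n) : Prop :=
  dim_ge n k (fun e => X (rvec n e)) (fun=> 0).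

Lemma sdim_geS n k (X Y : set 'rV[R]_n) : X `<=` Y -> sdim_ge k X -> sdim_ge k Y.
Proof. by move=> XY; apply: dim_geS => e; exact: XY. Qed.

(** A definable map does not raise the dimension: the graph has at least the
    dimension of its second projection, and, the two blocks of coordinates
    being exchanged, at most that of the first one because its fibers there
    are single points. *)
Lemma sdim_ge_map m n k (G : 'rV[R]_n -> 'rV[R]_m -> Prop) :
  dset D (fun e => G (rvec n e) (rvec m (drop_env n e))) ->
  (forall x y y', G x y -> G x y' -> y = y') ->
  sdim_ge k [set y | exists x, G x y] -> sdim_ge k [set x | exists y, G x y].
Proof.
move=> dG fG h.
set P := fun e => _ in dG.
have h1 : dim_ge (n + m) k P (fun=> 0).
  apply: dim_ge_ex_block; apply: dim_geS h => e [x Gx].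
  have [e' ee'] := rvecP 0 x; exists e'.
  by rewrite /P rvec_cat drop_env_cat ee'.
have h2 : dim_ge (m + n) k (fun e => P (swap_blocks m n e)) (fun=> 0).
  by apply: (dim_ge_swap_blocks dG (leqnn _)); rewrite addnC.
have PE y x e : P (swap_blocks m n (cat_env m y (cat_env n x e))) <-> G (rvec n x) (rvec m y).
  by rewrite /P swap_blocks_cat rvec_cat drop_env_cat rvec_cat.
have PE' y e : P (swap_blocks m n (cat_env m y e)) <-> G (rvec n e) (rvec m y).
  by rewrite -{1}[e](cat_env_drop n) PE.
have fP y y' e : P (swap_blocks m n (cat_env m y e)) ->
    P (swap_blocks m n (cat_env m y' e)) -> forall i, (i < m)%N -> y i = y' i.
  move=> /PE' Gy /PE' Gy' i im.
  have /rowP /(_ (rev_ord (Ordinal im))) := fG _ _ _ Gy Gy'.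
  by rewrite !mxE /= sub_rev.
apply: dim_geS (dim_ge_functional fP h2) => e [y /PE' Gy].
by exists (rvec m y).
Qed.

Lemma sdim_ge_box n (X : set 'rV[R]_n) : D X -> sdim_ge n X ->
  exists (z : 'rV[R]_n) (c : R), 0 < c /\ forall x : 'rV[R]_n,
    (forall i, `|x 0 i - z 0 i| < c) -> X x.
Proof.
move=> DX /dim_ge_box[|z [c [c0 h]]]; first by ddef.
exists (rvec n z), c; split => // x; have [e <-] := rvecP 0 x => hx.
have := h e; rewrite rvec_cat; apply => i i_n.
by have := hx (rev_ord (Ordinal i_n)); rewrite !mxE /= sub_rev.
Qed.

Lemma box_sdim_ge n (X : set 'rV[R]_n) (z : 'rV[R]_n) c : 0 < c ->
  (forall x : 'rV[R]_n, (forall i, `|x 0 i - z 0 i| < c) -> X x) -> sdim_ge n X.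
Proof.
have [e <-] := rvecP 0 z => c0 h; apply: (box_dim_ge (z := e) c0) => x hx.
by rewrite rvec_cat; apply: h => i; rewrite !mxE; apply: hx; move: (ltn_ord i) => hi; lia.
Qed.

Lemma sdim_geU n k (X Y : set 'rV[R]_n) : sdim_ge k (X `|` Y) -> sdim_ge k X \/ sdim_ge k Y.
Proof. exact: dim_geU. Qed.

Lemma sdim_ge_bigU (I : finType) n k (X : I -> set 'rV[R]_n) :
  sdim_ge k [set x | exists i, X i x] -> exists i, sdim_ge k (X i).
Proof. exact: dim_ge_fin. Qed.

End Permute.

(** * Cells in sets of large dimension *)

Definition rsnoc (R : Type) n (x : 'rV[R]_n) (y : R) : 'rV[R]_n.+1 :=
  \row_i oapp (x 0) y (unlift ord_max i).

Section Rsnoc.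
Variable R : rcfType.

Lemma rsnoc_last n (x : 'rV[R]_n) y : rsnoc x y 0 ord_max = y.
Proof. by rewrite mxE unlift_none. Qed.

Lemma rsnoc_lift n (x : 'rV[R]_n) y i : rsnoc x y 0 (lift ord_max i) = x 0 i.
Proof. by rewrite mxE liftK. Qed.

Lemma proj_init_rsnoc n (x : 'rV[R]_n) y : proj_init (rsnoc x y) = x.
Proof. by apply/rowP => i; rewrite mxE rsnoc_lift. Qed.

Lemma rsnocE n (x : 'rV[R]_n.+1) : rsnoc (proj_init x) (x 0 ord_max) = x.
Proof.
apply/rowP => i; rewrite mxE.
by case: unliftP => [j ->|->] //=; rewrite mxE.
Qed.

Lemma rvec_scons n (e : env R) y : rvec n.+1 (scons y e) = rsnoc (rvec n e) y.
Proof. by rewrite -[LHS]rsnocE proj_init_rvec tl_scons rvec_last. Qed.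

Lemma proj_init_lift n (x : 'rV[R]_n.+1) i : proj_init x 0 i = x 0 (lift ord_max i).
Proof. by rewrite mxE. Qed.

End Rsnoc.

Section RsnocDefinable.
Variables (R : archiRcfType) (D : set_family R).
Hypothesis oD : o_minimal D.

Lemma dfun_rsnoc n (v : env R -> 'rV[R]_n) (t : env R -> R) i :
  (forall j, dfun D (fun e => v e 0 j)) -> dfun D t ->
  dfun D (fun e => rsnoc (v e) (t e) 0 i).
Proof.
move=> dv dt; case: (unliftP ord_max i) => [j ->|->].
  by apply: (dfun_ext (dv j)) => e; rewrite rsnoc_lift.
by apply: (dfun_ext dt) => e; rewrite rsnoc_last.
Qed.

Lemma dfun_proj_init n (v : env R -> 'rV[R]_n.+1) i :
  (forall j, dfun D (fun e => v e 0 j)) -> dfun D (fun e => proj_init (v e) 0 i).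
Proof. by move=> dv; apply: (dfun_ext (dv (lift ord_max i))) => e; rewrite proj_init_lift. Qed.

End RsnocDefinable.

Ltac ddef_hook ::= lazymatch goal with oD : o_minimal ?D |- _ =>
  lazymatch goal with
  | |- dset _ (fun e => infR (fun y => @?P e y)) => apply (@dset_infR _ _ oD P)
  | |- dset _ (fun e => infR (@?P e)) => apply (@dset_infR _ _ oD P)
  | |- dfun _ (fun e => fun_of_matrix (rsnoc (@?v e) (@?t e)) _ ?i) =>
     (apply (@dfun_rsnoc _ _ _ v t i); [intro|])
  | |- dfun _ (fun e => fun_of_matrix (proj_init (@?v e)) _ ?i) =>
     (apply (@dfun_proj_init _ _ _ v i); intro)
  end end.

Section Discontinuity.
Variable R : rcfType.

Definition discontinuous_at n (C : set 'rV[R]_n) (f : 'rV[R]_n -> R) (c : R) (x : 'rV[R]_n) :=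
  C x /\ forall d : R, 0 < d -> exists x' : 'rV[R]_n, [/\ C x',
    forall i, `|x' 0 i - x 0 i| < d & c <= `|f x' - f x|].

Lemma ler_coord_norm n (x : 'rV[R]_n) i : `|x 0 i| <= `|x|.
Proof.
rewrite -[`|x|]/(mx_norm x) mx_normrE.
exact: (le_bigmax _ (fun j : 'I_1 * 'I_n => `|x j.1 j.2|) (0, i)).
Qed.

Lemma continuous_within n (C X : set 'rV[R]_n) (f : 'rV[R]_n -> R) : X `<=` C ->
  (forall x, X x -> ~ exists2 c : R, 0 < c & discontinuous_at C f c x) ->
  {within X, continuous f}.
Proof.
move=> XC h; apply/subspace_continuousP => x Xx.
apply/cvgrPdist_lt => c c0.
have [d d0 hd] : exists2 d : R, 0 < d & forall x', C x' ->
    (forall i, `|x' 0 i - x 0 i| < d) -> `|f x' - f x| < c.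
  apply: contrapT => nd; apply: (h x Xx); exists c => //; split; first exact: XC.
  move=> d d0; apply: contrapT => ne; apply: nd; exists d => // x' Cx' xx'.
  by rewrite ltNge; apply/negP => cf; apply: ne; exists x'.
rewrite near_withinE; near=> x' => Xx'.
rewrite distrC; apply: hd; first exact: XC.
move=> i; have : `|x - x'| < d by near: x'; exact: cvgr_dist_lt.
rewrite distrC => h0; apply: le_lt_trans h0.
by have := ler_coord_norm (x' - x) i; rewrite !mxE.
Unshelve. all: by end_near.
Qed.

End Discontinuity.

Section Cells.
Variables (R : archiRcfType) (D : set_family R).
Hypothesis oD : o_minimal D.

Lemma graph_onP n (X : set 'rV[R]_n) f x y :
  graph_on X f (rsnoc x y) <-> X x /\ y = f x.
Proof. by rewrite /graph_on /= proj_init_rsnoc rsnoc_last. Qed.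

Lemma cell_definable n d (X : set 'rV[R]_n) : cell D d X -> D X.
Proof.
elim: n d X / => [|n d X f _ _ []//|n d X f g _ DX df dg _].
  by have := omin_setC oD (omin_set0 oD 0); rewrite setC0.
have lo : D [set x : 'rV[R]_n.+1 | X (proj_init x) /\
    if f is Some f' then f' (proj_init x) < x 0 ord_max else True].
  case: f df => [f [Df _]|_]; apply: (dset_D oD); last by ddef.
  have dd : dset D (fun e => exists2 y, graph_on X f (rsnoc (proj_init (rvec n.+1 e)) y) & y < rvec n.+1 e 0 ord_max).
    by ddef.
  apply: (dset_ext dd) => e /=; split; first by move=> [y /graph_onP [Xe ->]].
  by move=> [Xe h]; exists (f (proj_init (rvec n.+1 e))) => //; apply/graph_onP.
have hi : D [set x : 'rV[R]_n.+1 | X (proj_init x) /\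
    if g is Some g' then x 0 ord_max < g' (proj_init x) else True].
  case: g dg => [g [Dg _]|_]; apply: (dset_D oD); last by ddef.
  have dd : dset D (fun e => exists2 y, graph_on X g (rsnoc (proj_init (rvec n.+1 e)) y) & rvec n.+1 e 0 ord_max < y).
    by ddef.
  apply: (dset_ext dd) => e /=; split; first by move=> [y /graph_onP [Xe ->]].
  by move=> [Xe h]; exists (g (proj_init (rvec n.+1 e))) => //; apply/graph_onP.
apply: (dset_D oD); set lo' := mkset _ in lo; set hi' := mkset _ in hi.
have dd : dset D (fun e => lo' (rvec n.+1 e) /\ hi' (rvec n.+1 e)).
  by apply: (dset_and oD); apply: (dset_vec oD) => // i; ddef.
apply: (dset_ext dd) => e; rewrite /lo' /hi' /band /=.
by split => [[[? ?] [? ?]]|[]].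
Qed.

Lemma cell_sdim_ge n d (X : set 'rV[R]_n) : cell D d X -> sdim_ge d X.
Proof.
elim: n d X / => [|n d X f _ IH _|n d X f g _ IH _ _ fg]; first by [].
  left; apply: dim_geS IH => e Xe; exists (f (rvec n e)).
  by rewrite rvec_scons; apply/graph_onP.
right; apply: dim_geS IH => e Xe; rewrite /inf_fiber.
pose x := rvec n e.
have h (a b : R) : a < b -> (forall y, a < y -> y < b ->
    (if f is Some f' then f' x < y else True) /\
    (if g is Some g' then y < g' x else True)) ->
   infR (fun y => band X f g (rvec n.+1 (scons y e))).
  move=> ab hab; apply: (itv_infinite ab) => y /andP[ay yb].
  have [h1 h2] := hab y ay yb.
  by rewrite rvec_scons /band /= proj_init_rsnoc rsnoc_last; split.
case: f g fg h => [f|] [g|] fg h.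
- exact: (h (f x) (g x) (fg _ _ erefl erefl x Xe)).
- by apply: (h (f x) (f x + 1)) => //; rewrite ltrDl.
- by apply: (h (g x - 1) (g x)) => //; rewrite ltrBlDr ltrDl.
- exact: (h 0 1).
Qed.

(** The coordinates at which the cell is a band determine the others. *)
Lemma cell_inj n d (X : set 'rV[R]_n) : cell D d X ->
  exists s : 'I_d -> 'I_n, forall x y, X x -> X y ->
    (forall i, x 0 (s i) = y 0 (s i)) -> x = y.
Proof.
elim: n d X / => [|n d X f _ [s IH] _|n d X f g _ [s IH] _ _ _].
- by exists id => x y _ _ _; apply/rowP => -[].
- exists (fun i => lift ord_max (s i)) => x y [Xx fx] [Xy fy] h.
  have xy : proj_init x = proj_init y.
    by apply: IH => // i; rewrite !proj_init_lift.
  by rewrite -[x]rsnocE -[y]rsnocE fx fy xy.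
exists (fun i => oapp (fun j => lift ord_max (s j)) ord_max (unlift ord_max i)).
move=> x y [Xx _ _] [Xy _ _] h.
have xy : proj_init x = proj_init y.
  by apply: IH => // i; have := h (lift ord_max i); rewrite liftK !proj_init_lift.
rewrite -[x]rsnocE -[y]rsnocE xy.
by have := h ord_max; rewrite unlift_none /= => ->.
Qed.

(** If the discontinuities had full dimension [k] then, by uniformity, so would
    a set of points at which the oscillation is at least a fixed [c], while the
    values lie in an interval of length [c].  In the coordinates [s] this set
    contains a box, so it is a neighbourhood in [C] of one of its points,
    against the oscillation there. *)
Lemma discontinuous_dim n k (C : set 'rV[R]_n) f (s : 'I_k -> 'I_n) :
  D C -> D (graph_on C f) ->
  (forall x y, C x -> C y -> (forall i, x 0 (s i) = y 0 (s i)) -> x = y) ->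
  ~ sdim_ge k [set x | exists2 c : R, 0 < c & discontinuous_at C f c x].
Proof.
move=> DC Df inj.
pose Dc (c : R) (x : 'rV[R]_n) := forall d : R, 0 < d -> exists x' : 'rV[R]_n,
  (forall i, `|x' 0 i - x 0 i| < d) /\
  exists y y' : R, (graph_on C f (rsnoc x y) /\ graph_on C f (rsnoc x' y')) /\ c <= `|y' - y|.
have DcE c x : discontinuous_at C f c x -> Dc c x.
  move=> [Cx h] d /h[x' [Cx' xx' cf]]; exists x'; split => //.
  by exists (f x), (f x'); split => //; split; apply/graph_onP.
rewrite /sdim_ge => h.
have [| | |c c0 hc] := @dim_ge_param _ _ oD n k (fun e => Dc (e 0%N) (rvec n (tl e))) (fun=> 0).
- by rewrite /Dc; ddef.
- move=> c c' e _ cc' h' d /h'[x' [xx' [y [y' [g cy]]]]].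
  by exists x'; split => //; exists y, y'; split => //; exact: le_trans cy.
- by apply: dim_geS h => e [c c0 /DcE h]; exists c.
have c2 : 0 < c / 2 by rewrite divr_gt0.
have [| |q hq] := @dim_ge_ex_ball _ _ oD n k (fun e => Dc c (rvec n (tl e)) /\
  graph_on C f (rsnoc (rvec n (tl e)) (e 0%N))) (fun=> 0) (c / 2) _ c2.
- by rewrite /Dc; ddef.
- apply: dim_geS hc => e hc; have [x' [_ [y [y' [[g _] _]]]]] := hc 1 ltr01.
  by exists y.
pose C4 := [set x | exists y, `|y - q| < c / 2 /\ (Dc c x /\ graph_on C f (rsnoc x y))].
have dC4 : D C4 by apply: (dset_D oD); rewrite /C4 /Dc; ddef.
have hC4 : sdim_ge k C4 by [].
have C4C x : C4 x -> C x by move=> [y [_ [_ /graph_onP[]]]].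
pose G4 (p : 'rV[R]_k) x := C4 x /\ forall i, p 0 i = x 0 (s i).
have [p [c' [c'0 hp]]] : exists (p : 'rV[R]_k) (c' : R), 0 < c' /\
    forall p' : 'rV[R]_k, (forall i, `|p' 0 i - p 0 i| < c') -> exists x, G4 p' x.
  apply: (sdim_ge_box oD); first by apply: (dset_D oD); rewrite /G4; ddef.
  apply: (sdim_ge_map oD) => [|p x x' [/C4C Cx px] [/C4C Cx' px']|].
  - by rewrite /G4; ddef.
  - by apply: inj => // i; rewrite -px -px'.
  apply: sdim_geS hC4 => x C4x; exists (\row_i x 0 (s i)); split => // i.
  by rewrite mxE.
have [x [[y [yq [Dx /graph_onP[Cx yfx]]]] px]] : exists x, G4 p x.
  by apply: hp => i; rewrite subrr normr0.
have [x' [xx' [y1 [y2 [[/graph_onP[_ e1] /graph_onP[Cx' e2]] cy]]]]] := Dx _ c'0.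
have [x'' [[y' [yq' [_ /graph_onP[Cx'' y'f]]]] px'']] : exists x, G4 (\row_i x' 0 (s i)) x.
  by apply: hp => i; rewrite mxE px.
have ex : x'' = x' by apply: inj => // i; rewrite -px'' mxE.
move: cy yq yq'; rewrite e1 e2 yfx y'f ex leNgt => /negP + h1 h2; apply.
move: h1 h2; rewrite !ltr_norml => /andP[? ?] /andP[? ?]; apply/andP; split; lra.
Qed.

Lemma D_discontinuous n (C : set 'rV[R]_n) f : D (graph_on C f) ->
  D [set x | exists2 c : R, 0 < c & discontinuous_at C f c x].
Proof.
move=> Dg; apply: (dset_D oD).
have d : dset D (fun e => exists c : R, 0 < c /\ forall d : R, 0 < d -> exists x' : 'rV[R]_n,
  (forall i, `|x' 0 i - rvec n e 0 i| < d) /\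
  exists y y' : R, (graph_on C f (rsnoc (rvec n e) y) /\ graph_on C f (rsnoc x' y')) /\ c <= `|y' - y|).
  by ddef.
apply: (dset_ext d) => e; split.
  move=> [c [c0 h']]; exists c => //; split.
    by have [x' [_ [y [y' [[/graph_onP[]]]]]]] := h' 1 ltr01.
  move=> r /h' [x' [xx' [y [y' [[/graph_onP[_ ->] /graph_onP[Cx' ->]] cy]]]]].
  by exists x'.
move=> [c c0 [Cx h']]; exists c; split => // r /h'[x' [Cx' xx' cf]].
exists x'; split => //; exists (f (rvec n e)), (f x'); split => //.
by split; apply/graph_onP.
Qed.

Lemma definable_continuous_cst n (C : set 'rV[R]_n) (q : R) : D C ->
  definable_continuous D C (fun=> q).
Proof.
move=> DC; split; last exact/continuous_subspaceT/cst_continuous.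
by apply: (dset_D oD); rewrite /graph_on; ddef.
Qed.

(** Induction on [n].  If the last quantifier is infinite, the fibers contain a
    fixed interval by uniformity, which gives a band with constant bounds.
    If it is [exists], and the infinite fibers do not already give the graph of
    a constant in this way, the fibers may be taken finite; the cell is then
    the graph of the least point of the fiber, over a cell on which this least
    point is a continuous function. *)
Lemma sdim_ge_cell n k (X : set 'rV[R]_n) : D X -> sdim_ge k X ->
  exists2 C, cell D k C & C `<=` X.
Proof.
elim: n k X => [|n IH] k X DX.
  rewrite /sdim_ge /= => -[-> X0]; exists setT; first exact: cell_nil.
  by move=> x _; rewrite [x]thinmx0; move: X0; rewrite [rvec _ _]thinmx0.
pose ball q c := [set x | forall y : R, `|y - q| < c -> X (rsnoc x y)].
have Dball q c : D (ball q c) by apply: (dset_D oD); rewrite /ball; ddef.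
have dX : dset D (fun e => X (rvec n.+1 e)) by ddef.
have infball j : dim_ge n j (inf_fiber (fun e => X (rvec n.+1 e))) (fun=> 0) ->
    exists (q c : R) C, [/\ 0 < c, cell D j C & C `<=` ball q c].
  move=> /(dim_ge_inf_ball oD dX) [q [c [c0 h]]].
  have [|C cC Cs] := IH j (ball q c) (Dball q c); last by exists q, c, C.
  by apply: dim_geS h => e h y /h; rewrite rvec_scons.
case=> [h|]; last first.
  case: k => [//|k] /infball[q [c [C [c0 cC Cs]]]].
  have DC := cell_definable cC.
  exists (band C (Some (fun=> q - c)) (Some (fun=> q + c))).
    apply: cell_band => //; try exact: definable_continuous_cst.
    by move=> _ _ [<-] [<-] x _; lra.
  move=> x [/Cs Cx h1 h2]; rewrite -[x]rsnocE; apply: Cx.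
  by rewrite ltr_norml; apply/andP; split; lra.
pose Y := [set x | (exists y, X (rsnoc x y)) /\ ~ infR (fun y => X (rsnoc x y))].
have DY : D Y by apply: (dset_D oD); rewrite /Y; ddef.
have /dim_geU[/infball[q [c [C [c0 cC Cs]]]]|hY] : dim_ge n k (fun e =>
    inf_fiber (fun e => X (rvec n.+1 e)) e \/ Y (rvec n e)) (fun=> 0).
- apply: dim_geS h => e [y Xy].
  have [|ninf] := pselect (inf_fiber (fun e => X (rvec n.+1 e)) e); first by left.
  right; split; first by exists y; rewrite -rvec_scons.
  by move=> h; apply: ninf; apply: infRS h => z; rewrite rvec_scons.
- exists (graph_on C (fun=> q)).
    by apply: cell_graph => //; apply: definable_continuous_cst; exact: cell_definable cC.
  move=> x [/Cs Cx xq]; rewrite -[x]rsnocE; apply: Cx.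
  by rewrite xq subrr normr0.
have [C cC CY] := IH k Y DY hY.
have DC := cell_definable cC.
pose lowest x m := X (rsnoc x m) /\ forall y, X (rsnoc x y) -> m <= y.
have lowestP x : exists m, C x -> lowest x m.
  have [/CY[[y Xy] /contrapT fin]|nC] := pselect (C x); last by exists 0.
  have [|||m Xm mm] := @exists_maximal R [set y | X (rsnoc x y)] (fun a b => b < a) fin.
  - by exists y.
  - by move=> a; rewrite ltxx.
  - by move=> a b d ab bd; exact: lt_trans bd ab.
  by exists m => _; split => // z Xz; rewrite leNgt; apply/negP => /mm; apply.
have [f hf] := choice lowestP.
have lowest_uniq x m m' : lowest x m -> lowest x m' -> m = m'.
  move=> [Xm mm] [Xm' mm']; apply/eqP; rewrite eq_le.
  by rewrite mm // mm'.
have Dgraph C' : C' `<=` C -> D C' -> D (graph_on C' f).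
  move=> C'C DC'; apply: (dset_D oD).
  have d : dset D (fun e => C' (rvec n (tl e)) /\ X (rvec n.+1 e) /\
      forall y, X (rsnoc (rvec n (tl e)) y) -> e 0%N <= y) by ddef.
  apply: (dset_ext d) => e; rewrite -[e]scons_tl rvec_scons graph_onP tl_scons /=.
  split; move=> [C'x h']; split => //.
    exact: (lowest_uniq _ _ _ h' (hf _ (C'C _ C'x))).
  by rewrite h'; exact: (hf _ (C'C _ C'x)).
have [s inj] := cell_inj cC.
pose Z := [set x | exists2 c : R, 0 < c & discontinuous_at C f c x].
have nZ : ~ sdim_ge k Z by apply: (discontinuous_dim DC (Dgraph C _ DC) inj).
have DZ : D Z by apply: D_discontinuous; exact: Dgraph.
have [//|hC'] : sdim_ge k Z \/ sdim_ge k (C `\` Z).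
  apply: sdim_geU; apply: sdim_geS (cell_sdim_ge cC) => x Cx.
  by have [|] := pselect (Z x); [left|right].
have DC' : D (C `\` Z) by apply: (dset_D oD); ddef.
have [C' cC' C'C] := IH k _ DC' hC'.
have C'C1 : C' `<=` C by move=> x /C'C[].
exists (graph_on C' f); last first.
  by move=> x [C'x xf]; rewrite -[x]rsnocE xf; have [] := hf _ (C'C1 _ C'x).
apply: cell_graph => //; split; first by apply: Dgraph => //; exact: cell_definable cC'.
by apply: (continuous_within C'C1) => x /C'C[].
Qed.

End Cells.

(** * The discrete Poincare-Miranda theorem *)

Section CubicalGrid.
Variables (k m : nat).
Hypothesis m_gt0 : (0 < m)%N.

(** Cells of the cubical subdivision of [0, m]^k: an even entry [2 j] is the
    vertex [j] and an odd entry [2 j + 1] the edge from [j] to [j + 1]. *)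
Local Notation cub := {ffun 'I_k -> 'I_(m.*2).+1}.
Local Notation F2 := 'F_2.
Local Notation chain := (cub -> F2).

Definition upd (q : cub) (i : 'I_k) (v : nat) : cub :=
  [ffun l => if l == i then inord v else q l].

Definition up q i := upd q i (q i).+1.
Definition dn q i := upd q i (q i).-1.

(** The boundary of a chain modulo 2.  The value at [f] collects the cells of
    which [f] is a face. *)
Definition bd (c : chain) : chain := fun f => \sum_i
  (if odd (f i) then 0 else
     (0 < f i)%N%:R * c (dn f i) + (f i < m.*2)%N%:R * c (up f i)).

(** The commutator of the boundary with multiplication by [g].  It only sees the
    pairs of a cell and a face on which [g] takes different values: it cuts a
    chain along the hypersurface that separates [g = 0] from [g = 1]. *)
Definition cut (g : chain) (c : chain) : chain :=
  fun f => bd (fun q => g q * c q) f + g f * bd c f.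

Lemma F2_addxx (x : F2) : x + x = 0.
Proof. by rewrite -mulr2n -mulr_natr; case: x => [[|[|]]] // h; apply: val_inj. Qed.

Lemma sum_sym2 (A : 'I_k -> 'I_k -> F2) : (forall i, A i i = 0) ->
  (forall i l, A i l = A l i) -> \sum_i \sum_l A i l = 0.
Proof.
move=> A0 As.
have e i : \sum_l A i l = \sum_(l : 'I_k | (l < i)%N) A i l + \sum_(l : 'I_k | (i < l)%N) A i l.
  rewrite (bigID (fun l : 'I_k => (l < i)%N)) /=; congr (_ + _).
  rewrite (bigID (fun l : 'I_k => l == i)) /= [X in X + _]big1 ?add0r.
    by apply: eq_bigl => l; rewrite -leqNgt ltn_neqAle andbC eq_sym.
  by move=> l /andP[_ /eqP ->].
under eq_bigr do rewrite e.
rewrite big_split /= [X in X + _](exchange_big_dep xpredT) //=.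
rewrite [X in _ + X](_ : _ = \sum_(i < k) \sum_(l : 'I_k | (i < l)%N) A l i).
  exact: F2_addxx.
by apply: eq_bigr => i _; apply: eq_bigr => l _.
Qed.

Lemma updE (q : cub) i v l : (v <= m.*2)%N ->
  upd q i v l = (if l == i then v else q l) :> nat.
Proof. by move=> h; rewrite ffunE; case: eqP => // _; rewrite inordK. Qed.

Lemma dnE (q : cub) i l : dn q i l = (if l == i then (q i).-1 else q l) :> nat.
Proof. by rewrite updE //; apply: leq_trans (leq_pred _) _; rewrite -ltnS. Qed.

Lemma upE (q : cub) i l : (q i < m.*2)%N ->
  up q i l = (if l == i then (q i).+1 else q l) :> nat.
Proof. by move=> h; rewrite updE. Qed.

Lemma cubP (p q : cub) : (forall l, p l = q l :> nat) -> p = q.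
Proof. by move=> h; apply/ffunP => l; apply: val_inj; exact: h. Qed.

Lemma odd_lt (q : cub) i : odd (q i) -> (0 < q i < m.*2)%N.
Proof.
move=> h; have := ltn_ord (q i); rewrite ltnS leq_eqVlt => /orP[/eqP e|->].
  by move: h; rewrite e odd_double.
by rewrite andbT; case: (nat_of_ord _) h.
Qed.

Lemma dn_up (q : cub) i : (q i < m.*2)%N -> dn (up q i) i = q.
Proof.
move=> h; apply: cubP => l; rewrite dnE !upE // eqxx.
by case: (l =P i) => [->|].
Qed.

Lemma up_dn (q : cub) i : (0 < q i)%N -> up (dn q i) i = q.
Proof.
move=> h; have h' : (dn q i i < m.*2)%N.
  by rewrite dnE eqxx; move: (ltn_ord (q i)); lia.
apply: cubP => l; rewrite upE // !dnE eqxx.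
by case: (l =P i) => [->|]; rewrite ?prednK.
Qed.

(** Each edge has two end points: the augmentation of a boundary is 0. *)
Lemma sum_bd c : \sum_f bd c f = 0.
Proof.
rewrite exchange_big /= big1 // => i _.
have -> : \sum_(f : cub) (if odd (f i) then 0 else
   (0 < f i)%N%:R * c (dn f i) + (f i < m.*2)%N%:R * c (up f i)) =
  \sum_(f : cub | ~~ odd (f i) && (0 < f i)%N) c (dn f i) +
  \sum_(f : cub | ~~ odd (f i) && (f i < m.*2)%N) c (up f i).
  rewrite !big_mkcondr /= [in RHS]big_mkcond [X in _ = _ + X]big_mkcond -big_split /=.
  apply: eq_bigr => f _; case: odd => /=; first by rewrite addr0.
  by congr (_ + _); case: ifP => _; rewrite ?mul1r ?mul0r.
rewrite (reindex_onto (fun q => up q i) (fun q => dn q i)); last first.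
  by move=> f /andP[_ /up_dn].
rewrite [X in _ + X](reindex_onto (fun q => dn q i) (fun q => up q i)); last first.
  by move=> f /andP[_ /dn_up].
have e1 (q : cub) : (~~ odd (up q i i) && (0 < up q i i)%N && (dn (up q i) i == q)) = odd (q i).
  apply/idP/idP => [/andP[/andP[o _] /eqP e]|o]; last first.
    have /andP[h0 h1] := odd_lt o.
    by rewrite dn_up // upE // !eqxx /= o.
  have [h|h] := ltnP (q i) m.*2; first by move: o; rewrite upE // eqxx /= negbK.
  have e2 : q i = m.*2 :> nat by move: (ltn_ord (q i)); lia.
  have : up q i i = 0%N :> nat.
    by rewrite /up /upd ffunE eqxx /inord /insubd insubF //= e2; lia.
  move/ffunP/(_ i)/(congr1 (@nat_of_ord _)): e; rewrite dnE eqxx => e up0.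
  by move: e; rewrite up0 e2 /=; lia.
have e2 (q : cub) : (~~ odd (dn q i i) && (dn q i i < m.*2)%N && (up (dn q i) i == q)) = odd (q i).
  apply/idP/idP => [/andP[/andP[o h] /eqP e]|o]; last first.
    have /andP[h0 h1] := odd_lt o.
    by rewrite up_dn // dnE !eqxx /= -subn1 oddB // o /=; lia.
  move/ffunP/(_ i)/(congr1 (@nat_of_ord _)): e; rewrite upE // eqxx => e.
  by rewrite -e /= o.
rewrite (eq_bigl _ _ e1) [X in _ + X](eq_bigl _ _ e2).
rewrite (eq_bigr c) => [|q /odd_lt /andP[_ h]]; last by rewrite dn_up.
rewrite [X in _ + X](eq_bigr c) => [|q /odd_lt /andP[h _]]; last by rewrite up_dn.
exact: F2_addxx.
Qed.

Lemma updC q i l v w : i != l -> upd (upd q i v) l w = upd (upd q l w) i v.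
Proof.
move=> il; apply/ffunP => j; rewrite !ffunE.
by case: (j =P l) => [->|//]; rewrite eq_sym (negPf il).
Qed.

(** The double boundary is a sum over ordered pairs of distinct directions whose
    terms are symmetric. *)
Lemma bdbd c f : bd (bd c) f = 0.
Proof.
pose w (q : cub) (i : 'I_k) (b : bool) : F2 := if odd (q i) then 0 else
  if b then (0 < q i)%N%:R else (q i < m.*2)%N%:R.
pose mv (q : cub) i (b : bool) : cub := if b then dn q i else up q i.
have bdE c' q : bd c' q = \sum_i (w q i true * c' (mv q i true) + w q i false * c' (mv q i false)).
  by apply: eq_bigr => i _; rewrite /w; case: odd => //; rewrite !mul0r addr0.
have wE q i b l b' : i != l -> w (mv q i b) l b' = w q l b'.
  move=> il; rewrite /w /mv; suff -> : (if b then dn q i else up q i) l = q l by [].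
  by case: b; rewrite ffunE eq_sym (negPf il).
have w0 q i b b' : w q i b * w (mv q i b) i b' = 0.
  rewrite /w; case: (boolP (odd (q i))) => [_|ev]; first by rewrite mul0r.
  have [h|h] := boolP (if b then 0 < q i else q i < m.*2)%N; last first.
    by case: b h => /negPf ->; rewrite mul0r.
  suff -> : odd (mv q i b i) by rewrite mulr0.
  rewrite /mv; case: b h => h; last by rewrite upE // eqxx /= ev.
  by rewrite dnE eqxx -subn1 oddB //; case: odd ev.
have mvC q i l b b' : i != l -> mv (mv q i b) l b' = mv (mv q l b') i b.
  move=> il; have li : l != i by rewrite eq_sym.
  have e (q' : cub) j d j' : j != j' -> mv q' j d j' = q' j'.
    by move=> h; rewrite /mv; case: d; rewrite ffunE eq_sym (negPf h).
  have mvE (q' : cub) j d : mv q' j d = upd q' j (if d then (q' j).-1 else (q' j).+1).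
    by rewrite /mv; case: d.
  by rewrite [LHS]mvE [RHS]mvE !e // !mvE updC.
pose A i l : F2 := if i == l then 0 else
  w f i true * w f l true * c (mv (mv f i true) l true) +
  w f i false * w f l false * c (mv (mv f i false) l false) +
  (w f i true * w f l false * c (mv (mv f i true) l false) +
   w f i false * w f l true * c (mv (mv f i false) l true)).
rewrite bdE -[RHS](@sum_sym2 A); last 2 first.
- by move=> i; rewrite /A eqxx.
- move=> i l; rewrite /A eq_sym; case: eqVneq => // il.
  have li : i != l by rewrite eq_sym.
  by rewrite !(mvC _ i l) //; ring.
apply: eq_bigr => i _; rewrite !bdE !mulr_sumr -big_split.
apply: eq_bigr => l _.
change (w f i true * (w (mv f i true) l true * c (mv (mv f i true) l true) +
    w (mv f i true) l false * c (mv (mv f i true) l false)) +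
  w f i false * (w (mv f i false) l true * c (mv (mv f i false) l true) +
    w (mv f i false) l false * c (mv (mv f i false) l false)) = A i l).
rewrite /A; case: eqVneq => [<-|il].
  by rewrite !mulrDr !mulrA !w0 !mul0r !addr0.
by rewrite !wE //; ring.
Qed.

Lemma bdD c c' f : bd (fun q => c q + c' q) f = bd c f + bd c' f.
Proof.
rewrite /bd -big_split /=; apply: eq_bigr => i _.
by case: odd; rewrite ?addr0 // !mulrDr addrACA.
Qed.

Lemma eq_bd c c' : c =1 c' -> bd c =1 bd c'.
Proof. by move=> h f; apply: eq_bigr => i _; rewrite !h. Qed.

Lemma bd0 c : c =1 (fun=> 0) -> bd c =1 (fun=> 0).
Proof.
move=> c0 f; rewrite /bd big1 // => i _.
by rewrite !c0 !mulr0 addr0 if_same.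
Qed.

Lemma eq_cut g c c' : c =1 c' -> cut g c =1 cut g c'.
Proof. by move=> h f; rewrite /cut (eq_bd h); congr (_ + _); apply: eq_bd => q; rewrite h. Qed.

Lemma cutD g c c' f : cut g (fun q => c q + c' q) f = cut g c f + cut g c' f.
Proof.
rewrite /cut bdD mulrDr addrACA; congr (_ + _).
by rewrite -bdD; apply: eq_bd => q; rewrite mulrDr.
Qed.

Lemma cut0 g c : c =1 (fun=> 0) -> cut g c =1 (fun=> 0).
Proof.
by move=> c0 f; rewrite /cut !bd0 // ?mulr0 ?addr0 // => q; rewrite c0 mulr0.
Qed.

Lemma bd_cut g c f : bd (cut g c) f = cut g (bd c) f.
Proof.
rewrite /cut bdD bdbd add0r [X in _ = _ + X](_ : _ = 0) ?addr0 //.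
by rewrite bdbd mulr0.
Qed.

Fixpoint cuts (g : nat -> chain) (j : nat) (c : chain) : chain :=
  if j is j'.+1 then cut (g j') (cuts g j' c) else c.

Lemma eq_cuts g j c c' : c =1 c' -> cuts g j c =1 cuts g j c'.
Proof. by elim: j => [|j IH] h //=; apply: eq_cut; apply: IH. Qed.

Lemma cutsD g j c c' f : cuts g j (fun q => c q + c' q) f = cuts g j c f + cuts g j c' f.
Proof.
elim: j f => [|j IH] f //=; rewrite -cutD; apply: eq_cut; exact: IH.
Qed.

Lemma cuts0 g j c : c =1 (fun=> 0) -> cuts g j c =1 (fun=> 0).
Proof. by elim: j => [|j IH] h //=; apply: cut0; apply: IH. Qed.

Lemma cuts_sum g j (I : finType) (P : pred I) (c : I -> chain) f :
  cuts g j (fun q => \sum_(i | P i) c i q) f = \sum_(i | P i) cuts g j (c i) f.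
Proof.
elim: index_enum => [|i r IH].
  by rewrite big_nil cuts0 // => q; rewrite big_nil.
rewrite big_cons -IH; case: (boolP (P i)) => Pi.
  by rewrite -cutsD; apply: eq_cuts => q; rewrite big_cons Pi.
by apply: eq_cuts => q; rewrite big_cons (negPf Pi).
Qed.

Lemma bd_cuts g j c f : bd (cuts g j c) f = cuts g j (bd c) f.
Proof.
elim: j f => [|j IH] f //=; rewrite bd_cut; apply: eq_cut; exact: IH.
Qed.

Definition face (f q : cub) := exists i, [/\ ~~ odd (f i), odd (q i),
  (f i <= (q i).+1)%N, (q i <= (f i).+1)%N & forall l, l != i -> f l = q l].

Lemma cut_neq0 g c f : cut g c f != 0 -> exists q, [/\ face f q, c q != 0 & g q != g f].
Proof.
move=> h; apply: contrapT => /forallNP nq; move/negP: h; apply; apply/eqP.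
have z q : face f q -> g q * c q = g f * c q.
  move=> fq; have [->|c0] := eqVneq (c q) 0; first by rewrite !mulr0.
  have [->//|gq] := eqVneq (g q) (g f).
  by case: (nq q).
rewrite /cut /bd mulr_sumr -big_split /= big1 // => i _.
case: (boolP (odd (f i))) => ev; first by rewrite mulr0 addr0.
have zd : (0 < f i)%N%:R * (g (dn f i) * c (dn f i)) = g f * ((0 < f i)%N%:R * c (dn f i)).
  have [h|] := ltnP 0 (f i); rewrite ?mul0r ?mulr0 // !mul1r.
  apply: z; exists i; rewrite dnE eqxx; split => //; try by lia.
  by move=> l li; rewrite ffunE (negPf li).
have zu : (f i < m.*2)%N%:R * (g (up f i) * c (up f i)) = g f * ((f i < m.*2)%N%:R * c (up f i)).
  have [h|] := ltnP (f i) m.*2; rewrite ?mul0r ?mulr0 // !mul1r.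
  apply: z; exists i; rewrite upE // eqxx; split => //; try by lia.
  by move=> l li; rewrite ffunE (negPf li).
by rewrite mulrDr -zd -zu F2_addxx.
Qed.

Lemma face_even f q i : face f q -> ~~ odd (q i) -> f i = q i.
Proof.
move=> [l [_ o _ _ h]] ev; apply: h; apply/eqP => il.
by move: ev; rewrite il o.
Qed.

Lemma cuts_supp g j (c : chain) (i : 'I_k) (v : nat) : ~~ odd v ->
  (forall q : cub, c q != 0 -> q i = v :> nat) ->
  forall q : cub, cuts g j c q != 0 -> q i = v :> nat.
Proof.
move=> ev hv; elim: j => [|j IH] q /=; first exact: hv.
by move=> /cut_neq0[p [qp /IH pv _]]; rewrite (face_even qp) pv.
Qed.

Lemma cuts_const (g : nat -> chain) j (c : chain) (i : 'I_k) (v : nat) b : (i < j)%N -> ~~ odd v ->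
  (forall q : cub, c q != 0 -> q i = v :> nat) ->
  (forall q : cub, q i = v :> nat -> g i q = b) -> cuts g j c =1 (fun=> 0).
Proof.
move=> + ev hv hg; elim: j => [//|j IH]; rewrite ltnS leq_eqVlt => /orP[/eqP ij|ij] /=.
  move=> f; apply/eqP/negP => /negP /cut_neq0[q [fq cq]].
  have qv := cuts_supp ev hv cq.
  by rewrite -ij !hg ?eqxx // (face_even fq) qv.
by apply: cut0; exact: IH.
Qed.

(** The entries of index less than [j] are edges and the others vanish, except
    for the entry [i], which is arbitrary. *)
Definition flat j (i : option 'I_k) (q : cub) : bool :=
  [forall l : 'I_k, (Some l == i) || (if (l < j)%N then odd (q l) else q l == 0%N :> nat)].

Definition subgrid j : chain := fun q => (flat j None q)%:R.

Lemma sum_subgrid0 : \sum_f subgrid 0 f = 1.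
Proof.
rewrite (bigD1 [ffun=> ord0]) //= big1 ?addr0.
  by rewrite /subgrid (_ : flat _ _ _ = true) //; apply/forallP => l; rewrite ffunE.
move=> q /eqP nq; rewrite /subgrid; have [/forallP h|//] := boolP (flat 0 None q); case: nq.
by apply/ffunP => l; rewrite ffunE; apply: val_inj; have /eqP := h l.
Qed.

(** Modulo 2, the interior faces cancel in pairs and those in the two outer faces
    of each direction remain. *)
Lemma bd_subgrid j f : bd (subgrid j) f =
  \sum_(i : 'I_k | (i < j)%N) ((flat j (Some i) f && (f i == 0%N :> nat))%:R +
                         (flat j (Some i) f && (f i == m.*2 :> nat))%:R).
Proof.
rewrite /bd [RHS]big_mkcond /=; apply: eq_bigr => i _.
have fl (v : nat) : (v <= m.*2)%N -> odd v -> flat j None (upd f i v) = (i < j)%N && flat j (Some i) f.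
  move=> vm ov; apply/forallP/andP => [h|[ij /forallP h] l].
    split; first by have := h i; rewrite /= updE // eqxx ov; case: ifP => // _ /eqP v0; rewrite v0 in ov.
    apply/forallP => l; have [->|li] := eqVneq l i; first by rewrite eqxx.
    by have := h l; rewrite /= updE // (negPf li) => ->; rewrite orbT.
  rewrite /= updE //; have [->|li] := eqVneq l i; first by rewrite ij.
  by have := h l; rewrite (inj_eq Some_inj) (negPf li).
have [o|ev] := boolP (odd (f i)).
  case: ifP => // _; rewrite [X in _ && X](_ : _ = false) ?[X in _ + (_ && X)%:R](_ : _ = false) ?andbF ?addr0 //.
    by apply/negP => /eqP e; rewrite e odd_double in o.
  by apply/negP => /eqP e; rewrite e in o.
have fi : (f i <= m.*2)%N by rewrite -ltnS.
have [f0|fpos] := posnP (f i).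
  rewrite f0 mul0r add0r (_ : (0 < m.*2)%N) ?mul1r; last by rewrite double_gt0.
  rewrite /subgrid /up f0 fl //; last by rewrite double_gt0.
  rewrite (_ : (0 == m.*2)%N = false) ?andbF ?addr0 ?andbT; last by rewrite eq_sym double_eq0; lia.
  by case: (i < j)%N.
rewrite mul1r.
have e1 : subgrid j (dn f i) = ((i < j)%N && flat j (Some i) f)%:R.
  by rewrite /subgrid /dn fl //; [lia|rewrite -subn1 oddB //; case: odd ev].
rewrite e1 andbF add0r.
have [fm|fm] := ltnP (f i) m.*2.
  rewrite mul1r /subgrid /up fl //.
  rewrite F2_addxx (_ : (f i == m.*2 :> nat) = false) ?andbF ?if_same //; lia.
rewrite mul0r addr0 (_ : (f i == m.*2 :> nat)) ?andbT; first by case: (i < j)%N.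
by rewrite eqn_leq fi fm.
Qed.

(** Cutting the [k]-dimensional grid along the [k] hypersurfaces leaves an odd
    number of points.  In [cut g X = bd (g X) + g (bd X)] the first term has
    augmentation 0; in the second one the boundary commutes with the earlier
    cuts, and the outer faces of direction [i < j] are killed by the cut [i],
    as [g i] is constant there.  Only the face of direction [j] on which [g j]
    is 1 contributes, which is the grid of one dimension less. *)
Lemma sum_cuts (g : nat -> chain) j : (j <= k)%N ->
  (forall (i : 'I_k) (q : cub), q i = 0%N :> nat -> g i q = 1) ->
  (forall (i : 'I_k) (q : cub), q i = m.*2 :> nat -> g i q = 0) ->
  \sum_f cuts g j (subgrid j) f = 1.
Proof.
move=> jk g1 g0; elim: j jk => [|j IH] jk; first exact: sum_subgrid0.
pose jo := Ordinal jk.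
rewrite /= /cut big_split /= sum_bd add0r.
pose a0 (i : 'I_k) : chain := fun f => (flat j.+1 (Some i) f && (f i == 0%N :> nat))%:R.
pose a1 (i : 'I_k) : chain := fun f => (flat j.+1 (Some i) f && (f i == m.*2 :> nat))%:R.
have s0 i (q : cub) : a0 i q != 0 -> q i = 0%N :> nat.
  by rewrite /a0; case: andP => [[_ /eqP]|].
have s1 i (q : cub) : a1 i q != 0 -> q i = m.*2 :> nat.
  by rewrite /a1; case: andP => [[_ /eqP]|].
have e f : g j f * bd (cuts g j (subgrid j.+1)) f = cuts g j (subgrid j) f.
  rewrite bd_cuts (eq_cuts _ _ (bd_subgrid j.+1)) cuts_sum.
  rewrite (bigD1 jo) /=; last by [].
  rewrite [X in _ + X]big1 ?addr0; last first.
    move=> i /andP[ij /eqP ij']; rewrite cutsD.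
    have ij2 : (i < j)%N.
      by rewrite ltn_neqAle -ltnS ij andbT; apply/eqP => h; apply: ij'; exact: val_inj.
    rewrite (cuts_const (c := a0 i) ij2 _ (s0 i) (g1 i)) //.
    by rewrite (cuts_const (c := a1 i) ij2 _ (s1 i) (g0 i)) ?odd_double // addr0.
  rewrite (cutsD g j (a0 jo) (a1 jo)) mulrDr.
  have -> : g j f * cuts g j (a1 jo) f = 0.
    have [->|h] := eqVneq (cuts g j (a1 jo) f) 0; first by rewrite mulr0.
    have := cuts_supp _ (s1 jo) h; rewrite odd_double => /(_ isT) /(g0 jo) /= ->.
    by rewrite mul0r.
  have -> : g j f * cuts g j (a0 jo) f = cuts g j (a0 jo) f.
    have [->|h] := eqVneq (cuts g j (a0 jo) f) 0; first by rewrite mulr0.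
    by have := cuts_supp _ (s0 jo) h; rewrite /= => /(_ isT) /(g1 jo) /= ->; rewrite mul1r.
  rewrite addr0; apply: eq_cuts => q; rewrite /a0 /subgrid; congr (_%:R); congr nat_of_bool.
  have ltj (l : 'I_k) : l != jo -> (l < j.+1)%N = (l < j)%N.
    by move=> lj; rewrite ltnS leq_eqVlt (_ : (l == j :> nat) = false) //; apply/negbTE.
  apply/andP/forallP => [[/forallP h /eqP q0] l|h].
    have [->|lj] := eqVneq l jo; first by rewrite /= ltnn q0.
    by have := h l; rewrite (inj_eq Some_inj) (negPf lj) ltj.
  split; last by have := h jo; rewrite /= ltnn.
  apply/forallP => l; rewrite (inj_eq Some_inj); have [//|lj] := eqVneq l jo.
  by have := h l; rewrite ltj.
by under eq_bigr do rewrite e; apply: IH; exact: ltnW.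
Qed.

Definition in_closure (p q : cub) := forall l,
  [/\ (p l <= (q l).+1)%N, (q l <= (p l).+1)%N & ~~ odd (q l) -> p l = q l].

Lemma in_closure_refl q : in_closure q q.
Proof. by move=> l; rewrite leqnSn. Qed.

Lemma in_closure_face f q p : face f q -> in_closure p f -> in_closure p q.
Proof.
move=> [i [ev o h1 h2 h3]] pf l; have [a b c] := pf l.
have [->|li] := eqVneq l i.
  by have [_ _ /(_ ev) ->] := pf i; split => //; rewrite o.
by rewrite -h3.
Qed.

(** A point that survives all the cuts is the end of a flag of cells, along
    which each [g i] changes its value once. *)
Lemma cuts_flag g j c f : cuts g j c f != 0 -> exists q0,
  in_closure f q0 /\ forall i : nat, (i < j)%N -> exists p p',
    [/\ in_closure p q0, in_closure p' q0 & g i p != g i p'].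
Proof.
elim: j f => [|j IH] f /=; first by move=> _; exists f; split => //; exact: in_closure_refl.
move=> /cut_neq0[q [fq /IH[q0 [qq0 h]] gq]].
have trans p : in_closure p q -> in_closure p q0.
  move=> pq l; have [a b e] := pq l; have [a' b' e'] := qq0 l.
  have [o|ev] := boolP (odd (q0 l)); last first.
    by have e1 := e' ev; rewrite e1 in a b e; split => //; rewrite e.
  split => //; have [o'|ev'] := boolP (odd (q l)); try (by rewrite (e ev'));
  by move: a b a' b' o o'; lia.
exists q0; split; first by apply: trans; apply: in_closure_face fq (in_closure_refl f).
move=> i; rewrite ltnS leq_eqVlt => /orP[/eqP ->|/h//].
exists q, f; split => //.
by apply: trans; apply: in_closure_face fq (in_closure_refl f).
Qed.

(** If [G i] holds on the face [z i = 0] and fails on the face [z i = m], then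
    some unit cube, the one with lowest corner [a], sees both values of every
    [G i]. *)
Theorem discrete_poincare_miranda (G : 'I_k -> {ffun 'I_k -> 'I_m.+1} -> bool) :
  (forall i (z : {ffun 'I_k -> 'I_m.+1}), z i = 0%N :> nat -> G i z) ->
  (forall i (z : {ffun 'I_k -> 'I_m.+1}), z i = m :> nat -> ~~ G i z) ->
  exists a : 'I_k -> nat, forall i, exists p p' : {ffun 'I_k -> 'I_m.+1},
    [/\ forall l, (a l <= p l <= (a l).+1)%N, forall l, (a l <= p' l <= (a l).+1)%N
       & G i p != G i p'].
Proof.
move=> G1 G0.
pose vert (q : cub) : {ffun 'I_k -> 'I_m.+1} := [ffun l => inord (q l)./2].
have vertE q l : vert q l = (q l)./2 :> nat.
  by rewrite ffunE inordK //; move: (ltn_ord (q l)); lia.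
pose g (i : nat) (q : cub) : F2 := if insub i is Some i' then (G i' (vert q))%:R else 0.
have gE (i : 'I_k) q : g i q = (G i (vert q))%:R.
  by rewrite /g valK.
have g1 (i : 'I_k) (q : cub) : q i = 0%N :> nat -> g i q = 1.
  by move=> q0; rewrite gE G1 // vertE q0.
have g0 (i : 'I_k) (q : cub) : q i = m.*2 :> nat -> g i q = 0.
  by move=> q0; rewrite gE (negPf (G0 _ _ _)) // vertE q0 doubleK.
have s1 := sum_cuts (leqnn k) g1 g0.
have [f hf] : exists f, cuts g k (subgrid k) f != 0.
  apply: contrapT => /forallNP n0; move: s1; rewrite big1 // => f _.
  by apply/eqP; have /negP := n0 f; rewrite negbK.
have [q0 [_ h]] := cuts_flag hf.
exists (fun l => (q0 l)./2) => i; have [p [p' [pq pq' gp]]] := h i (ltn_ord i).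
have vb q : in_closure q q0 -> forall l, ((q0 l)./2 <= vert q l <= (q0 l)./2.+1)%N.
  move=> qq0 l; rewrite vertE; have [a b e] := qq0 l.
  have [o|/e ->] := boolP (odd (q0 l)); last by rewrite leqnn leqnSn.
  by move: a b o; lia.
exists (vert p), (vert p'); split; [exact: vb|exact: vb|].
by move: gp; rewrite !gE; apply: contraNN => /eqP ->.
Qed.

End CubicalGrid.

(** * The Euclidean norm *)

Section EuclideanNorm.
Variables (R : rcfType) (n : nat).
Implicit Types x y z : 'rV[R]_n.

Let sumsq x := \sum_(i < n) x 0 i ^+ 2.

Lemma sumsq_ge0 x : 0 <= sumsq x.
Proof. by apply: sumr_ge0 => i _; exact: sqr_ge0. Qed.

Lemma enorm_ge0 x : 0 <= enorm x.
Proof. exact: sqrtr_ge0. Qed.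

Lemma enorm_sqr x : enorm x ^+ 2 = \sum_(i < n) x 0 i ^+ 2.
Proof. by rewrite sqr_sqrtr ?sumsq_ge0. Qed.

Lemma enorm0 : enorm (0 : 'rV[R]_n) = 0.
Proof. by rewrite /enorm big1 ?sqrtr0 // => i _; rewrite mxE expr0n. Qed.

Lemma enormZ a x : enorm (a *: x) = `|a| * enorm x.
Proof.
rewrite /enorm -sqrtr_sqr -sqrtrM ?sqr_ge0 // mulr_sumr; congr Num.sqrt.
by apply: eq_bigr => i _; rewrite mxE exprMn.
Qed.

Lemma enormN x : enorm (- x) = enorm x.
Proof. by rewrite -scaleN1r enormZ normrN normr1 mul1r. Qed.

Lemma enorm_coord x i : `|x 0 i| <= enorm x.
Proof.
rewrite -sqrtr_sqr; apply: ler_wsqrtr; rewrite (bigD1 i) //= lerDl.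
by apply: sumr_ge0 => j _; exact: sqr_ge0.
Qed.

Lemma enorm_eq0 x : enorm x = 0 -> x = 0.
Proof.
move=> x0; apply/rowP => i; rewrite mxE; apply/eqP; rewrite -normr_eq0.
by rewrite eq_le normr_ge0 -x0 enorm_coord.
Qed.

Lemma enorm_gt0 x : x <> 0 -> 0 < enorm x.
Proof. by move=> x0; rewrite lt_def enorm_ge0 andbT; apply/eqP => /enorm_eq0. Qed.

Lemma cauchy_schwarz x y : \sum_(i < n) x 0 i * y 0 i <= enorm x * enorm y.
Proof.
have [/eqP x0|x0] := eqVneq (enorm x) 0.
  by rewrite (enorm_eq0 (eqP x0)) enorm0 mul0r big1 // => i _; rewrite mxE mul0r.
have [/eqP y0|y0] := eqVneq (enorm y) 0.
  by rewrite (enorm_eq0 (eqP y0)) enorm0 mulr0 big1 // => i _; rewrite mxE mulr0.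
have p0 : 0 < enorm x * enorm y by rewrite mulr_gt0 // lt_def enorm_ge0 andbT.
have h : 0 <= \sum_(i < n) (enorm y * x 0 i - enorm x * y 0 i) ^+ 2.
  by apply: sumr_ge0 => i _; exact: sqr_ge0.
have e a b : \sum_(i < n) (b * x 0 i - a * y 0 i) ^+ 2 =
    b ^+ 2 * (\sum_(i < n) x 0 i ^+ 2) + a ^+ 2 * (\sum_(i < n) y 0 i ^+ 2)
    - 2 * (a * b) * \sum_(i < n) x 0 i * y 0 i.
  rewrite !mulr_sumr -big_split -sumrB.
  by apply: eq_bigr => i _ /=; ring.
move: h; rewrite e -!enorm_sqr.
set S := \sum_(i < n) _; set u := enorm x in p0 *; set v := enorm y in p0 * => h.
rewrite -subr_ge0 -(pmulr_rge0 _ p0).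
have -> : u * v * (u * v - S) = (v ^+ 2 * u ^+ 2 + u ^+ 2 * v ^+ 2 - 2 * (u * v) * S) / 2.
  by field.
by rewrite divr_ge0.
Qed.

Lemma enormD x y : enorm (x + y) <= enorm x + enorm y.
Proof.
rewrite -(@ler_pXn2r _ 2) ?nnegrE ?addr_ge0 ?enorm_ge0 //.
rewrite sqrrD !enorm_sqr.
have -> : \sum_(i < n) (x + y) 0 i ^+ 2 = \sum_(i < n) x 0 i ^+ 2
    + (\sum_(i < n) x 0 i * y 0 i) *+ 2 + \sum_(i < n) y 0 i ^+ 2.
  rewrite -sumrMnl -!big_split; apply: eq_bigr => i _ /=.
  by rewrite mxE sqrrD.
by rewrite lerD2r lerD2l lerMn2r cauchy_schwarz orbT.
Qed.

Lemma enormB x y : enorm (x - y) = enorm (y - x).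
Proof. by rewrite -opprB enormN. Qed.

Lemma enorm_triangle x y z : enorm (x - z) <= enorm (x - y) + enorm (y - z).
Proof. by have := enormD (x - y) (y - z); rewrite addrA subrK. Qed.

Lemma enorm_sub_ge x y : enorm x - enorm y <= enorm (x - y).
Proof. by have := enormD (x - y) y; rewrite subrK lerBlDr. Qed.

End EuclideanNorm.

Lemma enorm_le_coord (R : rcfType) n (x : 'rV[R]_n) c :
  (forall i, `|x 0 i| <= c) -> enorm x <= n%:R * c.
Proof.
case: n x => [|n] x xc; first by rewrite /enorm big_ord0 sqrtr0 mul0r.
have c0 : 0 <= c by apply: le_trans (xc ord0).
rewrite -(@ler_pXn2r _ 2) ?nnegrE ?enorm_ge0 ?mulr_ge0 // enorm_sqr.
have h : \sum_(i < n.+1) x 0 i ^+ 2 <= \sum_(i < n.+1) c ^+ 2.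
  apply: ler_sum => i _; rewrite -[x 0 i ^+ 2]ger0_norm ?sqr_ge0 // normrX.
  by rewrite ler_pXn2r ?nnegrE.
apply: le_trans h _; rewrite sumr_const card_ord [leRHS]exprMn -[leLHS]mulr_natl ler_wpM2r ?sqr_ge0 //.
by rewrite -natrX ler_nat -{1}[n.+1]expn1 leq_pexp2l.
Qed.

(** * Definable compactness and continuous sections *)

Lemma common_threshold (R : realDomainType) (I : finType) (P : I -> R -> Prop) :
  (forall i, exists2 d, 0 < d & forall d', 0 < d' -> d' <= d -> P i d') ->
  exists2 d, 0 < d & forall i, P i d.
Proof.
move=> h.
have h' i : exists d, 0 < d /\ forall d', 0 < d' -> d' <= d -> P i d'.
  by have [d d0 hd] := h i; exists d.
have [f hf] := choice h'.
have m0 : 0 < \big[Order.min/1]_i f i by apply: lt_bigmin => // i _; have [] := hf i.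
exists (\big[Order.min/1]_i f i) => // i.
by have [f0 hi] := hf i; apply: hi => //; exact: bigmin_le.
Qed.

Section Compactness.
Variables (R : archiRcfType) (D : set_family R).
Hypothesis oD : o_minimal D.

(** The last coordinate of [F] is the parameter of a decreasing family.  The
    coordinates of the limit point are found one after the other: each is the
    supremum of the [u] such that, for every parameter, some point of the family
    near the coordinates already found has this coordinate at least [u]. *)
Lemma definable_compact n (F : set 'rV[R]_n.+1) (M : R) : D F ->
  (forall x d d', 0 < d' -> d' <= d -> F (rsnoc x d') -> F (rsnoc x d)) ->
  (forall d, 0 < d -> exists x, F (rsnoc x d)) ->
  (forall x d, 0 < d -> F (rsnoc x d) -> forall i, `|x 0 i| <= M) ->
  exists x : 'rV[R]_n, forall d, 0 < d -> exists y, F (rsnoc y d) /\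
    forall i, `|y 0 i - x 0 i| < d.
Proof.
move=> DF mono ne bnd.
suff h j : (j <= n)%N -> exists x : 'rV[R]_n, forall d, 0 < d -> exists y, F (rsnoc y d) /\
    forall i : 'I_n, (i < j)%N -> `|y 0 i - x 0 i| < d.
  by have [x hx] := h n (leqnn n); exists x => d /hx[y [Fy hy]]; exists y; split => // i; exact: hy.
elim: j => [|j IH] jn.
  by exists 0 => d /ne[y Fy]; exists y.
have [x hx] := IH (ltnW jn).
pose j0 := Ordinal jn.
pose S u := forall d : R, 0 < d -> exists y : 'rV[R]_n, (F (rsnoc y d) /\
    (forall i : 'I_n, (i < j)%N -> `|y 0 i - x 0 i| < d)) /\ u <= y 0 j0.
have tS : tame S.
  have dS : dset D (fun e => S (e 0%N)) by rewrite /S; ddef.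
  exact: (dset_tame oD dS (fun=> 0)).
have SM : S (- M).
  move=> d d0; have [y [Fy hy]] := hx d d0; exists y; split => //.
  by have := bnd _ _ d0 Fy j0; rewrite ler_norml => /andP[].
have Sle u : S u -> u <= M.
  move=> /(_ 1 ltr01)[y [[Fy _] uy]]; apply: (le_trans uy).
  by have := bnd _ _ ltr01 Fy j0; rewrite ler_norml => /andP[].
have [m hm am] := tame_sup tS SM Sle.
exists (\row_i if i == j0 then m else x 0 i) => d d0.
have [d1 d10 hd1] : exists2 d1 : R, 0 < d1 & forall y, F (rsnoc y d1) ->
    (forall i : 'I_n, (i < j)%N -> `|y 0 i - x 0 i| < d1) -> y 0 j0 < m + d.
  apply: contrapT => nd; have /hm : S (m + d); last by rewrite leNgt ltrDl d0.
  move=> d1 d10; apply: contrapT => ny; apply: nd; exists d1 => // y Fy hy.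
  by rewrite ltNge; apply/negP => h; apply: ny; exists y.
have [u [Su mu]] := am d d0.
pose d2 := Order.min d d1.
have d20 : 0 < d2 by rewrite lt_min d0.
have d2d : d2 <= d by rewrite ge_min lexx.
have d2d1 : d2 <= d1 by rewrite ge_min lexx orbT.
have [y [[Fy hy] uy]] := Su d2 d20.
exists y; split; first exact: mono Fy.
move=> i; rewrite ltnS mxE => ij; have [->|ij0] := eqVneq i j0.
  have h1 : y 0 j0 < m + d.
    apply: hd1; first exact: mono Fy.
    by move=> l lj; apply: lt_le_trans (hy l lj) d2d1.
  by rewrite ltr_norml; apply/andP; split; lra.
apply: lt_le_trans (hy i _) d2d.
by rewrite ltn_neqAle ij andbT.
Qed.

Definition box n (a : 'rV[R]_n) (L : R) : set 'rV[R]_n :=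
  [set y | forall i, `|y 0 i - a 0 i| <= L].

(** Pairs of ever closer points with distant values would accumulate at a point
    of discontinuity. *)
Lemma uniform_continuity n (a : 'rV[R]_n) L (f : 'rV[R]_n -> R) c :
  D (graph_on (box a L) f) ->
  (forall x, box a L x -> ~ exists2 c : R, 0 < c & discontinuous_at (box a L) f c x) ->
  0 < c -> exists2 d : R, 0 < d & forall y y', box a L y -> box a L y' ->
    (forall i, `|y 0 i - y' 0 i| < d) -> `|f y - f y'| < c.
Proof.
move=> Df cont c0; apply: contrapT => nd.
pose F := [set z : 'rV[R]_n.+1 | exists y' : 'rV[R]_n,
  (forall i, `|proj_init z 0 i - y' 0 i| < z 0 ord_max) /\ exists u u' : R,
  graph_on (box a L) f (rsnoc (proj_init z) u) /\
  (graph_on (box a L) f (rsnoc y' u') /\ c <= `|u - u'|)].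
have FE y d : F (rsnoc y d) <-> exists y', [/\ box a L y, box a L y',
    forall i, `|y 0 i - y' 0 i| < d & c <= `|f y - f y'|].
  rewrite /F /= proj_init_rsnoc rsnoc_last; split.
    by move=> [y' [yy' [u [u' [/graph_onP[By ->] [/graph_onP[By' ->] cu]]]]]]; exists y'.
  move=> [y' [By By' yy' cf]]; exists y'; split => //; exists (f y), (f y').
  by split; [apply/graph_onP|split => //; apply/graph_onP].
have [||||x hx] := @definable_compact n F (`|L| + \sum_i `|a 0 i|).
- by apply: (dset_D oD); rewrite /F; ddef.
- move=> x d d' d'0 dd' /FE[y' [By By' yy' cf]]; apply/FE; exists y'; split => // i.
  exact: lt_le_trans dd'.
- move=> d d0; apply: contrapT => nx; apply: nd; exists d => // y y' By By' yy'.
  by rewrite ltNge; apply/negP => cf; apply: nx; exists y; apply/FE; exists y'.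
- move=> x d d0 /FE[y' [By _ _ _]] i.
  rewrite -[x 0 i](subrK (a 0 i)); apply: le_trans (ler_normD _ _) _; apply: lerD.
    exact: le_trans (By i) (ler_norm _).
  by rewrite (bigD1 i) //= lerDl; apply: sumr_ge0.
have Bx : box a L x.
  move=> i; apply/ler_addgt0Pr => d d0; have [y [/FE[y' [By _ _ _]] yx]] := hx d d0.
  have := By i; have := yx i; rewrite distrC.
  have := ler_distD (y 0 i) (x 0 i) (a 0 i); lra.
apply: (cont x Bx); exists (c / 2); first by rewrite divr_gt0.
split => // d d0; have d20 : 0 < d / 2 by rewrite divr_gt0.
have [y [/FE[y' [By By' yy' cf]] yx]] := hx _ d20.
have [h|h] := lerP (c / 2) `|f y - f x|.
  by exists y; split => // i; apply: lt_le_trans (yx i) _; lra.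
exists y'; split => //.
  move=> i; have h1 := yy' i; have h2 := yx i.
  by move: h1 h2; rewrite !ltr_norml => /andP[? ?] /andP[? ?]; apply/andP; split; lra.
have h3 : `|f y - f y'| <= `|f y - f x| + `|f y' - f x|.
  by rewrite [`|f y' - _|]distrC; exact: ler_distD.
by lra.
Qed.

End Compactness.

Section ContinuousSections.
Variables (R : archiRcfType) (D : set_family R).
Hypothesis oD : o_minimal D.

Lemma D_box n (a : 'rV[R]_n) L : D (box a L).
Proof. by apply: (dset_D oD); rewrite /box; ddef. Qed.

Lemma discontinuous_at_sub n (X Y : set 'rV[R]_n) f (c : R) x : X `<=` Y ->
  X x -> discontinuous_at X f c x -> discontinuous_at Y f c x.
Proof.
move=> XY Xx [_ h]; split; first exact: XY.
by move=> d /h[x' [Xx' ? ?]]; exists x'; split => //; exact: XY.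
Qed.

(** A set of dimension at least [k] contains a [k]-cell, which is in bijection
    with its projection on suitable coordinates [s].  The inverse bijection
    [sigma] is continuous off a set of smaller dimension, so on a box. *)
Lemma sdim_ge_section n k (N : set 'rV[R]_n) : D N -> sdim_ge k N ->
  exists (a : 'rV[R]_k) (L : R) (sigma : 'rV[R]_k -> 'rV[R]_n) (s : 'I_k -> 'I_n),
  [/\ 0 < L, forall y, box a L y -> N (sigma y) /\ forall i, sigma y 0 (s i) = y 0 i &
    forall c, 0 < c -> exists2 d : R, 0 < d & forall y y', box a L y -> box a L y' ->
      (forall i, `|y 0 i - y' 0 i| < d) -> forall j, `|sigma y 0 j - sigma y' 0 j| < c].
Proof.
move=> DN hN.
have [C cC CN] := sdim_ge_cell oD DN hN.
have DC := cell_definable oD cC.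
have [s inj] := cell_inj cC.
pose S := [set p : 'rV[R]_k | exists x, C x /\ forall i, p 0 i = x 0 (s i)].
have DS : D S by apply: (dset_D oD); rewrite /S; ddef.
have hS : sdim_ge k S.
  apply: (sdim_ge_map oD (G := fun p x => C x /\ forall i, p 0 i = x 0 (s i))).
  - by ddef.
  - by move=> p x x' [Cx px] [Cx' px']; apply: inj => // i; rewrite -px -px'.
  apply: sdim_geS (cell_sdim_ge cC) => x Cx; exists (\row_i x 0 (s i)); split => // i.
  by rewrite mxE.
have chS p : exists x, S p -> C x /\ forall i, p 0 i = x 0 (s i).
  by have [[x hx]|nS] := pselect (S p); [exists x|exists 0].
have [sigma hsigma] := choice chS.
have Dg j (X : set 'rV[R]_k) : X `<=` S -> D X -> D (graph_on X (fun p => sigma p 0 j)).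
  move=> XS DX; apply: (dset_D oD).
  have d : dset D (fun e => X (rvec k (tl e)) /\ exists x, (C x /\
     forall i, rvec k (tl e) 0 i = x 0 (s i)) /\ e 0%N = x 0 j) by ddef.
  apply: (dset_ext d) => e; rewrite -[e]scons_tl rvec_scons graph_onP tl_scons /=.
  split; move=> [Xe h]; split => //; last first.
    by exists (sigma (rvec k (tl e))); split => //; exact: hsigma (XS _ Xe).
  case: h => x [[Cx px] ->].
  have [Cs ps] := hsigma _ (XS _ Xe).
  by have -> : x = sigma (rvec k (tl e)) by apply: inj => // i; rewrite -ps -px.
pose Z (j : 'I_n) := [set x | exists2 c : R, 0 < c & discontinuous_at S (fun p => sigma p 0 j) c x].
have DZ j : D (Z j) by apply: (D_discontinuous oD); exact: Dg.
have nZ j : ~ sdim_ge k (Z j).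
  apply: (discontinuous_dim oD (s := id) DS (Dg j S (fun _ h => h) DS)).
  by move=> x y _ _ h; apply/rowP.
pose S' := [set p | S p /\ forall j, ~ Z j p].
have DS' : D S'.
  apply: (dset_D oD); apply: (dset_and oD (P := fun e => S (rvec k e))); first by ddef.
  apply: (dset_all_ord oD (P := fun j e => ~ Z j (rvec k e))) => j.
  by have DZj := DZ j; ddef.
have hS' : sdim_ge k S'.
  have /sdim_geU[//|/sdim_ge_bigU[j /nZ//]] : sdim_ge k (S' `|` [set p | exists j, Z j p]).
  apply: sdim_geS hS => p Sp; have [h|h] := pselect (exists j, Z j p); first by right.
  by left; split => // j Zj; apply: h; exists j.
have [a [c [c0 hc]]] := sdim_ge_box oD DS' hS'.
have c20 : 0 < c / 2 by rewrite divr_gt0.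
have boxS' : box a (c / 2) `<=` S'.
  by move=> y hy; apply: hc => i; apply: le_lt_trans (hy i) _; lra.
have boxS : box a (c / 2) `<=` S by move=> y /boxS'[].
exists a, (c / 2), sigma, s; split => // [y /boxS /hsigma[Cy py]|e e0].
  by split; [exact: CN|move=> i; rewrite -py].
have [d d0 hd] : exists2 d, 0 < d & forall j : 'I_n, forall y y', box a (c / 2) y ->
    box a (c / 2) y' -> (forall i, `|y 0 i - y' 0 i| < d) -> `|sigma y 0 j - sigma y' 0 j| < e.
  apply: common_threshold => j.
  have [|d d0 hd] := uniform_continuity oD (Dg j _ boxS (D_box _ _)) _ e0.
    move=> x Bx [c' c'0 dc]; have [_ /(_ j)] := boxS' _ Bx; apply.
    by exists c' => //; apply: discontinuous_at_sub dc.
  exists d => // d' d'0 dd' y y' By By' yy'; apply: hd => // i.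
  exact: lt_le_trans (yy' i) dd'.
by exists d => // y y' By By' yy' j; exact: hd.
Qed.

End ContinuousSections.

(** * Approximate embeddings and dimension *)

Section GenericGrid.
Variables (R : archiRcfType) (D : set_family R).
Hypothesis oD : o_minimal D.

(** For fixed coordinates [J] and integers [t], the origins [s] for which [X]
    meets the plane of equations [x (J j) = s (J j) + t j r] contain no box, as
    [X] would otherwise project onto a box of dimension [k].  Finitely many
    [J] and [t] matter, so some box of origins avoids them all. *)
Lemma generic_grid n k (X : set 'rV[R]_n) (M r : R) : D X -> 0 < r ->
  (forall x, X x -> forall i, `|x 0 i| <= M) -> ~ sdim_ge k X ->
  exists (s : 'rV[R]_n) (rho : R), 0 < rho /\ forall x (J : 'I_k -> 'I_n), X x -> injective J ->
    ~ forall j, exists t : int, `|x 0 (J j) - (s 0 (J j) + t%:~R * r)| <= rho.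
Proof.
move=> DX r0 XM nX.
(* The integers that can occur are bounded, as origins are taken in the unit cube. *)
pose l := Num.bound ((`|M| + 3) / r).
have lM : M + 3 < l%:R * r.
  have : 0 <= (`|M| + 3) / r by rewrite divr_ge0 ?addr_ge0 // ltW.
  move=> /archi_boundP; rewrite -/l ltr_pdivrMr //; apply: le_lt_trans.
  by rewrite lerD2r ler_norm.
pose tt (i : 'I_(l.*2).+1) : R := (i%:R - l%:R) * r.
pose Z (Jt : {ffun 'I_k -> 'I_n} * {ffun 'I_k -> 'I_(l.*2).+1}) : set 'rV[R]_n :=
  [set s | injective Jt.1 /\ exists x, X x /\ forall j, x 0 (Jt.1 j) = s 0 (Jt.1 j) + tt (Jt.2 j)].
have DZ Jt : D (Z Jt) by apply: (dset_D oD); rewrite /Z /tt; ddef.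
have nZ Jt : ~ sdim_ge n (Z Jt).
  move=> /(sdim_ge_box oD (DZ Jt))[z [c [c0 hz]]].
  have [zz _] : Z Jt z by apply: hz => i; rewrite subrr normr0.
  case: Jt zz hz {DZ} => J t /= injJ hz; apply: nX.
  pose G (x : 'rV[R]_n) (y : 'rV[R]_k) := X x /\ forall j, x 0 (J j) = y 0 j.
  have : sdim_ge k [set x | exists y, G x y]; last by apply: sdim_geS => x [y []].
  apply: (sdim_ge_map oD); first by rewrite /G; ddef.
    by move=> x y y' [_ h] [_ h']; apply/rowP => j; rewrite -h -h'.
  apply: (box_sdim_ge (z := \row_j (z 0 (J j) + tt (t j))) c0) => y hy.
  pose s := \row_i (if [pick j | J j == i] is Some j then y 0 j - tt (t j) else z 0 i).
  have sJ j : s 0 (J j) = y 0 j - tt (t j).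
    by rewrite mxE; case: pickP => [j' /eqP /injJ ->//|/(_ j)]; rewrite eqxx.
  have [_ [x [Xx xs]]] : Z (J, t) s.
    apply: hz => i; rewrite mxE; case: pickP => [j /eqP <-|_]; last by rewrite subrr normr0.
    by have := hy j; rewrite mxE opprD addrA -addrA -opprD [_ + tt _]addrC opprD addrA.
  by exists x; split => // j; rewrite xs sJ subrK.
pose c2 : R := 2^-1.
have c20 : 0 < c2 by rewrite invr_gt0.
pose U : set 'rV[R]_n := [set s | forall i, `|s 0 i - c2| < c2].
have hU : sdim_ge n U.
  by apply: (box_sdim_ge (z := \row_i c2) c20) => x hx i; have := hx i; rewrite mxE.
pose W := [set s | U s /\ forall Jt, ~ Z Jt s].
have hW : sdim_ge n W.
  have /sdim_geU[//|/sdim_ge_bigU[Jt /nZ//]] : sdim_ge n (W `|` [set s | exists Jt, Z Jt s]).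
  apply: sdim_geS hU => s Us; have [h|h] := pselect (exists Jt, Z Jt s); first by right.
  by left; split => // Jt ZJ; apply: h; exists Jt.
have DW : D W.
  apply: (dset_D oD); apply: (dset_and oD (P := fun e => U (rvec n e))).
    by rewrite /U; ddef.
  have d : dset D (fun e => forall i : 'I_#|{: {ffun 'I_k -> 'I_n} * {ffun 'I_k -> 'I_(l.*2).+1}}|,
     ~ Z (enum_val i) (rvec n e)).
    apply: (dset_all_ord oD (P := fun i e => ~ Z (enum_val i) (rvec n e))) => i.
    by have DZi := DZ (enum_val i); ddef.
  apply: (dset_ext d) => e; split => [h Jt|h i]; last exact: h.
  by have := h (enum_rank Jt); rewrite enum_rankK.
have [s [c [c0 hs]]] := sdim_ge_box oD DW hW.
pose rho := Order.min (c / 2) 1.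
have rho0 : 0 < rho by rewrite lt_min divr_gt0 //= ltr01.
have rhoc : rho < c.
  by apply: (@le_lt_trans _ _ (c / 2)); [rewrite ge_min lexx|lra].
have rho1 : rho <= 1 by rewrite ge_min lexx orbT.
exists s, rho; split => // x J Xx injJ /choice[t ht].
have [Us _] : W s by apply: hs => i; rewrite subrr normr0.
have tb j : (`|t j| <= l)%N.
  have e : `|t j|%N%:R * r = `|(t j)%:~R * r|.
    by rewrite normrM (gtr0_norm r0) natr_absz intr_norm.
  rewrite -(ler_nat R) -(ler_pM2r r0) e.
  have h1 := ht j; have h2 := XM x Xx (J j); have h3 := Us (J j).
  apply: le_trans (ltW lM).
  by move: h1 h2 h3; rewrite /c2 !ler_norml ltr_norml => /andP[? ?] /andP[? ?] /andP[? ?];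
    apply/andP; split; lra.
have tb' j : (`|(t j + l%:Z)%R| < (l.*2).+1)%N by have := tb j; lia.
pose t' := [ffun j => Ordinal (tb' j)].
have t'E j : tt (t' j) = (t j)%:~R * r.
  rewrite /tt ffunE /= natr_absz ger0_norm; last by have := tb j; lia.
  by rewrite intrD -pmulrn addrK.
pose s' := \row_i (if [pick j | J j == i] is Some j then x 0 (J j) - tt (t' j) else s 0 i).
have s'J j : s' 0 (J j) = x 0 (J j) - tt (t' j).
  by rewrite mxE; case: pickP => [j' /eqP /injJ ->//|/(_ j)]; rewrite eqxx.
have [_ /(_ ([ffun j => J j], t'))] : W s'.
  apply: hs => i; rewrite mxE; case: pickP => [j /eqP <-|_]; last by rewrite subrr normr0.
  apply: le_lt_trans rhoc; rewrite t'E; apply: le_trans (ht j).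
  by rewrite le_eqVlt; apply/orP; left; apply/eqP; congr `|_|; ring.
apply; split => /=.
  by move=> i j; rewrite !ffunE => /injJ.
exists x; split => // j.
have -> : [ffun j0 => J j0] j = J j by rewrite ffunE.
by rewrite s'J subrK.
Qed.

End GenericGrid.

Lemma exists_switch (P : nat -> bool) k : P 0%N -> ~~ P k ->
  exists2 i, (i < k)%N & P i && ~~ P i.+1.
Proof.
move=> P0; elim: k => [|k IH] nP; first by rewrite P0 in nP.
have [Pk|/IH[i ik hi]] := boolP (P k); first by exists k; rewrite ?Pk.
by exists i => //; exact: ltnW.
Qed.

(** Closeness to a grid hyperplane means distance at most [i g] for colour [i].
    This tolerance grows with [i] in order to separate the pieces: a point of
    colour [i] has no hyperplane at distance between [i g] and [(i + 1) g], so
    moving by less than [g] does not change the hyperplanes it is close to. *)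
Section Pieces.
Variables (R : archiRcfType) (n k : nat) (s : 'rV[R]_n) (r g : R).
Hypotheses (r0 : 0 < r) (g0 : 0 < g) (rg : 2 * (k%:R * g) < r).

Definition near_planes (c : R) (x : 'rV[R]_n) : {set 'I_n} :=
  [set j | `[< exists t : int, `|x 0 j - (s 0 j + t%:~R * r)| <= c >]].

Definition has_color (i : nat) (x : 'rV[R]_n) : bool :=
  (i <= #|near_planes (i%:R * g) x|)%N && (#|near_planes (i.+1%:R * g) x| <= i)%N.

(** The shift by [i g] puts the points close to a hyperplane with those that lie
    between it and the next one. *)
Definition piece (i : nat) (x : 'rV[R]_n) (j : 'I_n) : int :=
  Num.floor ((x 0 j - s 0 j + i%:R * g) / r).

Lemma near_planesS c c' x : c <= c' -> near_planes c x \subset near_planes c' x.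
Proof.
move=> cc'; apply/fintype.subsetP => j; rewrite inE => /asboolP[t ht].
rewrite inE; apply/asboolP; exists t; exact: le_trans ht cc'.
Qed.

Lemma has_color_exists (x : 'rV[R]_n) :
  (forall J : 'I_k -> 'I_n, injective J ->
     ~ forall j, exists t : int, `|x 0 (J j) - (s 0 (J j) + t%:~R * r)| <= k%:R * g) ->
  exists2 i, (i < k)%N & has_color i x.
Proof.
move=> h; have [|i ik /andP[h1 h2]] := @exists_switch (fun i => i <= #|near_planes (i%:R * g) x|)%N k isT.
  apply/negP => hk.
  pose J (j : 'I_k) := enum_val (widen_ord hk j).
  apply: (h J) => [j j' /enum_val_inj /(congr1 val) /= e|j]; first exact: val_inj.
  by have := enum_valP (widen_ord hk j); rewrite inE => /asboolP.
by exists i => //; rewrite /has_color h1 leqNgt.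
Qed.

Lemma piece_diam i (x x' : 'rV[R]_n) j : piece i x j = piece i x' j -> `|x 0 j - x' 0 j| < r.
Proof.
rewrite /piece => e.
have /andP[a1 a2] := floor_itv ((x 0 j - s 0 j + i%:R * g) / r).
have /andP[b1 b2] := floor_itv ((x' 0 j - s 0 j + i%:R * g) / r).
rewrite -e in b1 b2; move: (Num.floor _) a1 a2 b1 b2 => t.
rewrite !ler_pdivlMr // !ltr_pdivrMr // intrD mulr1z mulrDl mul1r => a1 a2 b1 b2.
by rewrite ltr_norml; apply/andP; split; lra.
Qed.

(** Otherwise a hyperplane would lie between [x - i g] and [x' - i g] in the
    direction [j], so at distance between [i g] and [(i + 1) g] from [x]. *)
Lemma piece_le i (x x' : 'rV[R]_n) j : (i < k)%N -> has_color i x -> `|x 0 j - x' 0 j| < g ->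
  piece i x' j <= piece i x j.
Proof.
move=> ik /andP[h1 h2] xx'; rewrite leNgt; apply/negP => lt.
pose t := piece i x' j.
have ti : i.+1%:R * g = i%:R * g + g by rewrite -natr1 mulrDl mul1r.
have kg : i.+1%:R * g <= k%:R * g by rewrite ler_pM2r // ler_nat.
have xt : x 0 j - s 0 j + i%:R * g < t%:~R * r.
  by rewrite -ltr_pdivrMr // -floor_lt_int.
have x't : t%:~R * r <= x' 0 j - s 0 j + i%:R * g.
  by rewrite -ler_pdivlMr // ge_floor.
have ig : 0 <= i%:R * g by rewrite mulr_ge0 // ltW.
move: xx'; rewrite ltr_norml => /andP[xx1 xx2].
have sub : near_planes (i%:R * g) x = near_planes (i.+1%:R * g) x.
  apply/eqP; rewrite eqEcard near_planesS ?(leq_trans h2) //.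
  by rewrite ti lerDl ltW.
have : j \in near_planes (i.+1%:R * g) x.
  rewrite inE; apply/asboolP; exists t.
  by rewrite ti ler_norml; apply/andP; split; lra.
rewrite -sub inE => /asboolP[t']; rewrite ler_norml => /andP[t1 t2].
have rg1 : 2 * (i%:R * g + g) < r.
  by rewrite -ti; apply: le_lt_trans rg; rewrite ler_pM2l.
have d1 : (t - t')%:~R * r < 1 * r.
  by rewrite intrB mulrBl mul1r; lra.
have d2 : 0 * r < (t - t')%:~R * r.
  by rewrite intrB mulrBl mul0r; lra.
move: d1 d2; rewrite !ltr_pM2r // => d1 d2.
have e1 : t - t' < 1 by rewrite -(ltr_int R).
have e2 : 0 < t - t' by rewrite -(ltr_int R).
by move: (t - t') e1 e2; clear; lia.
Qed.

Lemma piece_near i (x x' : 'rV[R]_n) j : (i < k)%N -> has_color i x -> has_color i x' ->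
  `|x 0 j - x' 0 j| < g -> piece i x j = piece i x' j.
Proof.
move=> ik cx cx' h; apply/eqP; rewrite eq_le !piece_le //.
by rewrite distrC.
Qed.

End Pieces.

Section Approximation.
Variables (R : archiRcfType) (D : set_family R).
Hypothesis oD : o_minimal D.

(** If [Y] had dimension less than [k], the fine grid of a [k]-box in [X] would
    be coloured by the pieces in which the approximate images lie.  The
    predicate [G i] below marks the grid points on the lower face of direction
    [i] and the neighbours of the pieces of colour [i] that reach this face.
    The pieces are too small to reach the opposite face, and [G i] is constant
    around a point of colour [i], so no unit cube sees both values of every
    [G i]. *)
Theorem sdim_ge_approx n k (X Y : set 'rV[R]_n) (K1 K2 M : R) : D X -> D Y ->
  0 < K1 -> 0 < K2 -> (forall y, Y y -> forall i, `|y 0 i| <= M) ->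
  (forall (I : finType) (w : I -> 'rV[R]_n) (c : R), (forall i, X (w i)) -> 0 < c ->
    exists phi : I -> 'rV[R]_n, (forall i, Y (phi i)) /\ forall i j,
      K1 * enorm (w i - w j) - c <= enorm (phi i - phi j) <= K2 * enorm (w i - w j) + c) ->
  sdim_ge k X -> sdim_ge k Y.
Proof.
move=> DX DY K10 K20 YM approx hX; apply: contrapT => nY.
have [a [L [sigma [sl [L0 sigmaP unif]]]]] := sdim_ge_section oD DX hX.
(* Two points of one piece are at distance less than [n r], so than [K1 L / 2]. *)
pose r := K1 * L / (2 * n.+1%:R).
have r0 : 0 < r by rewrite divr_gt0 ?mulr_gt0 ?ltr0n.
have nr : n%:R * r < K1 * L / 2.
  have -> : K1 * L / 2 = n.+1%:R * r.
    have : n.+1%:R != 0 :> R by rewrite pnatr_eq0.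
    by rewrite /r; move: (n.+1%:R) => N N0; field.
  by rewrite ltr_pM2r // ltr_nat.
have [s [rho [rho0 generic]]] := generic_grid oD DY r0 YM nY.
pose g := Order.min rho (r / 3) / k.+1%:R.
have mn0 : 0 < Order.min rho (r / 3) by rewrite lt_min rho0 divr_gt0.
have g0 : 0 < g by rewrite divr_gt0.
have kg : k%:R * g < Order.min rho (r / 3).
  by rewrite mulrA ltr_pdivrMr // mulrC ltr_pM2l // ltr_nat.
have kgrho : k%:R * g <= rho by apply/ltW/(lt_le_trans kg); rewrite ge_min lexx.
have rg : 2 * (k%:R * g) < r.
  have : k%:R * g < r / 3 by apply: (lt_le_trans kg); rewrite ge_min lexx orbT.
  by lra.
pose c := Order.min (g / 4) (K1 * L / 4).
have c0 : 0 < c by rewrite lt_min !divr_gt0 ?mulr_gt0 ?ltr0n.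
have cg : c <= g / 4 by rewrite ge_min lexx.
have cL : c <= K1 * L / 4 by rewrite ge_min lexx orbT.
pose c1 := g / (4 * K2 * n.+1%:R).
have c10 : 0 < c1 by rewrite divr_gt0 // !mulr_gt0 ?ltr0n.
have [d d0 hd] := unif c1 c10.
(* Two steps of the grid are shorter than [d].  With at least four steps, points
   within one step of two opposite faces are still [L] apart. *)
pose m := (Num.bound (4 * L / d)).+4.
have mR : 0 < m%:R :> R by rewrite ltr0n.
pose h := 2 * L / m%:R.
have h0 : 0 < h by rewrite divr_gt0 ?mulr_gt0.
have hm : h * m%:R = 2 * L.
  by rewrite /h mulfVK // lt0r_neq0.
have mh : m%:R * h = 2 * L by rewrite mulrC.
have h2d : 2 * h < d.
  have b0 : 0 <= 4 * L / d by rewrite divr_ge0 ?mulr_ge0 // ltW.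
  have := archi_boundP b0; rewrite ltr_pdivrMr // => hb.
  rewrite -(ltr_pM2r mR) -mulrA hm.
  have : (Num.bound (4 * L / d))%:R * d < m%:R * d.
    by rewrite ltr_pM2r // ltr_nat; exact: (leq_addl 3 (Num.bound (4 * L / d)).+1).
  by lra.
pose I := {ffun 'I_k -> 'I_m.+1}.
pose y (z : I) : 'rV[R]_k := \row_i (a 0 i - L + (z i)%:R * h).
have yB z : box a L (y z).
  move=> i; rewrite mxE.
  have z0 : 0 <= (z i)%:R * h by rewrite mulr_ge0 // ltW.
  have zm : (z i)%:R * h <= m%:R * h.
    by rewrite ler_pM2r // ler_nat -ltnS ltn_ord.
  by rewrite mh in zm; rewrite ler_norml; apply/andP; split; lra.
have Xs z : X (sigma (y z)) by have [] := sigmaP _ (yB z).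
have [x [Yx xK]] := approx I (fun z => sigma (y z)) c Xs c0.
pose close (q : nat) (z z' : I) := forall l, (z l <= z' l + q)%N /\ (z' l <= z l + q)%N.
have closex z z' : close 2 z z' -> forall j, `|x z 0 j - x z' 0 j| < g.
  move=> zz' j.
  have h1 : enorm (sigma (y z) - sigma (y z')) <= n%:R * c1.
    apply: enorm_le_coord => i; rewrite !mxE; apply/ltW/hd => // l.
    apply: le_lt_trans h2d; rewrite !mxE.
    have -> : a 0 l - L + (z l)%:R * h - (a 0 l - L + (z' l)%:R * h) =
       ((z l)%:R - (z' l)%:R) * h by ring.
    rewrite normrM (gtr0_norm h0) ler_pM2r // ler_norml.
    have [q1 q2] := zz' l; move: q1 q2; rewrite -!(ler_nat R) !natrD => q1 q2.
    by apply/andP; split; lra.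
  have /andP[_ h2] := xK z z'.
  have h3 := enorm_coord (x z - x z') j; rewrite !mxE in h3.
  apply: (le_lt_trans h3); apply: (le_lt_trans h2).
  have h4 : K2 * enorm (sigma (y z) - sigma (y z')) <= K2 * (n%:R * c1) by rewrite ler_pM2l.
  have h5 : K2 * (n%:R * c1) <= K2 * (n.+1%:R * c1).
    by rewrite ler_pM2l // ler_pM2r // ler_nat.
  have h6 : K2 * (n.+1%:R * c1) = g / 4.
    have N0 : n.+1%:R != 0 :> R by rewrite pnatr_eq0.
    have K20' : K2 != 0 by rewrite gt_eqF.
    by rewrite /c1; move: (n.+1%:R) N0 => N N0; field; rewrite N0.
  by lra.
have colx z : exists i : 'I_k, has_color s r g i (x z).
  have [J injJ hJ|i ik hi] := @has_color_exists _ n k s r g (x z).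
    apply: (generic (x z) J (Yx z) injJ) => j; have [t ht] := hJ j.
    by exists t; apply: le_trans ht kgrho.
  by exists (Ordinal ik).
have [col hcol] := choice colx.
pose pc (z : I) (i : nat) := piece s r g i (x z).
have same z z' (i : 'I_k) : close 2 z z' -> col z = i -> col z' = i ->
    forall j, pc z i j = pc z' i j.
  move=> zz' cz cz' j; apply: (piece_near r0 g0 rg (ltn_ord i)).
  - by rewrite -cz.
  - by rewrite -cz'.
  - exact: closex.
(* The piece of [z0] reaches the lower face of direction [i]. *)
pose link (i : 'I_k) (z0 : I) := exists z : I,
  [/\ col z = i, forall j, pc z i j = pc z0 i j & (z i <= 1)%N].
pose G (i : 'I_k) (z : I) : bool := `[< z i = 0%N :> nat \/
  exists z0 : I, [/\ close 1 z z0, col z0 = i & link i z0] >].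
have G1 (i : 'I_k) (z : I) : z i = 0%N :> nat -> G i z by move=> zi; apply/asboolP; left.
have G0 (i : 'I_k) (z : I) : z i = m :> nat -> ~~ G i z.
  move=> zi; apply/negP => /asboolP[zi0|[z0 [zz0 cz0 [z1 [cz1 pz1 z1i]]]]].
    by rewrite zi0 in zi.
  have [q1 q2] := zz0 i; rewrite zi in q1.
  have hx : enorm (x z0 - x z1) <= n%:R * r.
    apply: enorm_le_coord => j; rewrite !mxE; apply/ltW/(piece_diam (s := s) (g := g) r0 (i := i)).
    by rewrite -[LHS]pz1.
  have hs : L <= enorm (sigma (y z0) - sigma (y z1)).
    apply: le_trans (enorm_coord _ (sl i)); rewrite !mxE.
    have [_ ->] := sigmaP _ (yB z0); have [_ ->] := sigmaP _ (yB z1).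
    rewrite !mxE; apply: le_trans (ler_norm _).
    have -> : a 0 i - L + (z0 i)%:R * h - (a 0 i - L + (z1 i)%:R * h) =
       ((z0 i)%:R - (z1 i)%:R) * h by ring.
    have : m%:R - 2 <= (z0 i)%:R - (z1 i)%:R :> R.
      have q3 : (m + z1 i <= z0 i + 2)%N.
        by move: q1 z1i; generalize (nat_of_ord (z0 i)) (nat_of_ord (z1 i)); generalize m; clear; lia.
      by move: q3; rewrite -(ler_nat R) !natrD; lra.
    rewrite -(ler_pM2r h0); apply: le_trans.
    have m4 : 4 * h <= m%:R * h by rewrite ler_pM2r // ler_nat.
    by rewrite mulrBl; rewrite mh in m4 *; lra.
  have /andP[h1 _] := xK z0 z1.
  have h2 : K1 * L <= K1 * enorm (sigma (y z0) - sigma (y z1)) by rewrite ler_pM2l.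
  by lra.
have m0 : (0 < m)%N by [].
have [b hb] := discrete_poincare_miranda m0 G1 G0.
have bm l : (b l < m.+1)%N.
  have [p [_ [/(_ l)/andP[h1 _] _ _]]] := hb l.
  exact: leq_ltn_trans h1 (ltn_ord _).
pose p0 : I := [ffun l => Ordinal (bm l)].
pose i := col p0.
have GE (p : I) : (forall l, b l <= p l <= (b l).+1)%N -> G i p = `[< link i p0 >].
  move=> hp; have pp0 : close 1 p p0.
    by move=> l; rewrite ffunE /=; move: (hp l); generalize (nat_of_ord (p l)) (b l); clear; lia.
  apply/asboolP/asboolP => [[pi0|[z0 [pz0 cz0 [z1 [cz1 pz1 z1i]]]]]|lk].
  - exists p0; split => //; by have [_] := pp0 i; rewrite pi0.
  - exists z1; split => // j; rewrite pz1; apply: same => // l.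
    move: (pp0 l) (pz0 l).
    by generalize (nat_of_ord (p l)) (nat_of_ord (p0 l)) (nat_of_ord (z0 l)); clear; lia.
  - by right; exists p0.
have [p [p' [hp hp']]] := hb i.
by rewrite !GE // eqxx.
Qed.

End Approximation.

(** * Direction sets and their cones *)

Section Topology.
Variables (R : archiRcfType) (n : nat).
Implicit Types (x a : 'rV[R]_n) (A : set 'rV[R]_n).

Lemma ler_norm_enorm (x : 'rV[R]_n) : `|x : 'rV[(R : rcfType)]_n| <= enorm x.
Proof.
rewrite -[`|_|]/(mx_norm _) mx_normrE; apply: bigmax_le => [|[i j] _ /=].
  exact: enorm_ge0.
by rewrite ord1 enorm_coord.
Qed.

Lemma ler_enorm_norm (x : 'rV[R]_n) : enorm x <= n%:R * `|x : 'rV[(R : rcfType)]_n|.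
Proof. by apply: enorm_le_coord => i; exact: ler_coord_norm. Qed.

Lemma nbhs_enorm (x : 'rV[R]_n) (W : set 'rV[R]_n) : nbhs (x : 'rV[(R : rcfType)]_n) W ->
  exists2 rho : R, 0 < rho & forall y, enorm (y - x) < rho -> W y.
Proof.
move=> /nbhs_normP[rho /= rho0 h]; exists rho => // y yx; apply: h => /=.
by rewrite distrC; apply: le_lt_trans yx; exact: ler_norm_enorm.
Qed.

(** A first-order, hence definable, form of the direction set. *)
Definition direction (A : set 'rV[R]_n) (a : 'rV[R]_n) : Prop :=
  enorm a = 1 /\ forall e : R, 0 < e -> exists x, [/\ A x, 0 < enorm x, enorm x < e &
    enorm (x - enorm x *: a) < e * enorm x].

Lemma direction_setE A : direction_set A = direction A.
Proof.
apply/seteqP; split => a [a1].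
  move=> [x [Ax x0 xa]]; split => // e e0.
  have e1 : 0 < e / n.+1%:R by rewrite divr_gt0 ?ltr0n.
  have small y : `|y : 'rV[(R : rcfType)]_n| < e / n.+1%:R -> enorm y < e.
    move=> ye; apply: le_lt_trans (ler_enorm_norm y) _.
    have [y0|y0] := eqVneq (`|y : 'rV[(R : rcfType)]_n|) 0; first by rewrite y0 mulr0.
    apply: (@lt_trans _ _ (n.+1%:R * `|y : 'rV[(R : rcfType)]_n|)).
      by rewrite ltr_pM2r ?ltr_nat // lt_def y0 normr_ge0.
    by rewrite mulrC -ltr_pdivlMr ?ltr0n.
  move/cvgrPdist_lt/(_ _ e1): x0 => [N1 _ h1].
  move/cvgrPdist_lt/(_ _ e1): xa => [N2 _ h2].
  pose k := maxn N1 N2; exists (x k).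
  have [Axk xk0] := Ax k.
  have xk1 := enorm_gt0 xk0.
  split => //.
    by apply: small; have := h1 k (leq_maxl _ _); rewrite /= sub0r normrN.
  have -> : x k - enorm (x k) *: a = - (enorm (x k) *: (a - (enorm (x k))^-1 *: x k)).
    by rewrite scalerBr scalerA divff ?gt_eqF // scale1r opprB.
  rewrite enormN enormZ gtr0_norm // mulrC ltr_pM2r //.
  by apply: small; exact: (h2 k (leq_maxr _ _)).
move=> h; split => //.
have h' (k : nat) : exists x, [/\ A x, 0 < enorm x, enorm x < k.+1%:R^-1 &
    enorm (x - enorm x *: a) < k.+1%:R^-1 * enorm x].
  by apply: h; rewrite invr_gt0 ltr0n.
have [x hx] := choice h'.
have arch (e : R) : 0 < e -> exists N : nat, forall k, (N <= k)%N -> k.+1%:R^-1 < e.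
  move=> e0; have ei : 0 <= e^-1 by rewrite invr_ge0 ltW.
  exists (Num.bound e^-1) => k Nk.
  rewrite invf_plt ?posrE ?ltr0n //; apply: lt_trans (archi_boundP ei) _.
  by rewrite ltr_nat ltnS.
exists x; split.
- move=> k; have [Ak k0 _ _] := hx k; split => // xk0.
  by rewrite xk0 enorm0 ltxx in k0.
- apply/cvgrPdist_lt => e /arch[N hN]; exists N => // k /= Nk.
  rewrite sub0r normrN; apply: le_lt_trans (ler_norm_enorm _) _.
  by have [_ _ h1 _] := hx k; apply: lt_trans h1 (hN _ Nk).
- apply/cvgrPdist_lt => e /arch[N hN]; exists N => // k /= Nk.
  have [_ k0 _ h1] := hx k.
  apply: le_lt_trans (ler_norm_enorm _) _; apply: lt_trans (hN _ Nk).
  rewrite -(ltr_pM2r k0); apply: le_lt_trans h1.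
  rewrite mulrC -[X in X * _]gtr0_norm // -enormZ scalerBr scalerA divff ?gt_eqF //.
  by rewrite scale1r enormB.
Qed.

Lemma direction_germ A A' rho : 0 < rho -> (forall x, enorm x < rho -> A x -> A' x) ->
  direction A `<=` direction A'.
Proof.
move=> rho0 AA' a [a1 h]; split => // e e0.
have [|x [Ax x0 xe xa]] := h (Order.min e rho); first by rewrite lt_min e0.
move: xe; rewrite lt_min => /andP[xe xr]; exists x; split => //; first exact: AA'.
by apply: lt_le_trans xa _; rewrite ler_pM2r // ge_min lexx.
Qed.

End Topology.

Section Directions.
Variables (R : archiRcfType) (D : set_family R).
Hypothesis oD : o_minimal D.

Lemma D_direction n (A : set 'rV[R]_n) : D A -> D (direction A).
Proof.
move=> DA; apply: (dset_D oD).
have d : dset D (fun e => enorm (rvec n e) = 1 /\ forall c : R, 0 < c -> exists x : 'rV[R]_n,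
   A x /\ (0 < enorm x /\ (enorm x < c /\ enorm (x - enorm x *: rvec n e) < c * enorm x))).
  by ddef.
apply: (dset_ext d) => e; split => -[a1 h]; split => // c /h[x].
  by move=> [? [? [? ?]]]; exists x.
by move=> [? ? ? ?]; exists x.
Qed.

(** The set of scales [t] at which [A] has a point within [d t] of [t l a] is
    definable and accumulates at 0. *)
Lemma sequence_selection n (A : set 'rV[R]_n) a (l d : R) : D A -> direction A a ->
  0 < l -> 0 < d -> exists2 t0 : R, 0 < t0 & forall t, 0 < t -> t < t0 ->
    exists2 x, A x & enorm (x - t *: (l *: a)) < d * t.
Proof.
move=> DA [a1 dA] l0 d0.
have dS : dset D (fun e => exists2 x : 'rV[R]_n, A x &
    enorm (x - e 0%N *: (l *: (\row_i a 0 i))) < d * e 0%N).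
  have d1 : dset D (fun e => exists x : 'rV[R]_n, A x /\ enorm (x - e 0%N *: (l *: (\row_i a 0 i))) < d * e 0%N).
    by ddef; apply: (dfun_const oD).
  by apply: (dset_ext d1) => e; split => [[x []]|[x]]; exists x.
have aE : \row_i a 0 i = a by apply/rowP => i; rewrite mxE.
rewrite aE in dS.
have [|t0 t00 ht0] := tame_near0 (dset_tame oD dS (fun=> 0)).
  move=> c c0; pose e := Order.min (c * l) (d / l).
  have e0 : 0 < e by rewrite lt_min mulr_gt0 // divr_gt0.
  have [x [Ax x0 xe xa]] := dA e e0.
  exists (enorm x / l); split => /=.
    rewrite divr_gt0 //= ltr_pdivrMr //; apply: lt_le_trans xe _.
    by rewrite ge_min lexx.
  exists x => //; rewrite scalerA divfK ?gt_eqF //.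
  apply: lt_le_trans xa _; rewrite mulrA mulrAC ler_pM2r //.
  by rewrite ge_min lexx orbT.
exists t0 => // t t0' tt; have [|x Ax hx] := ht0 t; first by rewrite t0'.
by exists x.
Qed.

(** Otherwise the unit vectors of points of [A] that are ever closer to [B], and
    that stay away from the common directions, would accumulate at a common
    direction. *)
Lemma common_direction n (A B : set 'rV[R]_n) (eta : R) : D A -> D B -> 0 < eta ->
  exists2 e : R, 0 < e & forall x y, A x -> B y -> 0 < enorm x -> enorm x < e ->
    enorm (x - y) <= e * enorm x -> exists2 u, direction A u /\ direction B u &
      enorm (x - enorm x *: u) <= eta * enorm x.
Proof.
move=> DA DB eta0; apply: contrapT => ne.
have DdA := D_direction DA; have DdB := D_direction DB.
pose F := [set z : 'rV[R]_n.+1 | exists x y, A x /\ (B y /\ (0 < enorm x /\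
   (enorm x < z 0 ord_max /\ (enorm (x - y) <= z 0 ord_max * enorm x /\
   ((forall i, x 0 i = (enorm x *: proj_init z) 0 i) /\
   (forall v, direction A v -> direction B v -> eta <= enorm (proj_init z - v)))))))].
have FE u d : F (rsnoc u d) <-> exists x y, [/\ A x, B y, 0 < enorm x & enorm x < d] /\
   [/\ enorm (x - y) <= d * enorm x, x = enorm x *: u &
      forall v, direction A v -> direction B v -> eta <= enorm (u - v)].
  rewrite /F /= proj_init_rsnoc rsnoc_last; split => [[x [y [? [? [? [? [? [/rowP ? ?]]]]]]]]|].
    by exists x, y.
  by move=> [x [y [[? ? ? ?] [? xu ?]]]]; exists x, y; do 6!split => //; move=> i; rewrite {1}xu.
have Fnorm u d : F (rsnoc u d) -> enorm u = 1.
  move=> /FE[x [y [[_ _ x0 _] [_ xu _]]]].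
  have := congr1 (@enorm R n) xu; rewrite enormZ gtr0_norm //.
  by rewrite -[LHS]mulr1 => /(mulfI (lt0r_neq0 x0)).
have [||||u hu] := @definable_compact R D oD n F 1.
- by apply: (dset_D oD); rewrite /F; ddef.
- move=> u d d' d'0 dd' /FE[x [y [[? ? x0 xd] [xy xu ?]]]]; apply/FE; exists x, y.
  split; split => //; first exact: lt_le_trans dd'.
  by apply: le_trans xy _; rewrite ler_pM2r.
- move=> d d0; apply: contrapT => nF; apply: ne; exists d => // x y Ax By x0 xd xy.
  apply: contrapT => nu; apply: nF; exists ((enorm x)^-1 *: x); apply/FE; exists x, y.
  have xx : x = enorm x *: ((enorm x)^-1 *: x) by rewrite scalerA divff ?gt_eqF // scale1r.
  split; split => // v dv dv'; rewrite leNgt; apply/negP => h; apply: nu; exists v => //.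
  by rewrite {1}xx -scalerBr enormZ gtr0_norm // mulrC ler_pM2r // ltW.
- by move=> u d d0 /Fnorm u1 i; rewrite -u1 enorm_coord.
have nN : 0 < n.+1%:R :> R by rewrite ltr0n.
have nK (e q : R) : n.+1%:R * (e / n.+1%:R / q) = e / q.
  by rewrite mulrA [_ * (e / _)]mulrC divfK ?gt_eqF.
have close (d : R) : 0 < d -> exists u', F (rsnoc u' d) /\ enorm (u' - u) <= n.+1%:R * d.
  move=> d0; have [u' [Fu' uu']] := hu d d0; exists u'; split => //.
  apply: (@le_trans _ _ (n%:R * d)); last by rewrite ler_pM2r // ler_nat.
  by apply: enorm_le_coord => i; rewrite !mxE ltW.
have u1 : enorm u = 1.
  apply/eqP; rewrite eq_le; apply/andP; split; apply/ler_addgt0Pr => e e0;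
    have [|u' [/Fnorm u1 uu']] := close (e / n.+1%:R); rewrite ?divr_gt0 //;
    rewrite mulrC divfK ?gt_eqF // in uu'.
    by have := enorm_sub_ge u u'; rewrite enormB u1; lra.
  by have := enorm_sub_ge u' u; rewrite u1; lra.
have dirAB : direction A u /\ direction B u.
  split; split => // e e0.
    pose d := Order.min e (e / n.+1%:R / 2).
    have d0 : 0 < d by rewrite lt_min e0 !divr_gt0.
    have de : d <= e by rewrite ge_min lexx.
    have de2 : n.+1%:R * d <= e / 2.
      by rewrite -nK ler_pM2l // ge_min lexx orbT.
    have [u' [/FE[x [y [[Ax By x0 xd] [xy xu _]]]] uu']] := close d d0.
    exists x; split => //; first exact: lt_le_trans de.
    rewrite {1}xu -scalerBr enormZ gtr0_norm // mulrC ltr_pM2r //.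
    by lra.
  pose d := Order.min (Order.min (e / 2) (1 / 2)) (e / n.+1%:R / 8).
  have d0 : 0 < d by rewrite !lt_min !divr_gt0 ?ltr01.
  have de : d <= e / 2 by rewrite !ge_min lexx.
  have d1 : d <= 1 / 2 by rewrite !ge_min lexx orbT.
  have de2 : n.+1%:R * d <= e / 8.
    by rewrite -nK ler_pM2l // ge_min lexx orbT.
  have de3 : d <= e / 8.
    by apply: le_trans de2; rewrite -[leLHS]mul1r ler_pM2r // ler1n.
  have [u' [/FE[x [y [[Ax By x0 xd] [xy xu _]]]] uu']] := close d d0.
  have dx : d * enorm x <= enorm x / 2 by rewrite mulrC ler_pM2l //; lra.
  have y1 := enorm_sub_ge x y.
  have y2 := enorm_sub_ge y x; rewrite enormB in y2.
  exists y; split => //; try lra.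
  have h1 : enorm (y - enorm y *: u) <= enorm (x - y) + enorm (x - enorm x *: u)
      + enorm (enorm x *: u - enorm y *: u).
    apply: le_trans (enorm_triangle _ (enorm x *: u) _) _; rewrite lerD2r.
    by apply: le_trans (enorm_triangle _ x _) _; rewrite (enormB y x).
  apply: le_lt_trans h1 _.
  have h2 : enorm (x - enorm x *: u) <= e / 8 * enorm x.
    rewrite {1}xu -scalerBr enormZ gtr0_norm // mulrC ler_pM2r //.
    exact: le_trans de2.
  have h3 : enorm (enorm x *: u - enorm y *: u) <= enorm (x - y).
    by rewrite -scalerBl enormZ u1 mulr1 ler_norml; apply/andP; split; lra.
  have h4 : d * enorm x <= e / 8 * enorm x by rewrite ler_pM2r.
  have h5 : e * (enorm x / 2) <= e * enorm y by rewrite ler_pM2l //; lra.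
  have h6 : 0 < e * enorm x by rewrite mulr_gt0.
  by lra.
have [|u' [/FE[x [y [_ [_ _ far]]]] uu']] := close (eta / n.+1%:R / 2).
  by rewrite !divr_gt0.
have := far u dirAB.1 dirAB.2.
by rewrite nK in uu'; lra.
Qed.

Lemma dim_geW T m k (P : env T -> Prop) e : dim_ge m k.+1 P e -> dim_ge m k P e.
Proof.
elim: m k P => [|m IH] k P /=; first by case.
by case=> [/IH|h]; left => //; apply: dim_geS h => e' /infR_ex.
Qed.

(** A bi-Lipschitz map does not preserve spheres, so directions are compared
    through the part of the cone between two spheres. *)
Definition cone_shell n (M : set 'rV[R]_n) (b c : R) : set 'rV[R]_n :=
  [set x | b <= enorm x /\ (enorm x <= c /\ exists2 v, M v & x = enorm x *: v)].

Lemma D_cone_shell n (M : set 'rV[R]_n) b c : D M -> D (cone_shell M b c).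
Proof.
move=> DM; apply: (dset_D oD).
have d : dset D (fun e => b <= enorm (rvec n e) /\ (enorm (rvec n e) <= c /\
  exists v : 'rV[R]_n, M v /\ forall i, rvec n e 0 i = (enorm (rvec n e) *: v) 0 i)) by ddef.
apply: (dset_ext d) => e; split => -[h1 [h2]].
  by move=> [v [Mv /rowP h]]; split => //; split => //; exists v.
by move=> [v Mv h]; split => //; split => //; exists v; split => // i; rewrite {1}h.
Qed.

Definition cylinder n (M : set 'rV[R]_n) (b c : R) : set 'rV[R]_n.+1 :=
  [set z | M (proj_init z) /\ (b <= z 0 ord_max /\ z 0 ord_max <= c)].

Lemma cylinder_dim n (M : set 'rV[R]_n) b c k : b < c ->
  sdim_ge k.+1 (cylinder M b c) <-> sdim_ge k M.
Proof.
move=> bc; rewrite /sdim_ge /cylinder /=; split.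
  case=> [/dim_geW h|h]; apply: dim_geS h => e.
    by move=> [y]; rewrite proj_init_rvec => -[].
  by move=> /infR_ex[y]; rewrite proj_init_rvec => -[].
move=> h; right; apply: dim_geS h => e Me.
apply: (itv_infinite bc) => y /andP[h1 h2].
by rewrite proj_init_rvec rvec_last /=; split => //; rewrite !ltW.
Qed.

(** Polar coordinates identify the shell with a cylinder over [M]. *)
Lemma cone_shell_dim n (M : set 'rV[R]_n) b c k : D M -> (forall v, M v -> enorm v = 1) ->
  0 < b -> b < c -> sdim_ge k.+1 (cone_shell M b c) <-> sdim_ge k M.
Proof.
move=> DM M1 b0 bc; rewrite -(cylinder_dim M k bc).
pose G (z : 'rV[R]_n.+1) (x : 'rV[R]_n) := cylinder M b c z /\ forall i, x 0 i = (z 0 ord_max *: proj_init z) 0 i.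
have GE z x : G z x <-> cylinder M b c z /\ x = z 0 ord_max *: proj_init z.
  by split=> -[h1 h2]; split => //; [exact/rowP|rewrite h2].
have Gn z x : G z x -> enorm x = z 0 ord_max.
  move=> /GE[[Mz [bz zc]] ->]; rewrite enormZ M1 // mulr1 ger0_norm //.
  by rewrite (le_trans _ bz) // ltW.
split => h.
  have : sdim_ge k.+1 [set z | exists x, G z x]; last by apply: sdim_geS => z [x []].
  apply: (sdim_ge_map oD).
  - by rewrite /G /cylinder; ddef.
  - by move=> z x x' /GE[_ ->] /GE[_ ->].
  apply: sdim_geS h => x [bx [xc [v Mv xv]]]; exists (rsnoc v (enorm x)); apply/GE.
  by rewrite /cylinder /= proj_init_rsnoc rsnoc_last.
have : sdim_ge k.+1 [set x | exists z, G z x].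
  apply: (sdim_ge_map oD (G := fun x z => G z x)).
  - by rewrite /G /cylinder; ddef.
  - move=> x z z' Gz Gz'; have nz := Gn _ _ Gz; have nz' := Gn _ _ Gz'.
    have [[_ [bz _]] xz] := (GE _ _).1 Gz; have [_ xz'] := (GE _ _).1 Gz'.
    rewrite -[z]rsnocE -[z']rsnocE -nz -nz'; congr rsnoc.
    move: xz; rewrite xz' -nz -nz' => /(scalerI _)->//.
    by rewrite nz gt_eqF // (lt_le_trans b0).
  apply: sdim_geS h => z Cz; exists (z 0 ord_max *: proj_init z); exact/GE.
apply: sdim_geS => x [z Gz]; rewrite /cone_shell /= (Gn _ _ Gz).
by have [[Mz [bz zc]] xz] := (GE _ _).1 Gz; split => //; split => //; exists (proj_init z).
Qed.

End Directions.

(** * Transport of common directions *)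

Section Transfer.
Variables (R : archiRcfType) (D : set_family R).
Hypothesis oD : o_minimal D.

(** The relation [Psi] is the germ of a bi-Lipschitz map, given by its graph so
    that the statement applies to the inverse map as well.  For [w] on the
    cone over the common directions of [A] and [B], the points [x] of [A] and
    [y] of [B] near [t w] have images [x'] and [y'] with [x'] almost parallel
    to a common direction [u] of [A'] and [B']; the approximate embedding maps
    [w] to the multiple of [u] of length [enorm x' / t]. *)
Lemma direction_transfer n k (A B A' B' : set 'rV[R]_n) (Psi : 'rV[R]_n -> 'rV[R]_n -> Prop)
    (K1 K2 rho : R) :
  D A -> D B -> D A' -> D B' -> 0 < K1 -> 0 < K2 -> 0 < rho -> Psi 0 0 ->
  (forall x x' y y', Psi x x' -> Psi y y' ->
     K1 * enorm (x - y) <= enorm (x' - y') <= K2 * enorm (x - y)) ->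
  (forall x, A x -> enorm x < rho -> exists2 x', A' x' & Psi x x') ->
  (forall x, B x -> enorm x < rho -> exists2 x', B' x' & Psi x x') ->
  sdim_ge k (direction A `&` direction B) -> sdim_ge k (direction A' `&` direction B').
Proof.
move=> DA DB DA' DB' K10 K20 rho0 Psi0 lip PA PB.
have Dcap (X Y : set 'rV[R]_n) : D X -> D Y -> D (direction X `&` direction Y).
  move=> DX DY; have dX := D_direction oD DX; have dY := D_direction oD DY.
  by apply: (dset_D oD); ddef.
have norm1 (X Y : set 'rV[R]_n) v : (direction X `&` direction Y) v -> enorm v = 1.
  by move=> [[]].
have b1 : 0 < K1 / 2 by rewrite divr_gt0.
have b2 : K1 / 2 < K1 + 3 * K2 by lra.
rewrite -(cone_shell_dim oD k (Dcap A B DA DB) (@norm1 A B) ltr01 (ltr1n R 2)).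
rewrite -(cone_shell_dim oD k (Dcap A' B' DA' DB') (@norm1 A' B') b1 b2).
have DX := D_cone_shell oD 1 2 (Dcap A B DA DB).
have DY := D_cone_shell oD (K1 / 2) (K1 + 3 * K2) (Dcap A' B' DA' DB').
apply: (sdim_ge_approx oD DX DY K10 K20 (M := K1 + 3 * K2)).
  by move=> y [_ [h _]] i; apply: le_trans h; exact: enorm_coord.
move=> I w c hw c0.
have K2n : K2 != 0 by rewrite gt_eqF.
(* The constants [eta] and [d] make the errors on directions and on positions at
   most [c / 2] each. *)
pose eta := c / (12 * K2).
have eta0 : 0 < eta by rewrite divr_gt0 ?mulr_gt0.
have etac : 3 * K2 * eta = c / 4 by rewrite /eta; field.
have [e e0 he] := common_direction oD DA' DB' eta0.
pose d := Order.min (Order.min (1 / 2) (e * K1 / (4 * K2))) (Order.min (c / (4 * K2)) (c / (4 * K1))).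
have d0 : 0 < d by rewrite !lt_min !divr_gt0 ?mulr_gt0 ?ltr01.
have d1 : d <= 1 / 2 by rewrite !ge_min lexx.
have d2 : 2 * K2 * d <= e * (K1 / 2).
  have -> : e * (K1 / 2) = 2 * K2 * (e * K1 / (4 * K2)) by field.
  by rewrite ler_pM2l ?mulr_gt0 // !ge_min lexx orbT.
have d3 : 2 * (K2 * d) <= c / 2.
  have -> : c / 2 = 2 * (K2 * (c / (4 * K2))) by field.
  by rewrite !ler_pM2l // !ge_min lexx !orbT.
have d4 : 2 * (K1 * d) <= c / 2.
  have K1n : K1 != 0 by rewrite gt_eqF.
  have -> : c / 2 = 2 * (K1 * (c / (4 * K1))) by field.
  by rewrite !ler_pM2l // !ge_min lexx !orbT.
pose t1 := Order.min (rho / 4) (e / (4 * K2)).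
have t10 : 0 < t1 by rewrite lt_min !divr_gt0 ?mulr_gt0.
have ray (X : set 'rV[R]_n) i : D X -> (forall v, (direction A `&` direction B) v -> direction X v) ->
  exists2 t0 : R, 0 < t0 & forall t, 0 < t -> t < t0 ->
    exists2 x, X x & enorm (x - t *: w i) < d * t.
  move=> DX' sub; have [w1 [_ [v /sub Xv ->]]] := hw i.
  by apply: (sequence_selection oD DX' Xv _ d0); lra.
have [t t0 ht] : exists2 t, 0 < t & forall i : I, [/\ t <= t1,
    exists2 x, A x & enorm (x - t *: w i) < d * t &
    exists2 y, B y & enorm (y - t *: w i) < d * t].
  apply: common_threshold => i.
  have [ta ta0 hta] := ray A i DA (fun v h => h.1).
  have [tb tb0 htb] := ray B i DB (fun v h => h.2).
  exists (Order.min t1 (Order.min ta tb / 2)).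
    by rewrite lt_min t10 divr_gt0 // lt_min ta0.
  move=> t t0; rewrite le_min => /andP[tt1 tt2].
  have tmin : t < Order.min ta tb.
    by apply: le_lt_trans tt2 _; rewrite ltr_pdivrMr // ltr_pMr ?ltr1n // lt_min ta0.
  by move: tmin; rewrite lt_min => /andP[tta ttb]; split => //; [exact: hta|exact: htb].
have img i : exists x' phi, [/\ exists2 x, Psi x x' & enorm (x - t *: w i) < d * t,
    cone_shell (direction A' `&` direction B') (K1 / 2) (K1 + 3 * K2) phi &
    enorm (x' - t *: phi) <= c / 4 * t].
  have [tt1 [x Ax xw] [y By yw]] := ht i.
  have [w1 [w2 _]] := hw i.
  have tw : enorm (t *: w i) = t * enorm (w i) by rewrite enormZ gtr0_norm.
  have tw1 : t <= t * enorm (w i) by rewrite -[leLHS]mulr1 ler_pM2l.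
  have tw2 : t * enorm (w i) <= t * 2 by rewrite ler_pM2l.
  have dt : d * t <= t / 2 by rewrite mulrC ler_pM2l //; lra.
  have tr : t <= rho / 4 by apply: le_trans tt1 _; rewrite ge_min lexx.
  have te : 4 * K2 * t <= e.
    have -> : e = 4 * K2 * (e / (4 * K2)) by field.
    by rewrite ler_pM2l ?mulr_gt0 //; apply: le_trans tt1 _; rewrite ge_min lexx orbT.
  have x1 := enorm_sub_ge x (t *: w i).
  have x2 := enorm_sub_ge (t *: w i) x; rewrite enormB in x2.
  have y1 := enorm_sub_ge y (t *: w i).
  have [|x' A'x' xx'] := PA x Ax; first by lra.
  have [|y' B'y' yy'] := PB y By; first by lra.
  have /andP[l1 l2] := lip _ _ _ _ xx' Psi0; rewrite !subr0 in l1 l2.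
  have xlo : t / 2 <= enorm x by lra.
  have xhi : enorm x <= 3 * t by lra.
  have m1 : K1 * (t / 2) <= K1 * enorm x by rewrite ler_pM2l.
  have m2 : K2 * enorm x <= K2 * (3 * t) by rewrite ler_pM2l.
  have K1t : 0 < K1 * t by rewrite mulr_gt0.
  have K2t : 0 < K2 * t by rewrite mulr_gt0.
  have x'0 : 0 < enorm x' by lra.
  have x'e : enorm x' < e by lra.
  have /andP[_ l3] := lip _ _ _ _ xx' yy'.
  have xy : enorm (x - y) <= 2 * (d * t).
    by have := enorm_triangle x (t *: w i) y; rewrite (enormB (t *: w i) y); lra.
  have m3 : K2 * enorm (x - y) <= K2 * (2 * (d * t)) by rewrite ler_pM2l.
  have m4 : 2 * K2 * d * t <= e * (K1 / 2) * t by rewrite ler_pM2r.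
  have m5 : e * (K1 / 2 * t) <= e * enorm x' by rewrite ler_pM2l //; lra.
  have [|u [dAu dBu] hu] := he x' y' A'x' B'y' x'0 x'e; first by lra.
  exists x', ((enorm x' / t) *: u); split; first by exists x.
    have u1 : enorm u = 1 by case: dAu.
    have p0 : 0 < enorm x' / t by rewrite divr_gt0.
    rewrite /cone_shell /= enormZ u1 mulr1 gtr0_norm //; split.
      by rewrite ler_pdivlMr //; lra.
    split; last by exists u.
    by rewrite ler_pdivrMr //; lra.
  rewrite scalerA mulrC divfK ?gt_eqF //; apply: le_trans hu _.
  have -> : c / 4 * t = eta * (3 * K2 * t) by rewrite -etac; ring.
  by rewrite ler_pM2l //; lra.
have [x' hx'] := choice img; have [phi hphi] := choice hx'.
exists phi; split => [i|i j]; first by have [] := hphi i.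
have [[x px xw] _ fx] := hphi i; have [[y py yw] _ fy] := hphi j.
have /andP[l1 l2] := lip _ _ _ _ px py.
have scale a b : enorm (t *: a - t *: b) = t * enorm (a - b).
  by rewrite -scalerBr enormZ gtr0_norm.
have tri (p q p' q' : 'rV[R]_n) : enorm (p - q) <= enorm (p - p') + enorm (p' - q') + enorm (q - q').
  apply: le_trans (enorm_triangle _ p' _) _; rewrite -addrA lerD2l.
  by rewrite [enorm (q - _)]enormB; exact: enorm_triangle.
have a1 := tri x y (t *: w i) (t *: w j); rewrite scale in a1.
have a2 := tri (t *: w i) (t *: w j) x y; rewrite scale !(enormB (t *: w _)) in a2.
have a3 := tri (x' i) (x' j) (t *: phi i) (t *: phi j); rewrite scale in a3.
have a4 := tri (t *: phi i) (t *: phi j) (x' i) (x' j); rewrite scale !(enormB (t *: phi _)) in a4.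
have b3 : K2 * enorm (x - y) <= K2 * (t * enorm (w i - w j) + 2 * (d * t)).
  by rewrite ler_pM2l //; lra.
have b4 : K1 * (t * enorm (w i - w j) - 2 * (d * t)) <= K1 * enorm (x - y).
  by rewrite ler_pM2l //; lra.
have d3t : 2 * (K2 * d) * t <= c / 2 * t by rewrite ler_pM2r.
have d4t : 2 * (K1 * d) * t <= c / 2 * t by rewrite ler_pM2r.
apply/andP; split; rewrite -(ler_pM2l t0); lra.
Qed.

End Transfer.

Section Main.
Variables (R : archiRcfType) (D : set_family R).
Hypothesis oD : o_minimal D.

(** On definable sets, containing a [d]-cell and having dimension at least [d]
    are the same. *)
Lemma definable_dimE n (X Y : set 'rV[R]_n) : D X -> D Y ->
  (forall d, sdim_ge d X <-> sdim_ge d Y) -> definable_dim D X = definable_dim D Y.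
Proof.
move=> DX DY XY; rewrite /definable_dim; apply: eq_bigl => d.
have cellP (Z : set 'rV[R]_n) : D Z -> (exists2 C, cell D d C & C `<=` Z) <-> sdim_ge d Z.
  move=> DZ; split; last exact: sdim_ge_cell.
  by move=> [C cC CZ]; apply: sdim_geS CZ (cell_sdim_ge cC).
by apply: asbool_equiv_eq; rewrite !cellP.
Qed.

End Main.

Theorem theorem1p5 (R : archiRcfType) (D : set_family R) (n : nat)
    (A B : set 'rV[R]_n) (U V : set 'rV[R]_n) (h : 'rV[R]_n -> 'rV[R]_n)
    (oD : o_minimal D)
    (dA : definable_germ D A) (dB : definable_germ D B)
    (cA : adherent0 A) (cB : adherent0 B)
    (hh : bilipschitz_homeo_germ U V h)
    (dhA : definable_germ D (germ_image U h A))
    (dhB : definable_germ D (germ_image U h B)) :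
  definable_dim D (direction_set (germ_image U h A) `&`
                   direction_set (germ_image U h B)) =
  definable_dim D (direction_set A `&` direction_set B).
Proof.
have [oU oV [[hU hinj hV] hcont [gg gcont gK]] h00 [K1 [K2 [K10 K12 [W W0 [WU lip]]]]]] := hh.
have K20 : 0 < K2 by exact: lt_le_trans K12.
have U0 : U 0 by exact: nbhs_singleton (open_nbhs_nbhs oU).
have V0 : V 0 by exact: nbhs_singleton (open_nbhs_nbhs oV).
have W00 : W 0 by exact: nbhs_singleton W0.
have germ (X : set 'rV[R]_n) : definable_germ D X ->
    exists X', [/\ D n X', exists2 r : R, 0 < r & forall x, enorm x < r -> (X x <-> X' x) &
      direction_set X = direction X'].
  move=> [X' DX' /nbhs_enorm[r r0 hr]]; exists X'.
  have e x : enorm x < r -> (X x <-> X' x) by move=> xr; apply: hr; rewrite subr0.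
  split => //; first by exists r.
  rewrite direction_setE; apply/seteqP; split; apply: (direction_germ r0) => x /e[//].
have [A1 [DA1 [ra ra0 hA1] ->]] := germ _ dA.
have [B1 [DB1 [rb rb0 hB1] ->]] := germ _ dB.
have [A2 [DA2 [ra' ra0' hA2] ->]] := germ _ dhA.
have [B2 [DB2 [rb' rb0' hB2] ->]] := germ _ dhB.
have [rw rw0 hrw] := nbhs_enorm W0.
have Wsmall x : enorm x < rw -> W x by move=> xr; apply: hrw; rewrite subr0.
pose Psi x x' := W x /\ x' = h x.
have Psi0 : Psi 0 0 by split.
have lipPsi x x' y y' : Psi x x' -> Psi y y' ->
    K1 * enorm (x - y) <= enorm (x' - y') <= K2 * enorm (x - y).
  by move=> [Wx ->] [Wy ->]; exact: lip.
have hK x : W x -> enorm (h x) <= K2 * enorm x.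
  by move=> Wx; have /andP[_] := lip _ _ Wx W00; rewrite h00 !subr0.
have g0 : gg 0 = 0 by rewrite -{1}h00 gK.
(* The Lipschitz bounds hold on [W] only, and a point of the image of [U] that is
   close to 0 could come from outside [W]: continuity of the inverse excludes it. *)
have inv (r : R) : 0 < r -> exists2 r' : R, 0 < r' & forall x, V x -> enorm x < r' -> enorm (gg x) < r.
  move=> r0; move/subspace_continuousP: (gcont) => /(_ 0 V0).
  rewrite /from_subspace g0 => /cvgrPdist_lt /(_ (r / n.+1%:R)).
  rewrite divr_gt0 ?ltr0n // => /(_ isT); rewrite near_withinE => /nbhs_enorm[r' r'0 hr'].
  exists r' => // x Vx xr; have := hr' x; rewrite subr0 => /(_ xr Vx) /=.
  rewrite sub0r normrN ltr_pdivlMr ?ltr0n // => hx.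
  apply: le_lt_trans (ler_enorm_norm _) _; apply: le_lt_trans hx.
  by rewrite mulrC ler_wpM2l ?normr_ge0 // ler_nat.
have fwd (X X1 X2 : set 'rV[R]_n) (r1 r2 : R) : 0 < r1 -> 0 < r2 ->
    (forall x, enorm x < r1 -> (X x <-> X1 x)) ->
    (forall x, enorm x < r2 -> (germ_image U h X x <-> X2 x)) ->
  exists2 rho : R, 0 < rho & forall x, X1 x -> enorm x < rho -> exists2 x', X2 x' & Psi x x'.
  move=> r10 r20 h1 h2; exists (Order.min rw (Order.min r1 (r2 / K2))).
    by rewrite !lt_min rw0 r10 divr_gt0.
  move=> x X1x; rewrite !lt_min => /and3P[x1 x2 x3].
  have Wx := Wsmall _ x1; exists (h x); last by split.
  apply/h2; first by apply: le_lt_trans (hK _ Wx) _; rewrite mulrC -ltr_pdivlMr.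
  by exists x => //; split; [apply/h1|exact: WU].
have bwd (X X1 X2 : set 'rV[R]_n) (r1 r2 : R) : 0 < r1 -> 0 < r2 ->
    (forall x, enorm x < r1 -> (X x <-> X1 x)) ->
    (forall x, enorm x < r2 -> (germ_image U h X x <-> X2 x)) ->
  exists2 rho : R, 0 < rho & forall x, X2 x -> enorm x < rho -> exists2 x', X1 x' & Psi x' x.
  move=> r10 r20 h1 h2.
  have [|r' r'0 hr'] := inv (Order.min rw r1); first by rewrite lt_min rw0.
  exists (Order.min r2 r'); first by rewrite lt_min r20.
  move=> x X2x; rewrite lt_min => /andP[x1 x2].
  have [a [Xa Ua] ha] := (h2 _ x1).2 X2x.
  have Vx : V x by rewrite -ha; exact: hU.
  have := hr' x Vx x2; rewrite -ha gK // lt_min => /andP[a1 a2].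
  by exists a; [apply/h1|split => //; exact: Wsmall].
have Dcap (X Y : set 'rV[R]_n) : D n X -> D n Y -> D n (direction X `&` direction Y).
  move=> DX DY; have dX := D_direction oD DX; have dY := D_direction oD DY.
  by apply: (dset_D oD); ddef.
apply: (definable_dimE oD); [exact: Dcap|exact: Dcap|move=> d; split].
  have [r1 r10 h1] := bwd _ _ _ _ _ ra0 ra0' hA1 hA2.
  have [r2 r20 h2] := bwd _ _ _ _ _ rb0 rb0' hB1 hB2.
  apply: (@direction_transfer R D oD n d A2 B2 A1 B1 (fun x' x => Psi x x')
    K2^-1 K1^-1 (Order.min r1 r2)); rewrite ?invr_gt0 ?lt_min ?r10 //.
  - move=> x' x y' y px py; have /andP[l1 l2] := lipPsi _ _ _ _ px py.
    by rewrite mulrC ler_pdivrMr // [_ * K2]mulrC l2 mulrC ler_pdivlMr // mulrC l1.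
  - by move=> x Xx; rewrite lt_min => /andP[? _]; exact: h1.
  - by move=> x Xx; rewrite lt_min => /andP[_ ?]; exact: h2.
have [r1 r10 h1] := fwd _ _ _ _ _ ra0 ra0' hA1 hA2.
have [r2 r20 h2] := fwd _ _ _ _ _ rb0 rb0' hB1 hB2.
apply: (@direction_transfer R D oD n d A1 B1 A2 B2 Psi K1 K2 (Order.min r1 r2));
  rewrite ?lt_min ?r10 //.
- by move=> x Xx; rewrite lt_min => /andP[? _]; exact: h1.
- by move=> x Xx; rewrite lt_min => /andP[_ ?]; exact: h2.
Qed.
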